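(* Let $G$ be a finitely generated group such that for some $i\in\mathbb{N}$ the subgroup $\gamma_i(G)$ is e-definable in $G$ (in particular, this holds if $\gamma_i(G)$ has finite verbal width) and $G/\gamma_i(G)$ is not virtually abelian. Then there exists a ring of algebraic integers $O$ that is e-interpretable in $G$, and hence $\mathcal{D}(O)\leq_P\mathcal{D}(G)$.
   Context: $\gamma_1(G)=G$ and $\gamma_{i+1}(G)=[\gamma_i(G),G]$ is the lower central series; $\gamma_i(G)$ is generated by the set of left-normed commutators $[g_1,\dots,g_i]$, $g_j\in G$, where $[x,y]=x^{-1}y^{-1}xy$. $\gamma_i(G)$ has finite verbal width if there is $n$ such that every element of $\gamma_i(G)$ is a product of at most $n$ elements of the form $[g_1,\dots,g_i]^{\pm1}$. A group is virtually abelian if it has an abelian subgroup of finite index. A ring of algebraic integers is the integral closure of $\mathbb{Z}$ in a finite field extension of $\mathbb{Q}$. An equation in a group $G$ (respectively ring $R$) is an equality of two terms built from variables and elements of $G$ (resp. $R$), called coefficients; coefficients may be arbitrary elements. A system of equations is a finite conjunction of equations. A subset $X\subseteq G^m$ is e-definable in $G$ if there is a finite system $\Sigma(\mathbf{x},\mathbf{y})$ of equations with coefficients in $G$, $\mathbf x=(x_1,\dots,x_m)$, $\mathbf y=(y_1,\dots,y_k)$, such that for every $\mathbf{a}\in G^m$ one has $\mathbf{a}\in X$ if and only if $\Sigma(\mathbf{a},\mathbf{y})$ has a solution $\mathbf{y}\in G^k$. A ring $R$ is e-interpretable in $G$ if for some $m$ there are an e-definable set $X\subseteq G^m$ and a surjective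 map $\phi:X\to R$ such that the preimages under $\phi$ of the equality relation of $R$ and of the graphs of the addition and multiplication of $R$ are e-definable in $G$. For a finitely generated structure $\mathcal{M}$ (group or ring), the Diophantine problem $\mathcal{D}(\mathcal{M})$ is the problem of deciding, given a finite system of equations with coefficients in $\mathcal{M}$ (given as terms in a fixed finite generating set), whether it has a solution in $\mathcal{M}$. $\mathcal{D}(\mathcal{A})\leq_P\mathcal{D}(\mathcal{B})$ means that there is a polynomial-time algorithm transforming each finite system $\Sigma$ in $\mathcal{A}$ into a finite system $\Sigma^*$ in $\mathcal{B}$ such that $\Sigma$ has a solution in $\mathcal{A}$ if and only if $\Sigma^*$ has a solution in $\mathcal{B}$. *)

(* Defs.v *)
From HB Require Import structures.
From mathcomp Require Import all_boot all_order all_algebra all_field.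
From mathcomp Require Import boolp classical_sets functions cardinality.

Set Implicit Arguments.
Unset Strict Implicit.
Unset Printing Implicit Defensive.

Import GRing.Theory.

Local Open Scope classical_set_scope.

Section Groups.
Local Open Scope group_scope.

Definition is_subgroup (G : groupType) (H : set G) : Prop :=
  [/\ H 1, forall x y, H x -> H y -> H (x * y) & forall x, H x -> H x^-1].

Record normalSubgroup (G : groupType) := NormalSubgroup {
  normal_set : set G;
  normal_subgroup : is_subgroup normal_set;
  normal_conj : forall x y, normal_set x -> normal_set (x ^ y)
}.

Definition generated (G : groupType) (A : set G) : set G :=
  smallest (@is_subgroup G) A.

(** The lower central series is indexed from 1, as in the literature;
    the value at 0 is a dummy. *)
Fixpoint gamma (G : groupType) (i : nat) : set G :=
  if i is j.+1 then
    if j is 0 then [set: G]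
    else generated [set [~ x, g] | x in @gamma G j & g in [set: G]]
  else [set: G].

#[global] Arguments gamma G i : clear implicits.

Definition left_normed (G : groupType) (s : seq G) : G :=
  if s is g :: s' then foldl (fun x y => [~ x, y]) g s' else 1.

Definition gamma_generators (G : groupType) (i : nat) : set G :=
  [set c | exists s : i.-tuple G, c = left_normed s].

#[global] Arguments gamma_generators G i : clear implicits.

Definition finite_verbal_width (G : groupType) (i : nat) : Prop :=
  exists n, forall x, gamma G i x ->
    exists s : seq G,
      [/\ (size s <= n)%N,
          forall y, y \in s ->
            gamma_generators G i y \/ gamma_generators G i y^-1
        & x = \prod_(y <- s) y].

Definition virtually_abelian (G : groupType) : Prop :=
  exists H : set G,
    [/\ is_subgroup H,
        forall x y, H x -> H y -> x * y = y * x
      & finite_set [set [set g * h | h in H] | g in [set: G]]].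

Lemma generated_subgroup (G : groupType) (A : set G) :
  is_subgroup (generated A).
Proof.
split=> [H [[]] //|x y Ax Ay H HA|x Ax H HA].
- by have [[_ + _] _] := HA; apply; [apply: Ax | apply: Ay].
- by have [[_ _ +] _] := HA; apply; apply: Ax.
Qed.

Lemma gamma_subgroup (G : groupType) i : is_subgroup (gamma G i).
Proof. by case: i => [|[|i]]; [split| split|apply: generated_subgroup]. Qed.

Lemma gamma_conj (G : groupType) i x y : gamma G i x -> gamma G i (x ^ y).
Proof.
elim: i x y => [//|[//|i] IH] x y /= gx H HA; have [[H1 HM HV] sAH] := HA.
suff: [set z | H (z ^ y)] x by [].
apply: gx; split; first split=> /=.
- by rewrite conj1g.
- by move=> u v Hu Hv; rewrite conjMg; apply: HM.
- by move=> u Hu; rewrite conjVg; apply: HV.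
move=> _ [u gu [g _ <-]] /=; rewrite conjRg; apply: sAH.
by exists (u ^ y); [apply: IH | exists (g ^ y)].
Qed.

Definition gamma_normal (G : groupType) (i : nat) : normalSubgroup G :=
  NormalSubgroup (gamma_subgroup G i) (@gamma_conj G i).

End Groups.

Section QuotientGroup.
Local Open Scope group_scope.
Local Open Scope quotient_scope.
Variables (G : groupType) (N : normalSubgroup G).

Definition eqmodN (x y : G) : bool := `[< normal_set N (x^-1 * y) >].

Lemma eqmodN_refl : reflexive eqmodN.
Proof. by move=> x; apply/asboolP; rewrite mulVg; case: (normal_subgroup N). Qed.

Lemma eqmodN_sym : symmetric eqmodN.
Proof.
move=> x y; apply/asboolP/asboolP; case: (normal_subgroup N) => _ _ NV /NV;
  by rewrite invgM invgK.
Qed.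

Lemma eqmodN_trans : transitive eqmodN.
Proof.
move=> y x z /asboolP Nxy /asboolP Nyz; apply/asboolP.
have [_ NM _] := normal_subgroup N.
by have := NM _ _ Nxy Nyz; rewrite mulgA mulgK.
Qed.

Canonical eqmodN_equiv := EquivRel eqmodN eqmodN_refl eqmodN_sym eqmodN_trans.

Definition quot := {eq_quot eqmodN}.

HB.instance Definition _ := EqQuotient.on quot.
HB.instance Definition _ := Choice.on quot.

Definition quot_one : quot := \pi_quot 1.
Definition quot_mul (x y : quot) : quot := \pi_quot (repr x * repr y).
Definition quot_inv (x : quot) : quot := \pi_quot (repr x)^-1.

Lemma quot_piP (x y : G) :
  (\pi_quot x = \pi_quot y) <-> normal_set N (x^-1 * y).
Proof. by split=> [/eqmodP/asboolP|Nxy] //; apply/eqmodP/asboolP. Qed.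

Lemma quot_repr_piP (x : G) : normal_set N ((repr (\pi_quot x))^-1 * x).
Proof. by apply/quot_piP; rewrite reprK. Qed.

Lemma quot_mul_pi (x y : G) : quot_mul (\pi x) (\pi y) = \pi_quot (x * y).
Proof.
apply/quot_piP; have [_ NM _] := normal_subgroup N.
have Nx := normal_conj y (quot_repr_piP x); have Ny := quot_repr_piP y.
by have := NM _ _ Ny Nx; rewrite conjgE invgM !mulgA mulgK.
Qed.

Lemma quot_inv_pi (x : G) : quot_inv (\pi x) = \pi_quot x^-1.
Proof.
apply/quot_piP; have [_ NM NV] := normal_subgroup N.
have := normal_conj x^-1 (NV _ (quot_repr_piP x)).
by rewrite conjgE !invgM !invgK !mulgA mulgV mul1g.
Qed.

Lemma quot_mulA : associative quot_mul.
Proof.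
by elim/quotW=> x; elim/quotW=> y; elim/quotW=> z; rewrite !quot_mul_pi mulgA.
Qed.

Lemma quot_mul1 : left_id quot_one quot_mul.
Proof. by elim/quotW=> x; rewrite quot_mul_pi mul1g. Qed.

Lemma quot_mulr1 : right_id quot_one quot_mul.
Proof. by elim/quotW=> x; rewrite quot_mul_pi mulg1. Qed.

Lemma quot_mulV : left_inverse quot_one quot_inv quot_mul.
Proof. by elim/quotW=> x; rewrite quot_inv_pi quot_mul_pi mulVg. Qed.

Lemma quot_mulrV : right_inverse quot_one quot_inv quot_mul.
Proof. by elim/quotW=> x; rewrite quot_inv_pi quot_mul_pi mulgV. Qed.

HB.instance Definition _ :=
  isGroup.Build quot quot_mulA quot_mul1 quot_mulr1 quot_mulV quot_mulrV.

End QuotientGroup.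

Definition quotient_group (G : groupType) (N : normalSubgroup G) : groupType :=
  quot N.

Section AlgebraicIntegers.
Local Open Scope ring_scope.
Variable L : fieldExtType rat.

Definition integral_pred : {pred L} :=
  [pred x : L | `[< integralOver (intr : int -> L) x >]].

Fact integral_subring : subring_closed integral_pred.
Proof.
split=> [|x y|x y]; rewrite !inE.
- exact: integral1.
- exact: integral_sub.
- exact: integral_mul.
Qed.

HB.instance Definition _ :=
  GRing.isSubringClosed.Build L integral_pred integral_subring.

Record ring_of_integers := AlgInteger {
  algint_val :> L;
  algint_valP : algint_val \in integral_pred
}.

HB.instance Definition _ := [isSub for algint_val].
HB.instance Definition _ := [Choice of ring_of_integers by <:].
HB.instance Definition _ :=
  [SubChoice_isSubComNzRing of ring_of_integers by <:].

End AlgebraicIntegers.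

Record signature := Signature {
  nullary : finType;
  unary : finType;
  binary : finType
}.

Record structure (S : signature) := Structure {
  carrier :> Type;
  op0 : nullary S -> carrier;
  op1 : unary S -> carrier -> carrier;
  op2 : binary S -> carrier -> carrier -> carrier
}.

Arguments op0 {S s} _.
Arguments op1 {S s} _ _.
Arguments op2 {S s} _ _ _.

(** Terms with coefficients (or names of coefficients) in [C] and variables
    in [V]. *)
Inductive term (S : signature) (C V : Type) : Type :=
| Var of V
| Coef of C
| Op0 of nullary S
| Op1 of unary S & term S C V
| Op2 of binary S & term S C V & term S C V.

Definition system (S : signature) (C V : Type) : Type :=
  seq (term S C V * term S C V).

Section Semantics.
Variables (S : signature) (M : structure S) (C V : Type).
Variables (c : C -> M) (v : V -> M).

Fixpoint eval (t : term S C V) : M :=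
  match t with
  | Var x => v x
  | Coef a => c a
  | Op0 o => op0 o
  | Op1 o t1 => op1 o (eval t1)
  | Op2 o t1 t2 => op2 o (eval t1) (eval t2)
  end.

Fixpoint satisfies (E : system S C V) : Prop :=
  if E is (t, u) :: E' then eval t = eval u /\ satisfies E' else True.

End Semantics.

Definition group_signature : signature := @Signature unit unit unit.

Definition group_structure (G : groupType) : structure group_signature :=
  @Structure group_signature G
    (fun=> 1%g) (fun _ x => (x^-1)%g) (fun _ x y => (x * y)%g).

(** The language of unital rings: [0] and [1] (as [false] and [true]),
    opposite, sum and product (as [false] and [true]). *)
Definition ring_signature : signature := @Signature bool unit bool.

Definition ring_structure (R : nzRingType) : structure ring_signature :=
  @Structure ring_signature R
    (fun b => if b then 1%R else 0%R)
    (fun _ x => (- x)%R)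
    (fun b x y => if b then (x * y)%R else (x + y)%R).

Definition generates (S : signature) (M : structure S) (r : nat)
    (s : r.-tuple M) : Prop :=
  forall x : M, exists t : term S 'I_r void,
    eval (tnth s) (of_void M) t = x.

Definition finitely_generated (S : signature) (M : structure S) : Prop :=
  exists (r : nat) (s : r.-tuple M), generates s.

Definition e_definable (S : signature) (M : structure S) (m : nat)
    (X : set (m.-tuple M)) : Prop :=
  exists (k : nat) (E : system S M ('I_m + 'I_k)),
    forall a : m.-tuple M,
      X a <-> exists y : k.-tuple M,
        satisfies id (fun i => match i with
                               | inl j => tnth a j
                               | inr j => tnth y j
                               end) E.

Definition e_definable_in (G : groupType) (m : nat) (X : set (m.-tuple G)) :
  Prop := @e_definable group_signature (group_structure G) m X.

Definition as_unary (T : Type) (A : set T) : set (1.-tuple T) :=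
  [set a | A (thead a)].

(** [phi] is only used on [X]; its values elsewhere are irrelevant. *)
Definition e_interpretable (R : nzRingType) (G : groupType) : Prop :=
  exists (m : nat) (X : set (m.-tuple G)) (phi : m.-tuple G -> R),
    [/\ e_definable_in X,
        set_surj X [set: R] phi,
        e_definable_in [set t : (m + m).-tuple G | exists a b,
          [/\ X a, X b, t = [tuple of a ++ b] & phi a = phi b]],
        e_definable_in [set t : (m + (m + m)).-tuple G | exists a b c,
          [/\ X a, X b, X c, t = [tuple of a ++ b ++ c]
            & (phi a + phi b)%R = phi c]]
      & e_definable_in [set t : (m + (m + m)).-tuple G | exists a b c,
          [/\ X a, X b, X c, t = [tuple of a ++ b ++ c]
            & (phi a * phi b)%R = phi c]]].

Inductive move := Left | Stay | Right.

Section Machines.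
Variables A B : finType.

(** A deterministic machine with input alphabet [A], output alphabet [B],
    further work symbols, and [last_tape.+1] two-way infinite tapes; [None] is
    the blank symbol. The machine halts when [trans] returns [None]. *)
Record machine := Machine {
  work : finType;
  state : finType;
  last_tape : nat;
  start : state;
  trans : state ->
    {ffun 'I_last_tape.+1 -> option (A + B + work)} ->
    option (state *
      {ffun 'I_last_tape.+1 -> option (A + B + work) * move})
}.

Variable M : machine.

Definition cell : Type := option (A + B + work M).

(** The cells to the left of the head, nearest first, and the cells from the
    head rightwards; all cells not listed are blank. *)
Definition tape : Type := (seq cell * seq cell)%type.

Definition scanned (t : tape) : cell := head None t.2.

Definition act (t : tape) (a : cell * move) : tape :=
  match a.2 with
  | Left => (behead t.1, head None t.1 :: a.1 :: behead t.2)
  | Stay => (t.1, a.1 :: behead t.2)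
  | Right => (a.1 :: t.1, behead t.2)
  end.

Definition config : Type :=
  (state M * {ffun 'I_(last_tape M).+1 -> tape})%type.

Definition transition (c : config) :=
  @trans M c.1 [ffun i => scanned (c.2 i)].

Definition next (c : config) : config :=
  if transition c is Some (q, a)
  then (q, [ffun i => act (c.2 i) (a i)]) else c.

Definition initial (w : seq A) : config :=
  (start M,
   [ffun i => ([::],
      if i == ord0 then [seq Some (inl (inl x)) | x <- w] else [::])]).

(** The output is read on the last tape, from the head up to the first
    blank. *)
Definition output (c : config) : seq cell :=
  let r := (c.2 ord_max).2 in take (index None r) r.

Definition computes_within (w : seq A) (n : nat) (v : seq B) : Prop :=
  let c := iter n next (initial w) in
  transition c = None /\ output c = [seq Some (inl (inr x)) | x <- v].

End Machines.

Definition polynomial_time (A B : finType) (I J : Type)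
    (encI : I -> seq A) (encJ : J -> seq B) (f : I -> J) : Prop :=
  exists (M : machine A B) (p : {poly nat}), forall x : I,
    computes_within M (encI x) p.[size (encI x)]%R (encJ (f x)).

(** The variables are named by binary words and the coefficients are given by
    terms in [r] generators. A system is written as a word over [token S r]:
    each equation is [TokEq] followed by its two sides in Polish notation, the
    name of a variable being terminated by [TokEnd]. *)

Definition instance (S : signature) (r : nat) : Type := system S 'I_r bitseq.

Inductive token (S : signature) (r : nat) : Type :=
| TokBit of bool
| TokEnd
| TokEq
| TokGen of 'I_r
| TokOp0 of nullary S
| TokOp1 of unary S
| TokOp2 of binary S.

Section Tokens.
Variables (S : signature) (r : nat).

Definition token_code (x : token S r) :
    (bool + unit + unit + 'I_r + nullary S + unary S + binary S)%type :=
  match x with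
  | TokBit b => inl (inl (inl (inl (inl (inl b)))))
  | TokEnd => inl (inl (inl (inl (inl (inr tt)))))
  | TokEq => inl (inl (inl (inl (inr tt))))
  | TokGen i => inl (inl (inl (inr i)))
  | TokOp0 o => inl (inl (inr o))
  | TokOp1 o => inl (inr o)
  | TokOp2 o => inr o
  end.

Definition token_decode
    (x : (bool + unit + unit + 'I_r + nullary S + unary S + binary S)%type) :
    token S r :=
  match x with
  | inl (inl (inl (inl (inl (inl b))))) => TokBit S r b
  | inl (inl (inl (inl (inl (inr _))))) => TokEnd S r
  | inl (inl (inl (inl (inr _)))) => TokEq S r
  | inl (inl (inl (inr i))) => TokGen S i
  | inl (inl (inr o)) => TokOp0 r o
  | inl (inr o) => TokOp1 r o
  | inr o => TokOp2 r o
  end.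

Lemma token_codeK : cancel token_code token_decode.
Proof. by case. Qed.

HB.instance Definition _ := Finite.copy (token S r) (can_type token_codeK).

Fixpoint encode_term (t : term S 'I_r bitseq) : seq (token S r) :=
  match t with
  | Var x => rcons [seq TokBit S r b | b <- x] (TokEnd S r)
  | Coef i => [:: TokGen S i]
  | Op0 o => [:: TokOp0 r o]
  | Op1 o t1 => TokOp1 r o :: encode_term t1
  | Op2 o t1 t2 => TokOp2 r o :: encode_term t1 ++ encode_term t2
  end.

Definition encode (E : instance S r) : seq (token S r) :=
  flatten [seq TokEq S r :: encode_term e.1 ++ encode_term e.2 | e <- E].

End Tokens.

Definition has_solution (S : signature) (M : structure S) (r : nat)
    (s : r.-tuple M) (E : instance S r) : Prop :=
  exists v : bitseq -> M, satisfies (tnth s) v E.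

(** [D(M) <=_P D(N)], whatever finite generating sets are fixed. *)
Definition dioph_reducible (S T : signature)
    (M : structure S) (N : structure T) : Prop :=
  forall (r : nat) (s : r.-tuple M) (q : nat) (t : q.-tuple N),
    generates s -> generates t ->
    exists f : instance S r -> instance T q,
      polynomial_time (@encode S r) (@encode T q) f /\
      forall E, has_solution s E <-> has_solution t (f E).

(* Main.v *)
From HB Require Import structures.
Require Import Defs.
From mathcomp Require Import all_boot all_order all_algebra all_field.
From mathcomp Require Import spectral zify.
From mathcomp Require Import boolp classical_sets functions cardinality.

(** If [gamma_i(G)] has width [n], every element of it is a product of [n]
    terms [c c'^-1] with [c], [c'] left-normed commutators, so no disjunction is
    needed to define it.

    Let [W_0 = gamma_i(G)] and [W_(k+1) = {x | [x, G] <= W_k}]. All [W_k] are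
    e-definable because [G] is finitely generated, [W_(i-1) = G], and [W_1] has
    infinite index as [G / gamma_i(G)] is not virtually abelian. Choose [k] with
    [W_(k+1)] of infinite and [W_(k+2)] of finite index, and put [H = G / W_k],
    with center [Z] of infinite index and second center [Y] of finite index.
    Commutation is a pairing [Y x H -> Z], and [Y = <y_1, ..., y_n> Z]. An
    endomorphism of [Y / Z] with an adjoint for this pairing is given by a tuple
    [x] in [Y^n] such that [[x_i, g_j] = [y_i, w_j]] for some [w] in [H^r], where
    the [g_j] generate [H]; these equations and the analogous ones for the
    product interpret in [H] the ring [S] of such endomorphisms, and its center
    [S0] is cut out by commutation with finitely many additive generators of [S].
    An ideal of [S0] is e-definable since it is finitely generated.

    A common eigenvector of [S0] on [Hom(Y / Z, C)] gives a ring morphism [lam]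
    from [S0] to a number field [L] generated by [lam(S0)], and the trace form
    shows [d O_L <= lam(S0)] for some [d > 0]. Then [lam / d] maps the ideal
    [{P | lam(P) in d O_L}] onto [O_L], with kernel the ideal [ker lam].

    For the reduction, the nodes of the syntax trees of a system are named by
    their paths from the root, so that a machine reading the Polish notation from
    left to right needs no memory but the current path. *)

Set Implicit Arguments.
Unset Strict Implicit.
Unset Printing Implicit Defensive.

Import Order.TTheory GRing.Theory Num.Theory.

Local Open Scope classical_set_scope.

(** * Diophantine sets and interpretations *)

(** Equations cannot quantify over the exponents of a product of the [y_l], so the integer matrix of
    an endomorphism is never visible in [G]; only the tuple [x] of images and a witness [w] are. The
    witness is the adjoint on the generators, so for another tuple [x'] the commutators
    [[x'_i, w_j]] are those of the composite: this turns multiplication into equations. Ideals of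
    [S0] are used for the same reason: their elements are sums of [p_c R_c] with [R_c] in the
    definable ring [S0] instead of the integers.

    The [y_l] may satisfy relations modulo [Z], so [x] fixes its matrix only modulo these relations,
    and [S0] is commutative only modulo them. Functionals on [Y / Z] ignore both defects, and
    nonzero ones exist since [Y] has finite and [Z] infinite index.

    [lam(S0)] may be a proper subring of [O_L]; the interpreted ring is nevertheless all of [O_L],
    an element [z] being named by the scalars with [lam(P) = d z]. Equality in [O_L] is congruence
    modulo [ker lam], and a product carries one factor [d] too many, which is balanced by a [d]-th
    power. *)

Definition sumf (A B T : Type) (f : A -> T) (g : B -> T) (x : A + B) : T :=
  match x with inl a => f a | inr b => g b end.

Section Substitution.
Variables (S : signature) (C V C' V' : Type).

Fixpoint tsub (fc : C -> term S C' V') (fv : V -> term S C' V')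
    (t : term S C V) : term S C' V' :=
  match t with
  | Var x => fv x
  | Coef a => fc a
  | Op0 o => Op0 C' V' o
  | Op1 o t1 => Op1 o (tsub fc fv t1)
  | Op2 o t1 t2 => Op2 o (tsub fc fv t1) (tsub fc fv t2)
  end.

Definition ssub (fc : C -> term S C' V') (fv : V -> term S C' V')
    (E : system S C V) : system S C' V' :=
  [seq (tsub fc fv e.1, tsub fc fv e.2) | e <- E].

Variable M : structure S.

Lemma eval_tsub (c : C' -> M) (v : V' -> M) fc fv t :
  eval c v (tsub fc fv t) =
  eval (fun a => eval c v (fc a)) (fun x => eval c v (fv x)) t.
Proof. by elim: t => //= [o t ->|o t -> u ->]. Qed.

Lemma satisfies_ssub (c : C' -> M) (v : V' -> M) fc fv E :
  satisfies c v (ssub fc fv E) <->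
  satisfies (fun a => eval c v (fc a)) (fun x => eval c v (fv x)) E.
Proof. by elim: E => //= -[t u] E /= ->; rewrite !eval_tsub. Qed.

End Substitution.

Section Satisfaction.
Variables (S : signature) (M : structure S) (C V : Type).

Lemma eval_ext (c c' : C -> M) (v v' : V -> M) t :
  c =1 c' -> v =1 v' -> eval c v t = eval c' v' t.
Proof. by move=> ec ev; elim: t => //= [o t ->|o t -> u ->]. Qed.

Lemma eq_satisfies (c c' : C -> M) (v v' : V -> M) E :
  satisfies c v E -> c =1 c' -> v =1 v' -> satisfies c' v' E.
Proof.
move=> s ec ev; elim: E s => //= -[t u] E IH [e /IH]; split=> //.
by rewrite -!(eval_ext _ ec ev).
Qed.

Lemma satisfies_cat (c : C -> M) (v : V -> M) E F :
  satisfies c v (E ++ F) <-> satisfies c v E /\ satisfies c v F.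
Proof.
elim: E => [|[t u] E IH] /=; first by split=> [|[]].
by rewrite IH; split=> [[? []]|[[]]].
Qed.

End Satisfaction.

Section Diophantine.
Variables (S : signature) (M : structure S).

(** Variables are indexed by arbitrary types and witnesses by finite types, so that pairs of tuples
    and families of witnesses are sums and products of types; [e_definableP] returns to ordinals. *)
Definition diophantine (V : Type) (P : (V -> M) -> Prop) : Prop :=
  exists (W : finType) (E : system S M (V + W)),
    forall a, P a <-> exists y : W -> M, satisfies id (sumf a y) E.

Definition term_fun (V : Type) (F : (V -> M) -> M) : Prop :=
  exists t : term S M V, forall a, eval id a t = F a.

Variable V : Type.
Implicit Types P Q : (V -> M) -> Prop.

Lemma diophantine_ext P Q :
  (forall a, P a <-> Q a) -> diophantine P -> diophantine Q.
Proof. by move=> ePQ [W [E hE]]; exists W, E => a; rewrite -ePQ. Qed.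

Lemma term_fun_var x : term_fun (fun a : V -> M => a x).
Proof. by exists (Var S M x). Qed.

Lemma term_fun_const c : term_fun (fun _ : V -> M => c).
Proof. by exists (Coef S V c). Qed.

Lemma diophantine_eq (F F' : (V -> M) -> M) :
  term_fun F -> term_fun F' -> diophantine (fun a => F a = F' a).
Proof.
move=> [t tE] [u uE]; exists void.
exists (ssub (@Coef S M (V + void)) (fun x => Var S M (inl x)) [:: (t, u)]) => a.
rewrite -tE -uE; split=> [e|[y /satisfies_ssub /= []//]].
by exists (of_void M); apply/satisfies_ssub.
Qed.

Lemma diophantine_true : diophantine (fun _ : V -> M => True).
Proof. by exists void, [::] => a; split=> // _; exists (of_void M). Qed.

Lemma diophantine_and P Q :
  diophantine P -> diophantine Q -> diophantine (fun a => P a /\ Q a).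
Proof.
move=> [W1 [E1 h1]] [W2 [E2 h2]]; exists (W1 + W2)%type.
pose f1 (x : V + W1) := Var S M (match x with
  inl v => inl v | inr w => inr (inl w) end : V + (W1 + W2)).
pose f2 (x : V + W2) := Var S M (match x with
  inl v => inl v | inr w => inr (inr w) end : V + (W1 + W2)).
exists (ssub (@Coef _ _ _) f1 E1 ++ ssub (@Coef _ _ _) f2 E2) => a.
rewrite h1 h2; split=> [[[y1 s1] [y2 s2]]|[y]].
  exists (sumf y1 y2); apply/satisfies_cat; split; apply/satisfies_ssub.
    by apply: (eq_satisfies s1) => // -[].
  by apply: (eq_satisfies s2) => // -[].
move=> /satisfies_cat [/satisfies_ssub s1 /satisfies_ssub s2]; split.
  by exists (y \o inl); apply: (eq_satisfies s1) => // -[].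
by exists (y \o inr); apply: (eq_satisfies s2) => // -[].
Qed.

Lemma diophantine_all_in (I : eqType) (s : seq I) (P : I -> (V -> M) -> Prop) :
  (forall i, i \in s -> diophantine (P i)) ->
  diophantine (fun a => forall i, i \in s -> P i a).
Proof.
elim: s => [|i s IH] hP.
  by apply: diophantine_ext diophantine_true.
have hs : diophantine (fun a => forall j, j \in s -> P j a).
  by apply: IH => j js; apply: hP; rewrite inE js orbT.
apply: diophantine_ext (diophantine_and (hP i (mem_head _ _)) hs) => a.
split=> [[Pi Ps] j|Ps]; first by rewrite inE => /predU1P[->|/Ps].
by split=> [|j js]; apply: Ps; rewrite inE ?eqxx ?js ?orbT.
Qed.

Lemma diophantine_all (I : finType) (P : I -> (V -> M) -> Prop) :
  (forall i, diophantine (P i)) -> diophantine (fun a => forall i, P i a).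
Proof.
move=> hP; have := @diophantine_all_in I (enum I) P (fun i _ => hP i).
apply: diophantine_ext => a.
by split=> [h i|h i _]; apply: h; rewrite ?mem_enum.
Qed.

Lemma diophantine_ex (U : finType) (P : (V -> M) -> (U -> M) -> Prop) :
  diophantine (fun b : V + U -> M => P (b \o inl) (b \o inr)) ->
  diophantine (fun a => exists u, P a u).
Proof.
move=> [W [E hE]]; exists (U + W)%type.
pose f (x : V + U + W) := Var S M (match x with
  inl (inl v) => inl v | inl (inr u) => inr (inl u) | inr w => inr (inr w)
  end : V + (U + W)).
exists (ssub (@Coef _ _ _) f E) => a; split=> [[u]|[y /satisfies_ssub s]].
  move=> Pau; have /(hE (sumf a u)) [y s] : P (sumf a u \o inl) (sumf a u \o inr) by [].
  exists (sumf u y); apply/satisfies_ssub.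
  by apply: (eq_satisfies s) => // -[[]|].
exists (y \o inl).
have /(hE (sumf a (y \o inl))) : exists w : W -> M, satisfies id (sumf (sumf a (y \o inl)) w) E.
  by exists (y \o inr); apply: (eq_satisfies s) => // -[[]|].
by [].
Qed.

End Diophantine.

Section Diophantine2.
Variables (S : signature) (M : structure S).

Lemma diophantine_sub (V V' : Type) (P : (V -> M) -> Prop)
    (F : V -> (V' -> M) -> M) :
  diophantine P -> (forall x, term_fun (F x)) ->
  diophantine (fun a => P (fun x => F x a)).
Proof.
move=> [W [E hE]] /choice[t tE]; exists W.
pose f (x : V + W) : term S M (V' + W) := match x with
  | inl v => tsub (@Coef S M (V' + W)) (fun x => Var S M (inl x)) (t v)
  | inr w => Var S M (inr w) end.
exists (ssub (@Coef _ _ _) f E) => a; rewrite hE.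
split=> -[y s]; exists y.
  apply/satisfies_ssub; apply: (eq_satisfies s) => // -[v|w] //=.
  by rewrite eval_tsub /= -tE.
move/satisfies_ssub: s => s; apply: (eq_satisfies s) => // -[v|w] //=.
by rewrite eval_tsub /= -tE.
Qed.

Lemma e_definableP (m : nat) (X : set (m.-tuple M)) :
  e_definable X <-> diophantine (fun a : 'I_m -> M => X [tuple a i | i < m]).
Proof.
split=> [[k [E hE]]|[W [E hE]]].
  exists ('I_k : finType), E => a; rewrite hE; split=> -[y s].
    exists (tnth y); apply: (eq_satisfies s) => // -[i|i] //=.
    by rewrite tnth_mktuple.
  exists [tuple y i | i < k]; apply: (eq_satisfies s) => // -[i|i] //=;
    by rewrite tnth_mktuple.
exists #|W|.
pose f (x : 'I_m + W) : term S M ('I_m + 'I_#|W|) := Var S M (match x with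
  | inl v => inl v | inr w => inr (enum_rank w) end).
exists (ssub (@Coef _ _ _) f E) => a.
have -> : X a = X [tuple (tnth a) i | i < m].
  by congr X; apply: eq_from_tnth => i; rewrite tnth_mktuple.
rewrite hE; split=> -[y s].
  exists [tuple y (enum_val i) | i < #|W|]; apply/satisfies_ssub.
  apply: (eq_satisfies s) => // -[i|w] //=.
  by rewrite tnth_mktuple enum_rankK.
exists (fun w => tnth y (enum_rank w)); move/satisfies_ssub: s => s.
by apply: (eq_satisfies s) => // -[i|w].
Qed.

End Diophantine2.

Section GroupTerms.
Local Open Scope group_scope.
Variables (G : groupType) (V : Type).
Notation M := (group_structure G).
Implicit Types F : (V -> M) -> M.

Lemma term_fun_mul F F' :
  term_fun F -> term_fun F' -> term_fun (fun a => (F a : G) * F' a : M).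
Proof.
move=> [t tE] [u uE].
by exists (Op2 (tt : binary group_signature) t u) => a /=; rewrite tE uE.
Qed.

Lemma term_fun_inv F : term_fun F -> term_fun (fun a => (F a : G)^-1 : M).
Proof.
by move=> [t tE]; exists (Op1 (tt : unary group_signature) t) => a /=; rewrite tE.
Qed.

Lemma term_fun_comm F F' :
  term_fun F -> term_fun F' -> term_fun (fun a => [~ F a : G, F' a] : M).
Proof. by move=> tF tF'; do !apply: term_fun_mul => //; exact: term_fun_inv. Qed.

Lemma term_fun_prod (I : Type) (s : seq I) (F : I -> (V -> M) -> M) :
  (forall i, term_fun (F i)) ->
  term_fun (fun a => \prod_(i <- s) (F i a : G) : M).
Proof.
move=> hF; elim: s => [|i s [t tE]].
  by exists (Op0 M V (tt : nullary group_signature)) => a; rewrite big_nil.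
have [u uE] := hF i.
by exists (Op2 (tt : binary group_signature) u t) => a /=; rewrite big_cons tE uE.
Qed.

Lemma diophantine_mem (N : set G) F :
  e_definable_in (as_unary N) -> term_fun F ->
  diophantine (fun a => N (F a)).
Proof.
move=> /e_definableP dN tF.
have := diophantine_sub dN (fun _ : 'I_1 => tF).
by apply: diophantine_ext => a; rewrite /as_unary /= /thead tnth_mktuple.
Qed.

End GroupTerms.

(** * Definability of verbal subgroups of finite width *)

Section VerbalWidth.
Local Open Scope group_scope.
Variable G : groupType.

Lemma left_normed_rcons (s : seq G) x : s != [::] ->
  left_normed (rcons s x) = [~ left_normed s, x].
Proof. by case: s => // y s _; rewrite /= foldl_rcons. Qed.

Lemma left_normed_gamma (s : seq G) : s != [::] -> gamma G (size s) (left_normed s).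
Proof.
elim/last_ind: s => [//|s x IH] _; rewrite size_rcons.
have [->|s_n0] := eqVneq s [::]; first by [].
rewrite left_normed_rcons //; move: (IH s_n0).
case: s {IH} s_n0 => // y s _ /= gs H HA; have [_ sAH] := HA.
by apply: sAH; exists (left_normed (y :: s)) => //; exists x.
Qed.

Lemma left_normed1 n : left_normed (nseq n (1 : G)) = 1.
Proof.
case: n => //= n; elim: n => //= n IH.
by rewrite comm1g.
Qed.

Lemma subgroup_prod (H : set G) (I : Type) (s : seq I) (F : I -> G) :
  is_subgroup H -> (forall i, H (F i)) -> H (\prod_(i <- s) F i).
Proof. by move=> [H1 HM _] HF; elim/big_ind: _. Qed.

Lemma finite_verbal_width_definable i : 0 < i ->
  finite_verbal_width G i -> e_definable_in (as_unary (gamma G i)).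
Proof.
move=> i_gt0 [n hn]; apply/e_definableP.
(* The variable [u (l, b, j)] is the [j]-th entry of a left-normed commutator: the positive one of
   factor [l] if [b] is [ord0], the inverted one otherwise. *)
pose c (u : 'I_n * 'I_2 * 'I_i -> G) l b := left_normed [seq u (l, b, j) | j <- enum 'I_i].
pose P (x : G) (u : 'I_n * 'I_2 * 'I_i -> G) :=
  x = \prod_(l <- enum 'I_n) (c u l ord0 * (c u l ord_max)^-1).
suff eP x : gamma G i x <-> exists u, P x u.
  apply: (@diophantine_ext _ (group_structure G) _ (fun a => exists u, P (a ord0) u)).
    by move=> a; rewrite -eP /as_unary /= /thead tnth_mktuple.
  apply: (@diophantine_ex _ (group_structure G) _ _ (fun a => P (a ord0))).
  apply: diophantine_eq.
    exact: (@term_fun_var _ (group_structure G) _ (inl ord0)).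
  apply: term_fun_prod => l.
  have tc b : term_fun (fun a : 'I_1 + 'I_n * 'I_2 * 'I_i -> group_structure G =>
      c (a \o inr) l b : group_structure G).
    rewrite /c; elim/last_ind: (enum 'I_i) => [|s j IH] /=.
      by apply: term_fun_const.
    have [->|s_n0] := eqVneq s [::] => /=.
      exact: (@term_fun_var _ (group_structure G) _ (inr (l, b, j))).
    have [t tE] := IH.
    have [t' t'E] := @term_fun_comm G _ _ _ (ex_intro _ t tE)
      (@term_fun_var _ (group_structure G) _ (inr (l, b, j))).
    exists t' => a; rewrite t'E map_rcons left_normed_rcons //.
    by case: (s) s_n0.
  apply: term_fun_mul => //; exact: term_fun_inv.
have sz (u : 'I_n * 'I_2 * 'I_i -> G) l b :
    gamma_generators G i (c u l b).
  by exists [tuple u (l, b, j) | j < i].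
have gg y : gamma_generators G i y -> gamma G i y.
  move=> [s ->]; rewrite -[X in gamma G X](size_tuple s).
  by apply: left_normed_gamma; rewrite -size_eq0 size_tuple -lt0n.
have [g1 gM gV] := gamma_subgroup G i.
split=> [/hn [s [s_le s_gen ->]]|[u ->]]; last first.
  by apply: subgroup_prod => // l; apply: gM; [|apply: gV]; apply: gg.
(* One of the two commutators is trivial according to the sign of the factor, and both are beyond
   the end of [s], so every product gets exactly [n] factors. *)
have /choice [w wP] (l : 'I_n) : exists w : 'I_2 -> i.-tuple G,
    left_normed (w ord0) * (left_normed (w ord_max))^-1 = s`_l.
  have one : left_normed [tuple of nseq i (1 : G)] = 1 by exact: left_normed1.
  have [ls|sl] := ltnP l (size s); last first.
    exists (fun=> [tuple of nseq i 1]); rewrite one nth_default //.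
    by rewrite mulgV.
  case: (s_gen _ (mem_nth 1 ls)) => -[t tE].
    exists (fun b => if b == ord0 then t else [tuple of nseq i 1]).
    by rewrite eqxx -tE /= one invg1 mulg1.
  exists (fun b => if b == ord0 then [tuple of nseq i 1] else t).
  by rewrite eqxx one /= -tE invgK mul1g.
exists (fun x => tnth (w x.1.1 x.1.2) x.2).
rewrite /P [RHS](eq_bigr (fun l : 'I_n => s`_l)); last first.
  move=> l _; rewrite -wP /c /=; congr (left_normed _ * (left_normed _)^-1).
    by rewrite map_tnth_enum.
  by rewrite map_tnth_enum.
rewrite -(big_map val xpredT (fun l => s`_l)) val_enum_ord -{1}[n]subn0 -/(index_iota 0 n).
rewrite (big_cat_nat (n := size s)) //=.
rewrite -(big_nth 1 xpredT id) /= [X in _ * X]big_nat_cond [X in _ * X]big1 ?mulg1 //.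
by move=> l /andP[/andP[sl _] _]; rewrite nth_default.
Qed.

End VerbalWidth.

(** A form of [e_interpretable] with coordinates in a finite type, where concatenated tuples become
    functions on [V + V] and [V + (V + V)]. *)
Definition interpretation (R : nzRingType) (G : groupType) (V : finType)
    (X : (V -> G) -> Prop) (phi : (V -> G) -> R) : Prop :=
  let M := group_structure G in
  [/\ @diophantine _ M V X,
      forall r, exists2 a, X a & phi a = r,
      @diophantine _ M (V + V)%type (fun a =>
        [/\ X (a \o inl), X (a \o inr) & phi (a \o inl) = phi (a \o inr)]),
      @diophantine _ M (V + (V + V))%type (fun a =>
        [/\ X (a \o inl), X (a \o inr \o inl), X (a \o inr \o inr)
          & (phi (a \o inl) + phi (a \o inr \o inl))%R = phi (a \o inr \o inr)])
    & @diophantine _ M (V + (V + V))%type (fun a =>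
        [/\ X (a \o inl), X (a \o inr \o inl), X (a \o inr \o inr)
          & (phi (a \o inl) * phi (a \o inr \o inl))%R = phi (a \o inr \o inr)])].

Section Tuples.
Variables (T : Type) (m n : nat).

Lemma mktuple_catP (c : 'I_(m + n) -> T) (a : m.-tuple T) (b : n.-tuple T) :
  [tuple c i | i < m + n] = [tuple of a ++ b] <->
  (forall i, c (lshift n i) = tnth a i) /\ (forall i, c (rshift m i) = tnth b i).
Proof.
split=> [e|[ea eb]].
  split=> i; [have := congr1 (fun t => tnth t (lshift n i)) e
             |have := congr1 (fun t => tnth t (rshift m i)) e];
    by rewrite tnth_mktuple ?tnth_lshift ?tnth_rshift.
apply: eq_from_tnth => i; rewrite tnth_mktuple -(splitK i).
by case: (fintype.split i) => j /=; rewrite ?tnth_lshift ?tnth_rshift.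
Qed.

End Tuples.

Definition tuple_fun (T : Type) (V : finType) (a : #|V|.-tuple T) (v : V) : T :=
tnth a (enum_rank v).

Lemma tuple_fun_mktuple (T : Type) (V : finType) (c : 'I_#|V| -> T) :
tuple_fun [tuple c i | i < #|V|] = c \o enum_rank.
Proof. by apply/funext => v; rewrite /tuple_fun tnth_mktuple. Qed.

Lemma e_definable_ternary (G : groupType) (V : finType) (X : (V -> G) -> Prop)
  (r : (V -> G) -> (V -> G) -> (V -> G) -> Prop) :
@diophantine _ (group_structure G) (V + (V + V))%type (fun a =>
  [/\ X (a \o inl), X (a \o inr \o inl), X (a \o inr \o inr)
    & r (a \o inl) (a \o inr \o inl) (a \o inr \o inr)]) ->
e_definable_in [set t : (#|V| + (#|V| + #|V|)).-tuple G | exists a b c,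
  [/\ X (tuple_fun a), X (tuple_fun b), X (tuple_fun c),
      t = [tuple of a ++ b ++ c]
    & r (tuple_fun a) (tuple_fun b) (tuple_fun c)]].
Proof.
set m := #|V|; move=> dr; have fE := @tuple_fun_mktuple G V.
apply/e_definableP; pose s (x : V + (V + V)) : 'I_(m + (m + m)) := match x with
  | inl v => lshift (m + m) (enum_rank v)
  | inr (inl v) => rshift m (lshift m (enum_rank v))
  | inr (inr v) => rshift m (rshift m (enum_rank v)) end.
have := diophantine_sub dr (fun x => @term_fun_var _ (group_structure G) _ (s x)).
apply: diophantine_ext => c; split=> [[Xa Xb Xc eab]|].
  exists [tuple c (lshift (m + m) i) | i < m],
    [tuple c (rshift m (lshift m i)) | i < m],
    [tuple c (rshift m (rshift m i)) | i < m].
  rewrite /= !fE; split=> //; apply/mktuple_catP.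
  split=> i; first by rewrite tnth_mktuple.
  rewrite -(splitK i); case: (fintype.split i) => j /=;
    by rewrite ?tnth_lshift ?tnth_rshift tnth_mktuple.
move=> [a [b [d [Xa Xb Xd /mktuple_catP[ea ebd] eab]]]].
have -> : (fun x => c (s x)) \o inl = tuple_fun a by apply/funext => v /=; rewrite ea.
have -> : (fun x => c (s x)) \o inr \o inl = tuple_fun b.
  by apply/funext => v /=; rewrite ebd tnth_lshift.
have -> : (fun x => c (s x)) \o inr \o inr = tuple_fun d.
  by apply/funext => v /=; rewrite ebd tnth_rshift.
by [].
Qed.

Lemma interpretation_e_interpretable (R : nzRingType) (G : groupType)
    (V : finType) (X : (V -> G) -> Prop) (phi : (V -> G) -> R) :
  interpretation X phi -> e_interpretable R G.
Proof.
move=> [dX surj deq dadd dmul]; pose m := #|V|.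
pose f := @tuple_fun G V; have fE := @tuple_fun_mktuple G V.
have fV (c : V -> G) : f [tuple c (enum_val i) | i < m] = c.
  by apply/funext => v; rewrite /f fE /= enum_rankK.
exists m, [set a | X (f a)], (phi \o f); split.
- apply/e_definableP.
  have := diophantine_sub dX (fun v : V => @term_fun_var _ (group_structure G) _ (enum_rank v)).
  by apply: diophantine_ext => a /=; rewrite /f fE.
- by move=> r _; have [a Xa <-] := surj r; exists [tuple a (enum_val i) | i < m];
    rewrite /= fV.
- apply/e_definableP; pose s (x : V + V) : 'I_(m + m) := match x with
    | inl v => lshift m (enum_rank v) | inr v => rshift m (enum_rank v) end.
  have := diophantine_sub deq (fun x => @term_fun_var _ (group_structure G) _ (s x)).
  apply: diophantine_ext => c; split=> [[Xa Xb eab]|[a [b [Xa Xb /mktuple_catP[ea eb] eab]]]].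
    exists [tuple c (lshift m i) | i < m], [tuple c (rshift m i) | i < m].
    rewrite /= /f !fE; split=> //; apply/mktuple_catP.
    by split=> i; rewrite tnth_mktuple.
  have -> : (fun x => c (s x)) \o inl = f a by apply/funext => v /=; rewrite ea.
  by have -> : (fun x => c (s x)) \o inr = f b by apply/funext => v /=; rewrite eb.
- exact: (e_definable_ternary (r := fun a b c => (phi a + phi b)%R = phi c)).
- exact: (e_definable_ternary (r := fun a b c => (phi a * phi b)%R = phi c)).
Qed.

(** * Interpretations in a quotient by a definable normal subgroup *)

Section QuotientInterpretation.
Local Open Scope group_scope.
Local Open Scope quotient_scope.
Variables (G : groupType) (N : normalSubgroup G).
Notation Q := (quotient_group N).
Notation "\p x" := (\pi_(quot N) x : Q) (at level 10, x at level 9).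

Lemma quot_piM (x y : G) : \p (x * y) = \p x * \p y.
Proof. by rewrite -[RHS]/(quot_mul _ _) quot_mul_pi. Qed.

Lemma quot_pi1 : \p 1 = 1. Proof. by []. Qed.

Lemma quot_piV (x : G) : \p (x^-1) = (\p x)^-1.
Proof. by rewrite -[RHS]/(quot_inv _) quot_inv_pi. Qed.

Lemma quot_pi_eq1 (x : G) : \p x = 1 <-> normal_set N x.
Proof.
rewrite -quot_pi1; have [_ _ NV] := normal_subgroup N.
split=> [/quot_piP/NV|Nx]; first by rewrite mulg1 invgK.
by apply/quot_piP; rewrite mulg1; apply: NV.
Qed.

Lemma quot_pi_surj (x : Q) : exists y, \p y = x.
Proof. by exists (repr x); rewrite reprK. Qed.

(** An equation [t = u] of the quotient says that [t^-1 u] lies in [N] once its coefficients are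
    lifted to representatives; witnesses lift as the projection is onto. *)
Lemma diophantine_quotient (V : Type) (P : (V -> Q) -> Prop) :
  e_definable_in (as_unary (normal_set N)) ->
  @diophantine _ (group_structure Q) V P ->
  @diophantine _ (group_structure G) V (fun a => P (fun v => \p (a v))).
Proof.
move=> dN [W [E hE]].
pose lift := @tsub group_signature Q (V + W) G (V + W)
  (fun q => Coef _ _ (repr q)) (@Var _ _ _).
have liftE (b : V + W -> G) t :
    eval (M := group_structure Q) id (fun x => \p (b x)) t =
    \p (eval (M := group_structure G) id b (lift t)).
  elim: t => //= [q|o t ->|o t -> u ->]; first by rewrite reprK.
    by rewrite quot_piV.
  by rewrite quot_piM.
have dsat (E' : system group_signature (group_structure Q) (V + W)) :
    @diophantine _ (group_structure G) (V + W) (fun b =>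
      satisfies (M := group_structure Q) id (fun x => \p (b x)) E').
  elim: E' => [|[t u] E' IH]; first exact: diophantine_true.
  apply: diophantine_and IH; apply: (@diophantine_ext _ (group_structure G) _ (fun b =>
    normal_set N ((eval (M := group_structure G) id b (lift t))^-1 *
                  eval (M := group_structure G) id b (lift u)))).
    by move=> b; rewrite !liftE; exact: iff_sym (quot_piP _ _ _).
  apply: diophantine_mem => //; apply: term_fun_mul; last by exists (lift u).
  by apply: term_fun_inv; exists (lift t).
have := @diophantine_ex _ (group_structure G) V W (fun a y =>
  satisfies (M := group_structure Q) id (fun x => \p (sumf a y x)) E).
have eb (b : V + W -> G) : sumf (b \o inl) (b \o inr) = b.
  by apply/funext => -[].
move=> h; apply: diophantine_ext (h _).
  move=> a; rewrite hE; split=> -[y s].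
    by exists (fun w => \p (y w)); apply: (eq_satisfies s) => // -[].
  exists (fun w => repr (y w)); apply: (eq_satisfies s) => // -[] //= w.
  by rewrite reprK.
by apply: diophantine_ext (dsat E) => b; rewrite eb.
Qed.

Lemma interpretation_quotient (R : nzRingType) (V : finType)
    (X : (V -> Q) -> Prop) (phi : (V -> Q) -> R) :
  e_definable_in (as_unary (normal_set N)) -> interpretation X phi ->
  interpretation (fun a : V -> G => X (fun v => \p (a v)))
    (fun a => phi (fun v => \p (a v))).
Proof.
move=> dN [dX surj deq dadd dmul]; split.
- exact: diophantine_quotient.
- move=> r; have [a Xa <-] := surj r.
  have pa : (fun v => \p (repr (a v))) = a by apply/funext => v; rewrite reprK.
  by exists (fun v => repr (a v)); rewrite pa.
- exact: (diophantine_quotient dN deq).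
- exact: (diophantine_quotient dN dadd).
- exact: (diophantine_quotient dN dmul).
Qed.

End QuotientInterpretation.

(** * The upper central series *)

Section UpperCentral.
Local Open Scope group_scope.
Variable G : groupType.
Implicit Types (H N K : set G) (x y g h : G).

Lemma commMg x y g : [~ x * y, g] = [~ x, g] ^ y * [~ y, g].
Proof. by rewrite /commg /conjg !gnorm. Qed.

Lemma commgM x g h : [~ x, g * h] = [~ x, h] * [~ x, g] ^ h.
Proof. by rewrite /commg /conjg !gnorm. Qed.

Lemma commVg x g : [~ x^-1, g] = ([~ x, g] ^ x^-1)^-1.
Proof. by apply/esym/mulg1_eq; rewrite -commMg mulgV comm1g. Qed.

Definition conj_closed H := forall x y, H x -> H (x ^ y).

(** For normal [H], the preimage of the center of [G / H]. *)
Definition centralizing H : set G := [set x | forall g, H [~ x, g]].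

Lemma commutator_right_subgroup H x :
  is_subgroup H -> conj_closed H -> is_subgroup [set g | H [~ x, g]].
Proof.
move=> [H1 HM HV] HJ; split=> [|g h Hg Hh|g Hg] /=.
- by rewrite commg1.
- by rewrite commgM; apply: HM => //; apply: HJ.
- have e : [~ x, g^-1] = ([~ x, g] ^ g^-1)^-1.
    apply: (@mulIg _ ([~ x, g] ^ g^-1)); rewrite mulVg.
    by rewrite -commgM mulgV commg1.
  by rewrite e; apply/HV/HJ.
Qed.

Lemma centralizing_subgroup H :
  is_subgroup H -> conj_closed H -> is_subgroup (centralizing H).
Proof.
move=> [H1 HM HV] HJ; split=> [g|x y Hx Hy g|x Hx g] /=.
- by rewrite comm1g.
- by rewrite commMg; apply: HM => //; apply: HJ.
- by rewrite commVg; apply/HV/HJ.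
Qed.

Lemma centralizing_conj H : conj_closed H -> conj_closed (centralizing H).
Proof.
move=> HJ x y Hx g; rewrite -[g](conjgKV y) -conjRg.
exact: HJ.
Qed.

Fixpoint upper_central N k : set G :=
  if k is k'.+1 then centralizing (upper_central N k') else N.

Section Normal.
Variable N : normalSubgroup G.
Notation W := (upper_central (normal_set N)).

Lemma upper_central_conj k : conj_closed (W k).
Proof.
elim: k => [|k IH]; first exact: normal_conj.
exact: centralizing_conj.
Qed.

Lemma upper_central_subgroup k : is_subgroup (W k).
Proof.
elim: k => [|k IH]; first exact: normal_subgroup.
by apply: centralizing_subgroup => //; apply: upper_central_conj.
Qed.

Definition upper_central_normal k : normalSubgroup G :=
  NormalSubgroup (upper_central_subgroup k) (@upper_central_conj k).

Lemma upper_centralS k x : W k x -> W k.+1 x.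
Proof.
move=> Wx g; have [_ WM WV] := upper_central_subgroup k.
by rewrite commgEl; apply: WM; [apply: WV | apply: upper_central_conj].
Qed.

End Normal.

(** Commutators with [G] lead from each term of the lower series into the next, so the upper series
    built on [gamma_i] climbs at least as fast as the lower one descends. *)
Lemma gamma_upper_central i k x : k < i ->
  gamma G (i - k) x -> upper_central (gamma G i) k x.
Proof.
elim: k x => [|k IH] x ki; first by rewrite subn0.
move=> gx g; apply: IH; first exact: ltnW.
have -> : (i - k)%N = (i - k.+1).+1 by rewrite subnS prednK ?subn_gt0 ?(ltnW ki).
move: gx; case e : (i - k.+1)%N => [|j].
  by move/eqP: e; rewrite subn_eq0 leqNgt ki.
move=> gx H HA; have [_ sAH] := HA.
by apply: sAH; exists x => //; exists g.
Qed.

Lemma upper_central_gamma_full i x : 0 < i -> upper_central (gamma G i) i.-1 x.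
Proof.
case: i => // i _; apply: gamma_upper_central => //=.
by rewrite subSnn.
Qed.

Definition finite_index H : Prop :=
  exists s : seq G, forall g, exists2 t, t \in s & H (t^-1 * g).

Lemma finite_indexS H K : (forall x, H x -> K x) ->
  finite_index H -> finite_index K.
Proof.
move=> HK [s hs]; exists s => g; have [t ts Ht] := hs g.
by exists t => //; apply: HK.
Qed.

Lemma generates_subgroup r (s : r.-tuple G) H :
  @generates _ (group_structure G) r s -> is_subgroup H ->
  (forall j, H (tnth s j)) -> forall x, H x.
Proof.
move=> gen [H1 HM HV] Hs x; have [t <-] := gen x.
by elim: t => //= [o t Ht|o t Ht u Hu]; [apply: HV | apply: HM].
Qed.

(** For fixed [x] the [g] with [[x, g]] in [H] form a subgroup, so testing the generators replaces
    the universal quantifier by a finite conjunction. *)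
Lemma centralizing_definable H :
  finitely_generated (group_structure G) ->
  is_subgroup H -> conj_closed H ->
  e_definable_in (as_unary H) -> e_definable_in (as_unary (centralizing H)).
Proof.
move=> [r [s gen]] gH HJ dH; apply/e_definableP.
apply: (@diophantine_ext _ (group_structure G) _
  (fun a => forall j : 'I_r, H [~ a ord0 : G, tnth s j])).
  move=> a; rewrite /as_unary /= /thead tnth_mktuple; split=> h; last by move=> j.
  apply: (generates_subgroup gen) => //.
  exact: commutator_right_subgroup.
apply: (@diophantine_all _ (group_structure G)) => j.
apply: diophantine_mem => //; apply: term_fun_comm.
  exact: (@term_fun_var _ (group_structure G)).
exact: (@term_fun_const _ (group_structure G)).
Qed.

Lemma upper_central_definable (N : normalSubgroup G) k :
  finitely_generated (group_structure G) ->
  e_definable_in (as_unary (normal_set N)) ->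
  e_definable_in (as_unary (upper_central (normal_set N) k)).
Proof.
move=> fgG dN; elim: k => //= k IH; apply: centralizing_definable => //.
  exact: upper_central_subgroup.
exact: upper_central_conj.
Qed.

(* Schreier: the elements [t'^-1 u t] of [H], with [u] a generator or its
   inverse and [t], [t'] in a transversal, generate [H]. *)
Lemma finite_index_generated r (s : r.-tuple G) H :
  @generates _ (group_structure G) r s -> is_subgroup H -> finite_index H ->
  exists l : seq G, (forall x, x \in l -> H x) /\
    forall K, is_subgroup K -> (forall x, x \in l -> K x) ->
      forall x, H x -> K x.
Proof.
move=> gen gH [T hT]; have [H1 HM HV] := gH.
pose U := [seq u | u <- s] ++ [seq u^-1 | u <- s].
(* The transversal is added because 1 need not belong to it: the representative of the coset [H]
   must itself lie in [K]. *)
pose l0 := T ++ [seq p.1^-1 * q * p.2 | p <- [seq (t', t) | t' <- T, t <- T], q <- U].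
pose l := [seq x <- l0 | `[< H x >]].
exists l; split=> [x|K0 gK0 lK0]; first by rewrite mem_filter => /andP[/asboolP].
pose K := [set x | K0 x /\ H x].
have [K01 K0M K0V] := gK0.
have gK : is_subgroup K.
  split=> //; first by move=> x y [Kx Hx] [Ky Hy]; split; [apply: K0M|apply: HM].
  by move=> x [Kx Hx]; split; [apply: K0V | apply: HV].
have [K1 KM KV] := gK.
have lK x : x \in l0 -> H x -> K x.
  by move=> xl Hx; split=> //; apply: lK0; rewrite mem_filter xl andbT; apply/asboolP.
have TK t : t \in T -> H t -> K t by move=> tT; apply: lK; rewrite mem_cat tT.
(* [A] is the union of the cosets [t K]. It contains 1 and is stable under left multiplication by
   generators and their inverses, hence is [G]. *)
pose A := [set x | exists2 t, t \in T & K (t^-1 * x)].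
have UA u x : u \in U -> A x -> A (u * x).
  move=> uU [t tT Kt]; have [t' t'T Ht'] := hT (u * t).
  exists t' => //; have -> : t'^-1 * (u * x) = (t'^-1 * u * t) * (t^-1 * x).
    by rewrite !mulgA mulgK.
  apply: KM => //; apply: lK; last by rewrite -mulgA.
  rewrite mem_cat; apply/orP; right; apply/allpairsP.
  exists ((t', t), u); split=> //.
  by apply/allpairsP; exists (t', t).
have A1 : A 1.
  have [t tT] := hT 1; rewrite mulg1 => /HV; rewrite invgK => Ht.
  by exists t => //; rewrite mulg1; apply/KV/TK.
have allA x : A x.
  suff [h _] : (forall a, A a -> A (x * a)) /\ (forall a, A a -> A (x^-1 * a)).
    by have := h _ A1; rewrite mulg1.
  apply: (generates_subgroup gen (H := [set x | (forall a, A a -> A (x * a)) /\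
    (forall a, A a -> A (x^-1 * a))])).
    split=> [|y z [y1 y2] [z1 z2]|y [y1 y2]] /=.
    - by split=> a; rewrite ?invg1 mul1g.
    - split=> a Aa; first by rewrite -mulgA; apply/y1/z1.
      by rewrite invgM -mulgA; apply/z2/y2.
    - by rewrite invgK; split.
  move=> j; split=> a; apply: UA; rewrite mem_cat.
    by rewrite map_id mem_tnth.
  by apply/orP; right; apply: map_f; apply: mem_tnth.
move=> x Hx; have [t tT [Kx Htx]] := allA x.
have Ht : H t.
  by have := HM _ _ Hx (HV _ Htx); rewrite invgM invgK mulgA mulgV mul1g.
by have [Kt _] := TK t tT Ht; have := K0M _ _ Kt Kx; rewrite mulgA mulgV mul1g.
Qed.

End UpperCentral.

Section CentralQuotient.
Local Open Scope group_scope.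
Local Open Scope quotient_scope.
Variable G : groupType.

Lemma commg_pi (N : normalSubgroup G) (x y : G) :
  [~ \pi_(quot N) x : quotient_group N, \pi_(quot N) y] = \pi_(quot N) [~ x, y].
Proof. by rewrite /commg /conjg !quot_piM !quot_piV. Qed.

Lemma finite_index_center_virtually_abelian (N : normalSubgroup G) :
  finite_index (centralizing (normal_set N)) ->
  virtually_abelian (quotient_group N).
Proof.
move=> [s hs].
have [C1 CM CV] := upper_central_subgroup N 1.
pose p := \pi_(quot N) : G -> quotient_group N.
exists [set p x | x in centralizing (normal_set N)]; split.
- split; first by exists 1.
    by move=> _ _ [x Cx <-] [y Cy <-]; exists (x * y); [apply: CM | rewrite /p quot_piM].
  by move=> _ [x Cx <-]; exists x^-1; [apply: CV | rewrite /p quot_piV].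
- move=> _ _ [x Cx <-] [y _ <-]; apply/commgP/eqP.
  by rewrite /p commg_pi; apply/quot_pi_eq1; apply: Cx.
- apply: (@sub_finite_set _ _ [set [set p t * h | h in [set p x | x in
      centralizing (normal_set N)]] | t in [set` s]]); last first.
    exact/finite_image/finite_seq.
  move=> _ [g _ <-]; have [x <-] := quot_pi_surj g.
  have [t ts Ct] := hs x; exists t => //.
  rewrite eqEsubset; split=> _ [_ [z Cz <-] <-].
    exists (p ((t^-1 * x)^-1 * z)); last first.
      by rewrite /p -!quot_piM invgM invgK !mulgA mulgV mul1g.
    by exists ((t^-1 * x)^-1 * z) => //; apply: CM => //; apply: CV.
  exists (p (t^-1 * x * z)); last by rewrite /p -!quot_piM !mulgA mulgV mul1g.
  by exists (t^-1 * x * z) => //; apply: CM.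
Qed.

Lemma quotient_finitely_generated (N : normalSubgroup G) :
  finitely_generated (group_structure G) ->
  finitely_generated (group_structure (quotient_group N)).
Proof.
move=> [r [s gen]]; exists r, [tuple \pi_(quot N) (tnth s j) | j < r] => x.
have [y <-] := quot_pi_surj x; have [t <-] := gen y; exists t.
elim: t => //= [j|[] t ->|[] t -> u ->]; first by rewrite tnth_mktuple.
- by rewrite quot_piV.
- by rewrite quot_piM.
Qed.

Lemma centralizing_quotient (N : normalSubgroup G) (H : set G)
    (H' : set (quotient_group N)) :
  (forall x, H' (\pi_(quot N) x) <-> H x) ->
  forall x, centralizing H' (\pi_(quot N) x) <-> centralizing H x.
Proof.
move=> hH x; split=> [h g|h g]; first by apply/hH; rewrite -commg_pi; apply: h.
by have [y <-] := quot_pi_surj g; rewrite commg_pi; apply/hH.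
Qed.

Lemma finite_index_quotient (N : normalSubgroup G) (H : set G)
    (H' : set (quotient_group N)) :
  (forall x, H' (\pi_(quot N) x) <-> H x) -> finite_index H' <-> finite_index H.
Proof.
move=> hH; split=> -[s hs].
  exists [seq repr (t : quot N) | t <- s] => g.
  have [t ts Ht] := hs (\pi_(quot N) g); exists (repr (t : quot N)); first exact: map_f.
  by apply/hH; rewrite quot_piM quot_piV reprK.
exists [seq (\pi_(quot N) t : quotient_group N) | t <- s] => g.
have [x <-] := quot_pi_surj g; have [t ts Ht] := hs x.
exists (\pi_(quot N) t); first by apply: map_f.
by rewrite -quot_piV -quot_piM; apply/hH.
Qed.

Lemma central_quotient_exists i : 0 < i ->
  finitely_generated (group_structure G) ->
  e_definable_in (as_unary (gamma G i)) ->
  ~ virtually_abelian (quotient_group (gamma_normal G i)) ->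
  exists N : normalSubgroup G, let Q := quotient_group N in
    [/\ e_definable_in (as_unary (normal_set N)),
        finitely_generated (group_structure Q),
        ~ finite_index (centralizing [set (1 : Q)])
      & finite_index (centralizing (centralizing [set (1 : Q)]))].
Proof.
move=> i_gt0 fgG dg nva.
pose N0 := gamma_normal G i; pose W := upper_central (normal_set N0).
have W1 : ~ finite_index (W 1%N) by move=> /finite_index_center_virtually_abelian.
have ex : exists k, `[< finite_index (W k) >].
  exists i.-1; apply/asboolP; exists [:: 1] => g; exists 1; rewrite ?mem_head //.
  exact: upper_central_gamma_full.
case: (ex_minnP ex) => k0 /asboolP Wk0 min.
(* [W_1], and with it [W_0], has infinite index, so there are two terms below the first one of
   finite index. *)
have k0_gt1 : 1 < k0.
  case: k0 Wk0 min => [|[|//]] // W0 _; case: W1; apply: finite_indexS W0 => x.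
  exact: upper_centralS.
have [k k0E] : exists k, k0 = k.+2 by case: k0 k0_gt1 {Wk0 min} => [|[|k]] // _; exists k.
exists (upper_central_normal N0 k).
pose N := upper_central_normal N0 k.
(* By [e0], [e1] and [e2] the preimages of 1, of the center and of the second center of the quotient
   are [W_k], [W_(k+1)] and [W_(k+2)]. *)
have e0 x : [set (1 : quotient_group N)] (\pi_(quot N) x) <-> W k x by apply: quot_pi_eq1.
have e1 := centralizing_quotient e0.
have e2 := centralizing_quotient e1.
split.
- exact: upper_central_definable.
- exact: quotient_finitely_generated.
- move=> /(finite_index_quotient e1) Wk1.
  have /min : `[< finite_index (W k.+1) >] by apply/asboolP.
  by rewrite k0E ltnn.
- by apply/(finite_index_quotient e2); rewrite k0E in Wk0.
Qed.

End CentralQuotient.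

(** * Orders in number fields *)

Section Lattices.
Local Open Scope ring_scope.

Definition zmod_subgroup (A : zmodType) (H : set A) : Prop :=
  H 0 /\ forall x y, H x -> H y -> H (x - y).

Section Basics.
Variables (A : zmodType) (H : set A).
Hypothesis gH : zmod_subgroup H.

Lemma zmod_subgroupN x : H x -> H (- x).
Proof. by case: gH => H0 HB Hx; rewrite -sub0r; apply: HB. Qed.

Lemma zmod_subgroupD x y : H x -> H y -> H (x + y).
Proof.
by case: gH => H0 HB Hx Hy; rewrite -[y]opprK; apply/HB/zmod_subgroupN.
Qed.

Lemma zmod_subgroupMn x n : H x -> H (x *+ n).
Proof.
case: gH => H0 _ Hx; elim: n => // n IH.
by rewrite mulrS; apply: zmod_subgroupD.
Qed.

Lemma zmod_subgroupMz x n : H x -> H (x *~ n).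
Proof.
by move=> Hx; case: n => n; rewrite ?NegzE ?mulrNz; [|apply: zmod_subgroupN];
  rewrite -pmulrn; apply: zmod_subgroupMn.
Qed.

Lemma zmod_subgroup_sum (I : Type) (s : seq I) (P : pred I) (F : I -> A) :
  (forall i, P i -> H (F i)) -> H (\sum_(i <- s | P i) F i).
Proof. by case: gH => H0 _ HF; elim/big_ind: _ => //; apply: zmod_subgroupD. Qed.

End Basics.

Lemma int_subgroup_principal (X : set int) :
  zmod_subgroup X -> exists2 d, X d & forall x, X x -> exists q, x = d *~ q.
Proof.
move=> gX; have [X0 XB] := gX.
have [[x Xx x_n0]|no] := pselect (exists2 x, X x & x != 0); last first.
  exists 0 => // x Xx; exists 0; rewrite mul0rz.
  by apply/eqP/negPn/negP => x_n0; case: no; exists x.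
have ex : exists n : nat, (0 < n)%N && `[< X n%:Z >].
  exists `|x|%N; rewrite absz_gt0 x_n0; apply/asboolP.
  have [/gez0_abs->//|/ltW/lez0_abs->] := leP 0 x.
  exact: zmod_subgroupN.
case: (ex_minnP ex) => d /andP[d_gt0 /asboolP Xd] min.
exists d%:Z => // y Xy; exists (y %/ d)%Z.
rewrite -mulrzr intz mulrC {1}(divz_eq y d); apply/eqP.
rewrite addrC -subr_eq0 addrK; apply/negPn/negP => r_n0.
have r_ge0 : 0 <= (y %% d)%Z by rewrite modz_ge0 // -lt0n.
have Xr : X (y %% d)%Z.
  have -> : (y %% d)%Z = y - d%:Z *~ (y %/ d)%Z.
    by rewrite {2}(divz_eq y d) -[_ *~ _]mulrzr intz mulrC addrAC subrr add0r.
  by apply: XB => //; apply: zmod_subgroupMz.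
have := min `|(y %% d)%Z|%N; rewrite absz_gt0 r_n0 gez0_abs //=.
rewrite leqNgt -ltz_nat gez0_abs // ltz_pmod //.
by move=> h; have := h (asboolT Xr).
Qed.

(** Induction on the list of coordinates that may be nonzero on the subgroup. The values of [c i]
    form an ideal of the integers; an element [h] attaining a generator of it serves to clear that
    coordinate. *)
Lemma zmod_subgroup_fg (A : zmodType) (I : finType) (c : I -> {additive A -> int})
    (H : set A) :
  (forall x, (forall i, c i x = 0) -> x = 0) -> zmod_subgroup H ->
  exists (t : nat) (g : 'I_t -> A), (forall j, H (g j)) /\
    forall x, H x -> exists k : 'I_t -> int, x = \sum_j g j *~ k j.
Proof.
move=> cinj; suff main (s : seq I) (K : set A) : zmod_subgroup K ->
    (forall x, K x -> forall i, i \notin s -> c i x = 0) ->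
  exists (t : nat) (g : 'I_t -> A), (forall j, K (g j)) /\
    forall x, K x -> exists k : 'I_t -> int, x = \sum_j g j *~ k j.
  by move=> gH; apply: (main (enum I)) => // x _ i; rewrite mem_enum.
elim: s K => [|i s IH] K gK Ks.
  exists 0%N, (fun=> 0); split=> [[]//|x Kx].
  by exists (fun=> 0); rewrite big_ord0; apply: cinj => i; rewrite (Ks x).
have [K0 KB] := gK.
have [d [h Kh <-] hd] : exists2 d, (exists2 h, K h & c i h = d) &
    forall x, (exists2 y, K y & c i y = x) -> exists q, x = d *~ q.
  apply: int_subgroup_principal; split; first by exists 0; rewrite ?raddf0.
  by move=> _ _ [x Kx <-] [y Ky <-]; exists (x - y); rewrite ?raddfB //; apply: KB.
have [||t [g [gK' span]]] := IH (fun x => K x /\ c i x = 0).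
- split=> [|x y [Kx cx] [Ky cy]]; first by rewrite /= raddf0.
  by split; [apply: KB | rewrite raddfB cx cy subrr].
- move=> x [Kx cx] j js; have [->//|ji] := eqVneq j i.
  by apply: Ks => //; rewrite inE negb_or ji.
exists t.+1, (fun j => if unlift ord0 j is Some j' then g j' else h); split.
  by move=> j; case: unliftP => [j' _|_] //; case: (gK' j').
move=> x Kx; have [q xq] := hd (c i x) (ex_intro2 _ _ x Kx erefl).
have [|k xk] := span (x - h *~ q).
  split; first by apply: KB => //; apply: zmod_subgroupMz.
  by rewrite raddfB raddfMz xq subrr.
exists (fun j => if unlift ord0 j is Some j' then k j' else q).
rewrite big_ord_recl unlift_none (eq_bigr (fun j => g j *~ k j)).
  by rewrite -xk addrC subrK.
by move=> j _; rewrite !liftK.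
Qed.

Lemma matrix_subgroup_fg (m n : nat) (H : set 'M[int]_(m, n)) :
  zmod_subgroup H ->
  exists (t : nat) (g : 'I_t -> 'M[int]_(m, n)), (forall j, H (g j)) /\
    forall x, H x -> exists k : 'I_t -> int, x = \sum_j g j *~ k j.
Proof.
pose c (ij : 'I_m * 'I_n) (x : 'M[int]_(m, n)) : int := x ij.1 ij.2.
have cB ij : zmod_morphism (c ij) by move=> x y; rewrite /c !mxE.
pose cc ij : {additive 'M[int]_(m, n) -> int} :=
  HB.pack (c ij) (GRing.isZmodMorphism.Build _ _ (c ij) (cB ij)).
apply: (@zmod_subgroup_fg _ ('I_m * 'I_n)%type cc) => x x0.
by apply/matrixP => i j; rewrite mxE; apply: (x0 (i, j)).
Qed.

End Lattices.

(** * Functionals vanishing on a subgroup of infinite index *)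

Section LinearAlgebra.
Local Open Scope ring_scope.

(** A family of maximal rank. Its rows are taken in [X] itself, so that properties of the elements
    of [X] remain available for a spanning set. *)
Lemma span_mx (F : fieldType) (n : nat) (X : set 'rV[F]_n) :
  exists (m : nat) (A : 'M[F]_(m, n)),
    (forall i, X (row i A)) /\ forall x, X x -> (x <= A)%MS.
Proof.
pose P r := `[< exists (m : nat) (A : 'M[F]_(m, n)),
  (forall i, X (row i A)) /\ \rank A = r >].
have ex : exists r, P r.
  exists 0%N; apply/asboolP; exists 0%N, 0; split=> [[]//|].
  by rewrite mxrank0.
have bd r : P r -> (r <= n)%N by move=> /asboolP[m [A [_ <-]]]; apply: rank_leq_col.
case: (ex_maxnP ex bd) => _ /asboolP[m [A [XA <-]]] max.
exists m, A; split=> // x Xx.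
have /max : P (\rank (col_mx x A)).
  apply/asboolP; exists (1 + m)%N, (col_mx x A); split=> // i.
  rewrite -(splitK i); case: (fintype.split i) => j /=.
    by rewrite rowKu (_ : j = ord0) ?row_id // ord1.
  by rewrite rowKd.
have sA : (A <= col_mx x A)%MS by rewrite -addsmxE addsmxSr.
move=> le; have := mxrank_leqif_sup sA; rewrite /leqif.
case=> le' /esym; rewrite eqn_leq le' le => /esym; rewrite -addsmxE.
by move=> sxA; apply: submx_trans (addsmxSl _ _) (esym sxA).
Qed.

Lemma rat_mx_denominator (m n : nat) (A : 'M[rat]_(m, n)) :
  exists2 d : int, d != 0 & exists B : 'M[int]_(m, n),
    d%:~R *: A = map_mx intr B.
Proof.
pose d := \prod_(ij : 'I_m * 'I_n) denq (A ij.1 ij.2).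
exists d; first by apply/prodf_neq0 => ij _; rewrite denq_eq0.
exists (\matrix_(i, j)
  (numq (A i j) * \prod_(ij | ij != (i, j)) denq (A ij.1 ij.2))).
apply/matrixP => i j; rewrite !mxE /d (bigD1 (i, j)) //= !rmorphM /=.
rewrite [(denq _)%:~R * _]mulrC -mulrA mulrC; congr (_ * _).
by rewrite -{2}[A i j]divq_num_den mulrCA divff ?mulr1 // intr_eq0 denq_eq0.
Qed.

(** The condition on [d] says that the quotient by [K] has no finite exponent. If [K] spanned the
    rational space, a common denominator of a pseudo-inverse would be such an exponent; so the
    cokernel has a nonzero column, and this is the functional. *)
Lemma infinite_index_functional (n : nat) (K : set 'rV[int]_n) :
  zmod_subgroup K ->
  (forall d : int, d != 0 -> exists i, ~ K (d *: delta_mx 0 i)) ->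
  exists2 u : 'rV[algC]_n, u != 0 &
    forall k, K k -> map_mx intr k *m u^T = 0.
Proof.
move=> gK hK.
have [m [A [KA spanA]]] := @span_mx rat n [set map_mx intr k | k in K]%classic.
have [fullA|nfull] := boolP (row_full A).
  have /choice[k kA] (i : 'I_m) : exists k, K k /\ map_mx intr k = row i A.
    by have [k] := KA i; exists k.
  have [d d_n0 [B dB]] := rat_mx_denominator (pinvmx A).
  have [i []] := hK d d_n0.
  suff -> : d *: delta_mx 0 i = \sum_j k j *~ (B i j).
    apply: zmod_subgroup_sum => // j _; apply: zmod_subgroupMz => //.
    by case: (kA j).
  suff /matrixP E : map_mx (intr : int -> rat) (d *: delta_mx 0 i) =
      map_mx intr (\sum_j k j *~ B i j).
    by apply/matrixP => a b; have := E a b; rewrite 2!mxE [RHS]mxE => /intr_inj.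
  rewrite map_mxZ /= map_delta_mx.
  have -> : (delta_mx 0 i : 'rV[rat]_n) = row i (pinvmx A) *m A.
    by rewrite -row_mul mulVpmx // row1.
  rewrite scalemxAl -linearZ /= dB mulmx_sum_row raddf_sum.
  by apply: eq_bigr => j _; rewrite !mxE -(kA j).2 raddfMz /= scaler_int.
have ck : cokermx A != 0.
  by rewrite -mxrank_eq0 mxrank_coker subn_eq0 -ltnNge ltn_neqAle nfull rank_leq_col.
have [j cj] : exists j, col j (cokermx A) != 0.
  apply: contrapT => no; case/negP: ck; apply/eqP/matrixP => i j.
  have /eqP/matrixP/(_ i 0) : col j (cokermx A) == 0.
    by apply/negPn/negP => cj; apply: no; exists j.
  by rewrite !mxE.
exists (map_mx ratr (col j (cokermx A)))^T.
  by rewrite -trmx0 (inj_eq trmx_inj) map_mx_eq0.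
move=> k Kk; rewrite trmxK.
have -> : map_mx intr k = map_mx ratr (map_mx intr k : 'rV[rat]_n) :> 'rV[algC]_n.
  by apply/matrixP => a b; rewrite !mxE ratr_int.
rewrite -map_mxM; apply/eqP; rewrite map_mx_eq0.
have /submxP[D ->] := spanA _ (ex_intro2 _ _ k Kk erefl).
by rewrite colE mulmxA -(mulmxA D) mulmx_coker mulmx0 mul0mx.
Qed.

End LinearAlgebra.

(** * Common eigenvectors of commuting operators *)

Section CommonEigenvector.
Local Open Scope ring_scope.
Variables (C : numClosedFieldType) (n : nat).

Lemma stable_eigenvector (m : nat) (U : 'M[C]_(m, n)) (A : 'M[C]_n) :
  U != 0 -> stablemx U A ->
  exists a, (U :&: eigenspace A a)%MS != 0.
Proof.
move=> U_n0 UA; pose B := row_base U.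
have Bfree : row_free B by apply: row_base_free.
(* The matrix of [A] on the row space of [U], in the basis [B]; it has an eigenvalue as the field is
   closed. *)
pose D := B *m A *m pinvmx B.
have BD : D *m B = B *m A.
  rewrite mulmxKpV //; apply: submx_trans (_ : U *m A <= _)%MS.
    by apply: submxMr; rewrite eq_row_base.
  by apply: submx_trans UA _; rewrite eq_row_base.
have [|a /eigenvalueP[w wD w_n0]] := @eigenvalue_closed C _ D.
  by rewrite lt0n mxrank_eq0.
exists a; apply/negP => /eqP cap0.
have : (w *m B <= U :&: eigenspace A a)%MS.
  rewrite sub_capmx; apply/andP; split.
    by apply: submx_trans (submxMl _ _) _; rewrite eq_row_base.
  by apply/eigenspaceP; rewrite -mulmxA -BD mulmxA wD scalemxAl.
rewrite cap0 submx0 => /eqP wB0; case/negP: w_n0; apply/eqP.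
by apply: (row_free_inj Bfree); rewrite wB0 mul0mx.
Qed.

(** In a nonzero stable space of minimal rank, each operator has a nonzero eigenspace. Commutation
    makes it stable, so by minimality it is the whole space and the operator is scalar there.
    Commutation is assumed only on [V] since scalars commute only modulo relations. *)
Lemma common_eigenvector_on (X : set 'M[C]_n) (V : set 'rV[C]_n) :
  (forall a u v, V u -> V v -> V (a *: u + v)) ->
  (exists2 u, V u & u != 0) ->
  (forall u A, V u -> X A -> V (u *m A)) ->
  (forall u A B, V u -> X A -> X B -> u *m A *m B = u *m B *m A) ->
  exists2 u, V u /\ u != 0 & forall A, X A -> exists a, u *m A = a *: u.
Proof.
move=> Vlin [u0 Vu0 u0_n0] VX Vcomm.
have V0 : V 0 by have := Vlin (-1) _ _ Vu0 Vu0; rewrite scaleN1r addNr.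
have Vspan m (A : 'M[C]_(m, n)) x : (forall i, V (row i A)) -> (x <= A)%MS -> V x.
  move=> VA /submxP[D ->]; rewrite mulmx_sum_row; elim/big_ind: _ => // [x' y Vx Vy|i _].
    by have := Vlin 1 _ _ Vx Vy; rewrite scale1r.
  by have := Vlin (D 0 i) _ _ (VA i) V0; rewrite addr0.
pose P r := `[< exists m (U : 'M[C]_(m, n)), [/\ U != 0, forall i, V (row i U),
  forall A, X A -> stablemx U A & \rank U = r] >].
have ex : exists r, P r.
  have [m [U [VU sU]]] := span_mx V.
  exists (\rank U); apply/asboolP; exists m, U; split=> //.
    apply/eqP => U0; case/negP: u0_n0.
    by have /submxP[D ->] := sU _ Vu0; rewrite U0 mulmx0.
  move=> A XA; apply/row_subP => i; rewrite row_mul; apply: sU.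
  exact: VX.
case: (ex_minnP ex) => _ /asboolP[m [U [U_n0 VU XU <-]]] min.
have key A : X A -> exists a, forall u : 'rV_n, (u <= U)%MS -> u *m A = a *: u.
  move=> XA; have [a cap] := stable_eigenvector U_n0 (XU _ XA).
  exists a => u uU; apply/eigenspaceP; apply: submx_trans uU _.
  set W := (U :&: eigenspace A a)%MS in cap.
  have WU : (W <= U)%MS by apply: capmxSl.
  suff : (U <= W)%MS by rewrite sub_capmx => /andP[].
  have /min le : P (\rank W).
    apply/asboolP; exists n, W; split=> //.
      by move=> i; apply: (Vspan _ _ _ VU); apply: submx_trans (row_sub _ _) WU.
    move=> B XB; apply/row_subP => i; rewrite row_mul.
    have rW : (row i W <= W)%MS by apply: row_sub.
    have rU := submx_trans rW WU.
    have Vr := Vspan _ _ _ VU rU.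
    rewrite sub_capmx; apply/andP; split.
      exact: submx_trans (submxMr _ rU) (XU _ XB).
    apply/eigenspaceP; rewrite Vcomm // scalemxAl; congr (_ *m _).
    by apply/eigenspaceP; apply: submx_trans rW _; apply: capmxSr.
  case: (mxrank_leqif_sup WU) => le'.
  by rewrite eqn_leq le' (le : \rank U <= \rank W)%N => <-.
have [i ri] : exists i, row i U != 0.
  apply: contrapT => no; case/negP: U_n0; apply/eqP/row_matrixP => i.
  by apply/eqP/negPn/negP; rewrite row0 => h; apply: no; exists i.
exists (row i U); first by split.
by move=> A XA; have [a aP] := key A XA; exists a; apply: aP; apply: row_sub.
Qed.

End CommonEigenvector.

Section Eigencharacter.
Local Open Scope ring_scope.
Variable n : nat.
Implicit Types P Q : 'M[int]_n.

Definition int_subring (S : set 'M[int]_n) : Prop :=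
  [/\ S 1%:M, forall P Q, S P -> S Q -> S (P - Q)
    & forall P Q, S P -> S Q -> S (P *m Q)].

Lemma int_subring_group S : int_subring S -> zmod_subgroup S.
Proof.
by case=> S1 SB _; split=> //; have := SB _ _ S1 S1; rewrite subrr.
Qed.

Notation toC := (map_mx (intr : int -> algC)).

(** [V] is the space of complex functionals on the integer rows that vanish on [K], where [P] acts
    by its transpose. Matrices with rows in [K], in particular the commutators, act as 0 on it, so
    there is a common eigenvector; [lam] is its eigenvalue. *)
Lemma eigencharacter (K : set 'rV[int]_n) (S : set 'M[int]_n) :
  zmod_subgroup K ->
  (forall d : int, d != 0 -> exists i, ~ K (d *: delta_mx 0 i)) ->
  int_subring S ->
  (forall k P, K k -> S P -> K (k *m P)) ->
  (forall P Q i, S P -> S Q -> K (row i (P *m Q - Q *m P))) ->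
  exists lam : 'M[int]_n -> algC,
    [/\ lam 1%:M = 1,
        forall P Q, S P -> S Q -> lam (P - Q) = lam P - lam Q,
        forall P Q, S P -> S Q -> lam (P *m Q) = lam P * lam Q,
        forall P, S P -> (forall i, K (row i P)) -> lam P = 0
      & forall P, S P -> root (map_poly intr (char_poly P^T)) (lam P)].
Proof.
move=> gK infK [S1 SB SM] KS Scomm.
have [u0 u0_n0 u0K] := infinite_index_functional gK infK.
pose V (u : 'rV[algC]_n) := forall k, K k -> toC k *m u^T = 0.
pose X (A : 'M[algC]_n) := exists2 P, S P & A = (toC P)^T.
have [||||u [Vu u_n0] uX] := @common_eigenvector_on algC n X V.
- move=> a u v Vu Vv k Kk.
  by rewrite linearD linearZ /= mulmxDr -scalemxAr Vu // Vv // scaler0 addr0.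
- by exists u0.
- move=> u _ Vu [P SP ->] k Kk.
  by rewrite trmx_mul trmxK mulmxA -map_mxM /=; apply: Vu; apply: KS.
- move=> u _ _ Vu [P SP ->] [Q SQ ->].
  apply/trmx_inj; rewrite !trmx_mul !trmxK !mulmxA; apply/eqP.
  rewrite -subr_eq0 -mulmxBl -!map_mxM -map_mxB /=; apply/eqP/row_matrixP => i.
  by rewrite row_mul -map_row Vu ?row0 //; apply: Scomm.
have /choice[lam lamP] P : exists a, S P -> u *m (toC P)^T = a *: u.
  have [SP|nSP] := pselect (S P); last by exists 0.
  by have [a aP] := uX _ (ex_intro2 _ _ P SP erefl); exists a.
have lam_uniq P a : S P -> u *m (toC P)^T = a *: u -> lam P = a.
  move=> SP; rewrite lamP // => /eqP; rewrite -subr_eq0 -scalerBl scaler_eq0.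
  by rewrite (negPf u_n0) orbF subr_eq0 => /eqP.
exists lam; split.
- by apply: lam_uniq => //; rewrite map_mx1 trmx1 mulmx1 scale1r.
- move=> P Q SP SQ; apply: lam_uniq; first exact: SB.
  by rewrite map_mxB linearB /= mulmxBr !lamP // scalerBl.
- move=> P Q SP SQ; apply: lam_uniq; first exact: SM.
  by rewrite map_mxM trmx_mul mulmxA lamP // -scalemxAl lamP // scalerA mulrC.
- move=> P SP KP; apply: lam_uniq => //; rewrite scale0r.
  apply/trmx_inj; rewrite trmx_mul trmxK trmx0; apply/row_matrixP => i.
  by rewrite row_mul -map_row Vu ?row0.
- move=> P SP; rewrite map_char_poly -eigenvalue_root_char.
  by apply/eigenvalueP; exists u => //; rewrite -map_trmx lamP.
Qed.

End Eigencharacter.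

(** * The trace form of a number field *)

Section Trace.
Local Open Scope ring_scope.
Variables (L : fieldExtType rat) (m : nat) (b : m.+1.-tuple L).
Hypothesis b_basis : basis_of fullv b.

Definition mul_mx (x : L) : 'M[rat]_m.+1 :=
  \matrix_(i, j) coord b j (x * b`_i).

Definition coord_row (y : L) : 'rV[rat]_m.+1 := \row_j coord b j y.

Definition field_trace (x : L) : rat := \tr (mul_mx x).

Lemma coord_rowK y : y = \sum_j coord_row y 0 j *: b`_j.
Proof.
rewrite {1}(coord_basis b_basis (memvf y)).
by apply: eq_bigr => j _; rewrite mxE.
Qed.

Lemma coord_row_mul x y : coord_row y *m mul_mx x = coord_row (y * x).
Proof.
apply/rowP => j; rewrite !mxE {2}(coord_rowK y) mulr_suml linear_sum /=.
by apply: eq_bigr => i _; rewrite !mxE -scalerAl linearZ /= mulrC [x * _]mulrC mulrC.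
Qed.

Lemma coord_row_basis (i : 'I_m.+1) : coord_row b`_i = delta_mx 0 i.
Proof.
apply/rowP => j; rewrite !mxE eqxx /= coord_free ?(basis_free b_basis) //.
by rewrite eq_sym.
Qed.

Lemma coord_row_horner x y p :
  coord_row y *m horner_mx (mul_mx x) p =
  coord_row (y * (map_poly (in_alg L) p).[x]).
Proof.
elim/poly_ind: p y => [|p c IH] y.
  rewrite !rmorph0 horner0 mulmx0 mulr0; apply/rowP => j.
  by rewrite !mxE linear0.
rewrite !rmorphD !rmorphM /= horner_mx_X horner_mx_C map_polyX map_polyC /=.
rewrite hornerD hornerM hornerX hornerC mulmxDr mulmxA IH coord_row_mul.
rewrite mulrDr mulrA mul_mx_scalar; apply/rowP => j.
by rewrite !mxE linearD /= -scalerAr mulr1 linearZ.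
Qed.

Lemma horner_mul_mx x p :
  (map_poly (in_alg L) p).[x] = 0 -> horner_mx (mul_mx x) p = 0.
Proof.
move=> p0; apply/row_matrixP => i.
rewrite row0 rowE -coord_row_basis coord_row_horner p0 mulr0.
by apply/rowP => j; rewrite !mxE linear0.
Qed.

Lemma field_trace_linear a x y :
  field_trace (a *: x + y) = a * field_trace x + field_trace y.
Proof.
rewrite /field_trace -linearZ -linearD /=; congr (\tr _).
by apply/matrixP => i j; rewrite !mxE mulrDl linearD -scalerAl linearZ.
Qed.

Lemma field_trace0 : field_trace 0 = 0.
Proof.
by have := field_trace_linear (-1) 0 0; rewrite scaler0 addr0 mulN1r addNr.
Qed.

Lemma field_traceD x y : field_trace (x + y) = field_trace x + field_trace y.
Proof. by have := field_trace_linear 1 x y; rewrite scale1r mul1r. Qed.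

Lemma field_traceZ a x : field_trace (a *: x) = a * field_trace x.
Proof. by rewrite -[a *: x]addr0 field_trace_linear field_trace0 addr0. Qed.

Lemma field_trace1 : field_trace 1 = m.+1%:R.
Proof.
rewrite /field_trace -(mxtrace1 rat m.+1); congr (\tr _).
apply/row_matrixP => i; rewrite row1 -coord_row_basis.
by apply/rowP => j; rewrite !mxE mul1r.
Qed.

(** The eigenvalues of multiplication by [x] are roots of a monic integer polynomial annihilating
    [x]. Their elementary symmetric functions are algebraic integers, and the trace is moreover
    rational. *)
Lemma field_trace_integral x :
  integralOver (intr : int -> L) x -> exists z : int, field_trace x = z%:~R.
Proof.
case=> p p_monic px.
pose pQ : {poly rat} := map_poly intr p.
pose pC : {poly algC} := map_poly intr p.
have pQL : map_poly (in_alg L) pQ = map_poly intr p.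
  by rewrite -map_poly_comp; apply: eq_map_poly => z; apply: (rmorph_int (in_alg L)).
have Hp : horner_mx (mul_mx x) pQ = 0 by apply: horner_mul_mx; rewrite pQL; apply/rootP.
pose MC : 'M[algC]_m.+1 := map_mx ratr (mul_mx x).
have HpC : horner_mx MC pC = 0.
  have -> : pC = map_poly ratr pQ.
    by rewrite -map_poly_comp; apply: eq_map_poly => z /=; rewrite ratr_int.
  by rewrite -map_horner_mx Hp map_mx0.
have [r rE] := closed_field_poly_normal (char_poly MC).
rewrite (monicP (char_poly_monic MC)) scale1r in rE.
have rA z : z \in r -> z \in Aint.
  move=> zr; apply: (@root_monic_Aint pC).
  - have /dvdpP[q ->] := mxminpoly_min HpC.
    rewrite rootM -eigenvalue_root_min eigenvalue_root_char rE.
    by rewrite root_prod_XsubC zr orbT.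
  - exact: monic_map.
  - by apply/polyOverP => i; rewrite coef_map /= intr_int.
have : char_poly MC \is a polyOver Aint.
  rewrite rE big_seq_cond; apply: rpred_prod => z; rewrite andbT => zr.
  by rewrite polyOverXsubC rA.
move=> /polyOverP/(_ m); rewrite -[m]/(m.+1.-1) char_poly_trace // rpredN.
rewrite trace_map_mx => TA.
have := Cint_rat_Aint _ TA.
rewrite Crat_rat => /(_ isT); rewrite Cint_rat => /intrP[z zE].
by exists z.
Qed.

(** For nonzero [y] the product of [y] and its inverse has trace [m.+1], nonzero in characteristic
    0. *)
Lemma trace_form_nondegenerate y :
  (forall j : 'I_m.+1, field_trace (y * b`_j) = 0) -> y = 0.
Proof.
move=> y0; apply/eqP/negPn/negP => y_n0.
have tr0 z : field_trace (y * z) = 0.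
  rewrite (coord_rowK z) mulr_sumr.
  elim/big_ind: _ => [|u v tu tv|i _]; first exact: field_trace0.
    by rewrite field_traceD tu tv addr0.
  by rewrite -scalerAr field_traceZ y0 mulr0.
have := tr0 y^-1; rewrite divff // field_trace1 => /eqP.
by rewrite pnatr_eq0.
Qed.

End Trace.

Section Conductor.
Local Open Scope ring_scope.
Variable L : fieldExtType rat.

(** The discriminant argument: with respect to a rational basis [e] inside [D], an integral [x] has
    integral traces against [e], so Cramer's rule for the Gram matrix bounds the denominators of its
    coordinates. [D] need only be an additive group. *)
Lemma integral_conductor (D : set L) :
  zmod_subgroup D ->
  (forall x, D x -> integralOver (intr : int -> L) x) ->
  (forall x, exists2 N : int, N != 0 & D (x *~ N)) ->
  exists2 d : int, d != 0 &
    forall x, integralOver (intr : int -> L) x -> D (x *~ d).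
Proof.
move=> gD Dint Dspan.
have [m [b b_basis]] : exists m (b : m.+1.-tuple L), basis_of fullv b.
  have : (0 < \dim {:L})%N by rewrite adim_gt0.
  have := vbasisP {:L}; move: (vbasis {:L}).
  by case: (\dim {:L}) => // m b; exists m, b.
have /choice[N0 N0P] i : exists N : int, N != 0 /\ D (b`_i *~ N).
  by have [N N_n0 DN] := Dspan b`_i; exists N.
pose N := \prod_(i < m.+1) N0 i.
have N_n0 : N != 0 by apply/prodf_neq0 => i _; have [] := N0P i.
have De (i : 'I_m.+1) : D (b`_i *~ N).
  rewrite /N (bigD1 i) //= mulrzA; apply: zmod_subgroupMz => //.
  by have [] := N0P i.
pose e i := b`_i *~ N.
have intM x y : integralOver (intr : int -> L) x -> integralOver (intr : int -> L) y ->
    integralOver (intr : int -> L) (x * y) by apply: integral_mul.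
have /choice[g gP] (ij : 'I_m.+1 * 'I_m.+1) :
    exists z : int, field_trace b (e ij.1 * e ij.2) = z%:~R.
  by apply: field_trace_integral => //; apply: intM; apply: Dint; apply: De.
pose G : 'M[int]_m.+1 := \matrix_(i, j) g (i, j).
pose GQ : 'M[rat]_m.+1 := map_mx intr G.
have GE (c : 'rV[rat]_m.+1) j : (c *m GQ) 0 j = field_trace b ((\sum_i c 0 i *: e i) * e j).
  rewrite mxE mulr_suml.
  rewrite (big_morph _ (field_traceD b) (field_trace0 b)).
  apply: eq_bigr => i _; rewrite !mxE -(gP (i, j)) -scalerAl.
  by rewrite field_traceZ.
have eZ c : \sum_(i < m.+1) c i *: e i = (\sum_i c i *: b`_i) *~ N.
  by rewrite mulrz_suml; apply: eq_bigr => i _; rewrite scalerMzr.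
have NL_n0 : N%:~R != 0 :> L.
  by rewrite -(rmorph_int (in_alg L)) fmorph_eq0 intr_eq0.
have detG : \det G != 0.
  have : GQ \in unitmx.
    rewrite -row_free_unit -kermx_eq0; apply/rowV0P => w /sub_kermxP wG.
    have y0 : \sum_i w 0 i *: e i = 0.
      apply: (trace_form_nondegenerate b_basis) => j.
      have := GE w j; rewrite wG mxE /e -[b`_j *~ N]scaler_int -scalerAr.
      by rewrite field_traceZ => /esym/eqP; rewrite mulf_eq0 intr_eq0 (negPf N_n0) => /eqP.
    apply/rowP => i; rewrite mxE.
    move: y0; rewrite eZ -mulrzr => /eqP; rewrite mulf_eq0 (negPf NL_n0) orbF.
    move=> /eqP y0; have /freeP/(_ _ y0 i) := basis_free b_basis.
    by [].
  by rewrite unitmxE unitfE det_map_mx intr_eq0.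
(* [N] turns the coordinates of [x] in the basis [b] into those of [x *~ N] in [e], and [\det G]
   makes them integers. *)
exists (\det G * N); first by rewrite mulf_neq0.
move=> x xint.
have /choice[t tP] (j : 'I_m.+1) : exists z : int, field_trace b (x *~ N * e j) = z%:~R.
  rewrite mulrzAl -mulrzAr; apply: field_trace_integral => //; apply: intM => //.
  by apply: Dint; apply: zmod_subgroupMz; last apply: De.
pose c := coord_row b x.
have cG : c *m GQ = map_mx intr (\row_j t j).
  by apply/rowP => j; rewrite GE eZ -coord_rowK // tP !mxE.
have cd : (\det G)%:~R *: c = map_mx intr ((\row_j t j) *m \adj G).
  rewrite map_mxM -cG map_mx_adj -mulmxA mul_mx_adj det_map_mx mul_mx_scalar.
  by [].
have -> : x *~ (\det G * N) = \sum_(i < m.+1) e i *~ (((\row_j t j) *m \adj G) 0 i).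
  rewrite mulrC mulrzA {1}(coord_rowK b_basis x) -eZ mulrz_suml.
  apply: eq_bigr => i _; have /rowP/(_ i) := cd; rewrite 2!mxE [RHS]mxE => E.
  by rewrite scalerMzl -mulrzl E scaler_int.
apply: zmod_subgroup_sum => // i _; apply: zmod_subgroupMz => //.
exact: De.
Qed.

End Conductor.

(** * From a commuting ring of integer matrices to a number field *)

Section NumberFieldCharacter.
Local Open Scope ring_scope.

Lemma number_field_character (n : nat) (K : set 'rV[int]_n)
    (S : set 'M[int]_n) :
  zmod_subgroup K ->
  (forall d : int, d != 0 -> exists i, ~ K (d *: delta_mx 0 i)) ->
  int_subring S ->
  (forall k P, K k -> S P -> K (k *m P)) ->
  (forall P Q i, S P -> S Q -> K (row i (P *m Q - Q *m P))) ->
  exists (L : fieldExtType rat) (lam : 'M[int]_n -> L) (d : nat),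
    [/\ (0 < d)%N,
        (forall P Q, S P -> S Q -> lam (P - Q) = lam P - lam Q) /\
          (forall P Q, S P -> S Q -> lam (P *m Q) = lam P * lam Q),
        forall P, S P -> (forall i, K (row i P)) -> lam P = 0,
        forall P, S P -> integralOver (intr : int -> L) (lam P)
      & forall x, integralOver (intr : int -> L) x ->
          exists2 P, S P & lam P = x *+ d].
Proof.
move=> gK infK rS KS Scomm; have [S1 SB SM] := rS.
have gS := int_subring_group rS.
have [lamC [lC1 lCB lCM lCK lCroot]] := eigencharacter gK infK rS KS Scomm.
have [t [g [Sg spanS]]] := matrix_subgroup_fg gS.
(* The values on finitely many additive generators generate the field; [io] embeds it into the
   algebraic numbers, and [s1] are the generators inside [L]. *)
have [L [io [s1 s1E s1gen]]] := num_field_exists [seq lamC (g j) | j <- enum 'I_t].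
have genS (T : set 'M[int]_n) : zmod_subgroup T -> (forall j, T (g j)) ->
    forall P, S P -> T P.
  move=> gT Tg P /spanS[k ->]; apply: zmod_subgroup_sum => // j _.
  exact: zmod_subgroupMz.
have lC0 : lamC 0 = 0 by rewrite -(subrr (1%:M : 'M_n)) lCB // subrr.
have [S0 _] := gS.
have io_s1 (j : 'I_t) : io s1`_j = lamC (g j).
  have sz : size s1 = t by have := congr1 size s1E; rewrite 2!size_map size_enum_ord.
  rewrite -(nth_map 0 0) ?sz // s1E (nth_map j) ?size_enum_ord //.
  by rewrite nth_ord_enum.
have /choice[lam lamP] P : exists x, S P -> io x = lamC P.
  have [SP|nSP] := pselect (S P); last by exists 0.
  suff [_ [x xE]] : S P /\ exists x, io x = lamC P by exists x.
  apply: (genS (fun P => S P /\ exists x, io x = lamC P)) => //.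
    split=> [|Q R [SQ [x xE]] [SR [y yE]]]; first by split=> //; exists 0; rewrite rmorph0.
    by split; [apply: SB | exists (x - y); rewrite rmorphB xE yE lCB].
  by move=> j; split; [apply: Sg | exists s1`_j; rewrite io_s1].
have io_inj : injective io by apply: fmorph_inj.
have lam1 : lam 1%:M = 1 by apply: io_inj; rewrite lamP // lC1 rmorph1.
have lamB P Q : S P -> S Q -> lam (P - Q) = lam P - lam Q.
  by move=> SP SQ; apply: io_inj; rewrite rmorphB !lamP ?lCB //; apply: SB.
have lamM P Q : S P -> S Q -> lam (P *m Q) = lam P * lam Q.
  by move=> SP SQ; apply: io_inj; rewrite rmorphM !lamP ?lCM //; apply: SM.
have lamg (j : 'I_t) : lam (g j) = s1`_j by apply: io_inj; rewrite lamP ?io_s1.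
have lam0 : lam 0 = 0 by apply: io_inj; rewrite lamP // lC0 rmorph0.
have lam_int P : S P -> integralOver (intr : int -> L) (lam P).
  move=> SP; exists (char_poly P^T); first exact: char_poly_monic.
  rewrite -(fmorph_root io) -map_poly_comp lamP //.
  rewrite (eq_map_poly (g := intr)); first exact: lCroot.
  by move=> z /=; rewrite rmorph_int.
pose D (x : L) := exists2 P, S P & lam P = x.
have gD : zmod_subgroup D.
  split; first by exists 0.
  by move=> _ _ [P SP <-] [Q SQ <-]; exists (P - Q); [apply: SB | apply: lamB].
pose W := <<s1>>%VS.
have sz1 : size s1 = t by have := congr1 size s1E; rewrite 2!size_map size_enum_ord.
have s1W (j : 'I_t) : s1`_j \in W by apply: memv_span; rewrite mem_nth ?sz1.
have DW P : S P -> lam P \in W.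
  move=> SP; apply: (genS (fun P => S P /\ lam P \in W) _ _ P SP).2.
    split=> [|Q R [SQ QW] [SR RW]]; first by rewrite lam0 mem0v.
    by split; [apply: SB | rewrite lamB // memvB].
  by move=> j; rewrite lamg.
(* The rational span [W] of the values is closed under products, because [S] is, and contains 1; so
   it is the field generated. *)
have Wfull x : x \in W.
  suff: (<<1 & s1>> <= W)%VS by rewrite s1gen => /subvP; apply; rewrite memvf.
  have W1 : (1 <= W)%VS by rewrite -memvE -lam1 DW.
  apply: agenv_sub_modl => //; rewrite (addv_idPr W1).
  apply/prodvP => u v uW vW.
  rewrite (@coord_span _ _ _ (in_tuple s1) u uW) (@coord_span _ _ _ (in_tuple s1) v vW) /=.
  rewrite mulr_suml memv_suml // => i _; rewrite mulr_sumr memv_suml // => j _.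
  have is1 : s1`_i \in s1 by rewrite mem_nth.
  rewrite -scalerAl -scalerAr !memvZ //.
  have lt k : (k < size s1)%N -> exists j : 'I_t, k = j.
    by rewrite sz1 => kt; exists (Ordinal kt).
  have [i' ->] := lt i (ltn_ord i); have [j' ->] := lt j (ltn_ord j).
  by rewrite -!lamg -lamM //; apply/DW/SM.
have [||d d_n0 dP] := integral_conductor gD.
- by move=> _ [P SP <-]; apply: lam_int.
- move=> x; rewrite (@coord_span _ _ _ (in_tuple s1) x (Wfull x)) /=.
  elim/big_ind: _ => [|u v [N N_n0 DN] [N' N'_n0 DN']|i _].
  + by exists 1 => //; rewrite mul0rz; case: gD.
  + exists (N * N'); first by rewrite mulf_neq0.
    rewrite mulrzDl; apply: zmod_subgroupD => //.
      by rewrite mulrzA; apply: zmod_subgroupMz.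
    by rewrite mulrC mulrzA; apply: zmod_subgroupMz.
  + set q := coord _ _ _; exists (denq q); first exact: denq_neq0.
    rewrite scalerMzl -mulrzr -numqE scaler_int; apply: zmod_subgroupMz => //.
    have it : (i < t)%N by rewrite -sz1.
    by exists (g (Ordinal it)) => //; rewrite lamg.
(* The absolute value makes [d] a natural number, to be used as an exponent in the group. *)
exists L, lam, `|d|%N; split=> //; first by rewrite absz_gt0.
  move=> P SP KP; apply: io_inj; rewrite lamP // rmorph0.
  exact: lCK.
move=> x /dP; case: (d) => e //; rewrite NegzE mulrNz => /(zmod_subgroupN gD).
by rewrite opprK abszN.
Qed.

End NumberFieldCharacter.

(** * The commutator pairing of the second center *)

Section Center.
Local Open Scope group_scope.
Variable G : groupType.

Definition central (x : G) : bool := `[< centralizing [set 1] x >].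

Lemma centralP x : reflect (forall g, [~ x, g] = 1) (central x).
Proof. exact: asboolP. Qed.

Lemma central_comm x g : central x -> x * g = g * x.
Proof. by move/centralP/(_ g)/eqP/commgP. Qed.

Lemma trivial_subgroup : is_subgroup [set (1 : G)].
Proof. by split=> [//|x y -> ->|x ->] /=; rewrite ?mulg1 ?invg1. Qed.

Lemma trivial_conj : conj_closed [set (1 : G)].
Proof. by move=> x y -> /=; rewrite conj1g. Qed.

Definition trivial_normal := NormalSubgroup trivial_subgroup trivial_conj.

Lemma center_group : is_subgroup [set x | central x].
Proof.
have [C1 CM CV] := upper_central_subgroup trivial_normal 1.
split=> [|x y /asboolP Cx /asboolP Cy|x /asboolP Cx]; apply/asboolP => //.
  exact: CM.
exact: CV.
Qed.

(** The center is made an additive group to let integer matrices act on families of commutators. *)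
Record center_of : Type := Center { center_val : G; center_valP : central center_val }.

HB.instance Definition _ := [isSub for center_val].
HB.instance Definition _ := [Choice of center_of by <:].

Lemma central1 : central 1.
Proof. by case: center_group. Qed.

Lemma centralM x y : central x -> central y -> central (x * y).
Proof. by case: center_group => _ CM _; apply: CM. Qed.

Lemma centralV x : central x -> central x^-1.
Proof. by case: center_group => _ _ CV; apply: CV. Qed.

Definition center_zero : center_of := Center central1.
Definition center_add (x y : center_of) : center_of :=
  Center (centralM (center_valP x) (center_valP y)).
Definition center_opp (x : center_of) : center_of :=
  Center (centralV (center_valP x)).

Fact center_addA : associative center_add.
Proof. by move=> x y z; apply: val_inj; rewrite /= mulgA. Qed.
Fact center_addC : commutative center_add.
Proof. by move=> x y; apply: val_inj => /=; apply/central_comm/center_valP. Qed.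
Fact center_add0 : left_id center_zero center_add.
Proof. by move=> x; apply: val_inj; rewrite /= mul1g. Qed.
Fact center_addN : left_inverse center_zero center_opp center_add.
Proof. by move=> x; apply: val_inj; rewrite /= mulVg. Qed.

HB.instance Definition _ :=
  GRing.isZmodule.Build center_of center_addA center_addC center_add0 center_addN.

(** Noncentral elements are sent to 0, so an equality between values says something about [G] only
    for central arguments. *)
Definition in_center (x : G) : center_of := insubd center_zero x.

Lemma in_centerK x : central x -> center_val (in_center x) = x.
Proof. exact: (@insubdK G central). Qed.

Lemma in_center_inj x y : central x -> central y -> in_center x = in_center y -> x = y.
Proof. by move=> Cx Cy e; rewrite -(in_centerK Cx) -(in_centerK Cy) e. Qed.

Lemma in_center1 : in_center 1 = 0%R.
Proof. by apply: val_inj; rewrite /= in_centerK // central1. Qed.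

Lemma in_centerM x y : central x -> central y ->
  in_center (x * y) = (in_center x + in_center y)%R.
Proof.
by move=> Cx Cy; apply: val_inj; rewrite /= !in_centerK // centralM.
Qed.

Lemma in_center_prod (I : finType) (F : I -> G) : (forall i, central (F i)) ->
  central (\prod_(i <- enum I) F i) /\
  in_center (\prod_(i <- enum I) F i) = (\sum_i in_center (F i))%R.
Proof.
move=> CF; rewrite -big_enum /=; elim: (enum I) => [|i s [Cs IH]].
  by rewrite !big_nil in_center1 central1.
by rewrite !big_cons in_centerM // IH centralM.
Qed.

Definition second_center : set G := centralizing (centralizing [set 1]).
Local Notation Y := second_center.

Lemma second_center_subgroup : is_subgroup Y.
Proof. exact: (upper_central_subgroup trivial_normal 2). Qed.

Lemma second_centerP x : Y x <-> forall g, central [~ x, g].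
Proof. by split=> [h g|h g]; apply/asboolP/h. Qed.

Lemma central_conj x y : central x -> x ^ y = x.
Proof. by move=> /centralP/(_ y)/eqP/conjg_fixP. Qed.

(** Bilinear on the second center times [G], with left kernel the center; it therefore sees the
    second center exactly modulo the center. *)
Definition pairing (x g : G) : center_of := in_center [~ x, g].

Lemma pairingMl x y g : Y x -> Y y -> pairing (x * y) g = (pairing x g + pairing y g)%R.
Proof.
move=> /second_centerP Yx /second_centerP Yy.
by rewrite /pairing commMg central_conj // in_centerM.
Qed.

Lemma pairingMr x g h : Y x -> pairing x (g * h) = (pairing x g + pairing x h)%R.
Proof.
move=> /second_centerP Yx.
by rewrite /pairing commgM central_conj // in_centerM // addrC.
Qed.

Lemma pairing1l g : pairing 1 g = 0%R.
Proof. by rewrite /pairing comm1g in_center1. Qed.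

Lemma pairing1r x : pairing x 1 = 0%R.
Proof. by rewrite /pairing commg1 in_center1. Qed.

Lemma pairingVl x g : Y x -> pairing x^-1 g = (- pairing x g)%R.
Proof.
move=> Yx; have [_ _ YV] := second_center_subgroup.
by apply/eqP; rewrite -addr_eq0 -pairingMl ?mulVg ?pairing1l //; apply: YV.
Qed.

Lemma pairingVr x g : Y x -> pairing x g^-1 = (- pairing x g)%R.
Proof. by move=> Yx; apply/eqP; rewrite -addr_eq0 -pairingMr // mulVg pairing1r. Qed.

Lemma pairing_inj x y g h : Y x -> Y y -> pairing x g = pairing y h -> [~ x, g] = [~ y, h].
Proof. by move=> /second_centerP Yx /second_centerP Yy; apply: in_center_inj. Qed.

Lemma pairing_eq0 x : Y x -> (forall g, pairing x g = 0%R) -> central x.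
Proof.
move=> /second_centerP Yx x0; apply/centralP => g.
by apply: in_center_inj; rewrite ?in_center1 ?central1 //; apply: x0.
Qed.

End Center.

Section IntegerAction.
Local Open Scope ring_scope.
Variables (Z : zmodType).

(** The matrix product [A F], where the entries of [F] lie in a mere abelian group; [ract] is the
    product [F A]. *)
Definition lact m n r (A : 'M[int]_(m, n)) (F : 'M[Z]_(n, r)) : 'M[Z]_(m, r) :=
  \matrix_(i, j) \sum_l F l j *~ A i l.

Definition ract m n r (F : 'M[Z]_(m, n)) (A : 'M[int]_(n, r)) : 'M[Z]_(m, r) :=
  \matrix_(i, j) \sum_l F i l *~ A l j.

Lemma lact_mul m n p r (A : 'M_(m, n)) (B : 'M_(n, p)) (F : 'M[Z]_(p, r)) :
  lact (A *m B) F = lact A (lact B F).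
Proof.
apply/matrixP => i j; rewrite !mxE.
under eq_bigr => l _ do rewrite mxE mulrz_sumr.
rewrite exchange_big /=; apply: eq_bigr => l _; rewrite mxE mulrz_suml.
by apply: eq_bigr => q _; rewrite mulrC mulrzA.
Qed.

Lemma ract_mul m n p r (F : 'M[Z]_(m, n)) (A : 'M_(n, p)) (B : 'M_(p, r)) :
  ract F (A *m B) = ract (ract F A) B.
Proof.
apply/matrixP => i j; rewrite !mxE.
under eq_bigr => l _ do rewrite mxE mulrz_sumr.
rewrite exchange_big /=; apply: eq_bigr => l _; rewrite mxE mulrz_suml.
by apply: eq_bigr => q _; rewrite mulrzA.
Qed.

Lemma lact_ract m n p r (A : 'M_(m, n)) (F : 'M[Z]_(n, p)) (B : 'M_(p, r)) :
  lact A (ract F B) = ract (lact A F) B.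
Proof.
apply/matrixP => i j; rewrite !mxE.
under eq_bigr => l _ do rewrite mxE mulrz_suml.
rewrite exchange_big /=; apply: eq_bigr => l _; rewrite mxE mulrz_suml.
by apply: eq_bigr => q _; rewrite -!mulrzA mulrC.
Qed.

Lemma lactB m n r (A B : 'M_(m, n)) (F : 'M[Z]_(n, r)) :
  lact (A - B) F = lact A F - lact B F.
Proof.
apply/matrixP => i j; rewrite !mxE -sumrB; apply: eq_bigr => l _.
by rewrite !mxE mulrzBr.
Qed.

Lemma ractB m n r (A B : 'M_(n, r)) (F : 'M[Z]_(m, n)) :
  ract F (A - B) = ract F A - ract F B.
Proof.
apply/matrixP => i j; rewrite !mxE -sumrB; apply: eq_bigr => l _.
by rewrite !mxE mulrzBr.
Qed.

Lemma lact0 m n r (F : 'M[Z]_(n, r)) : lact (0 : 'M_(m, n)) F = 0.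
Proof. by rewrite -(subrr 0) lactB subrr. Qed.

Lemma lactD m n r (A B : 'M_(m, n)) (F : 'M[Z]_(n, r)) :
  lact (A + B) F = lact A F + lact B F.
Proof.
apply/matrixP => i j; rewrite !mxE -big_split; apply: eq_bigr => l _.
by rewrite !mxE mulrzDr.
Qed.

Lemma lact_sum m n r (I : Type) (s : seq I) (A : I -> 'M_(m, n)) (F : 'M[Z]_(n, r)) :
  lact (\sum_(i <- s) A i) F = \sum_(i <- s) lact (A i) F.
Proof.
elim/big_rec2: _ => [|i B C _ <-]; first by rewrite lact0.
by rewrite lactD.
Qed.

Lemma lactBr m n r (A : 'M_(m, n)) (F F' : 'M[Z]_(n, r)) :
  lact A (F - F') = lact A F - lact A F'.
Proof.
apply/matrixP => i j; rewrite !mxE -sumrB; apply: eq_bigr => l _.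
by rewrite !mxE mulrzBl.
Qed.

Lemma lact1 n r (F : 'M[Z]_(n, r)) : lact 1%:M F = F.
Proof.
apply/matrixP => i j; rewrite mxE (bigD1 i) //= mxE eqxx big1 ?addr0 //.
by move=> l /negPf li; rewrite mxE eq_sym li.
Qed.

Lemma ract1 n r (F : 'M[Z]_(n, r)) : ract F 1%:M = F.
Proof.
apply/matrixP => i j; rewrite mxE (bigD1 j) //= mxE eqxx big1 ?addr0 //.
by move=> l /negPf li; rewrite mxE li.
Qed.

Lemma ract0l m n r (A : 'M_(n, r)) : ract (0 : 'M[Z]_(m, n)) A = 0.
Proof.
by apply/matrixP => i j; rewrite !mxE big1 // => l _; rewrite mxE mul0rz.
Qed.

Lemma lact_row m n r (A : 'M_(m, n)) (F : 'M[Z]_(n, r)) i :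
  lact (row i A) F = row i (lact A F).
Proof. by apply/matrixP => a j; rewrite !mxE; apply: eq_bigr => l _; rewrite mxE. Qed.

Lemma lact_delta n r (F : 'M[Z]_(n, r)) (d : int) i j :
  lact (d *: delta_mx (0 : 'I_1) i) F 0 j = F i j *~ d.
Proof.
rewrite mxE (bigD1 i) //= big1 ?addr0; first by rewrite !mxE !eqxx mulr1.
by move=> l /negPf li; rewrite !mxE eqxx li mulr0.
Qed.

End IntegerAction.

Lemma term_fun_exp (G : groupType) (V : Type)
    (F : (V -> group_structure G) -> group_structure G) k :
  term_fun F -> term_fun (fun a => (F a : G) ^+ k : group_structure G)%g.
Proof.
move=> tF; elim: k => [|k [t tE]]; first exact: term_fun_const.
have [u uE] := term_fun_mul tF (ex_intro _ t tE).
by exists u => a; rewrite uE expgS.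
Qed.

(** * Integer matrices of endomorphisms and their definability *)

Section Coordinates.
Local Open Scope ring_scope.
Variables (G : groupType) (r : nat) (s : r.-tuple G).
Hypothesis gen : @generates _ (group_structure G) r s.
Local Notation Y := (@second_center G).
Local Notation Zc := (center_of G).

Lemma rV_subgroup_full m (T : set 'rV[int]_m) :
  zmod_subgroup T -> (forall i, T (delta_mx 0 i)) -> forall q, T q.
Proof.
move=> gT Td q; rewrite [q]row_sum_delta; apply: zmod_subgroup_sum => // i _.
by rewrite -[q 0 i]intz scaler_int; apply: zmod_subgroupMz.
Qed.

(** Coordinates in terms of the [y_i] are asserted through the pairing only, that is, modulo the
    center, where the second center is abelian. *)
Lemma pairing_span n (y : 'I_n -> G) (l : seq G) :
  l = [seq y i | i <- enum 'I_n] -> (forall x, x \in l -> Y x) ->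
  (forall H, is_subgroup H -> (forall x, x \in l -> H x) -> forall x, Y x -> H x) ->
  forall x, Y x -> exists k : 'rV[int]_n, forall g,
    pairing x g = \sum_i pairing (y i) g *~ k 0 i.
Proof.
move=> lE Yl span x Yx; have [Y1 YM YV] := @second_center_subgroup G.
apply: (span [set x | Y x /\ exists k : 'rV[int]_n, forall g,
    pairing x g = \sum_i pairing (y i) g *~ k 0 i] _ _ x Yx).2.
- split=> [|u v [Yu [k kP]] [Yv [k' k'P]]|u [Yu [k kP]]] /=.
  + split=> //; exists 0 => g; rewrite pairing1l big1 // => i _.
    by rewrite mxE.
  + split; first exact: YM.
    exists (k + k') => g; rewrite pairingMl // kP k'P -big_split.
    by apply: eq_bigr => i _; rewrite mxE mulrzDr.
  + split; first exact: YV.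
    exists (- k) => g; rewrite pairingVl // kP -sumrN.
    by apply: eq_bigr => i _; rewrite mxE mulrNz.
- move=> u ul; split; first exact: Yl.
  move: ul; rewrite lE => /mapP[i _ ->]; exists (delta_mx 0 i) => g.
  rewrite (bigD1 i) //= mxE !eqxx big1 ?addr0 // => j /negPf ji.
  by rewrite mxE ji andbF.
Qed.

Lemma second_center_generators : finite_index Y ->
  exists n (y : 'I_n -> G), (forall i, Y (y i)) /\
    forall x, Y x -> exists k : 'rV[int]_n, forall g,
      pairing x g = \sum_i pairing (y i) g *~ k 0 i.
Proof.
move=> /(finite_index_generated gen (@second_center_subgroup G))[l [Yl span]].
exists (size l), (fun i => tnth (in_tuple l) i); split.
  by move=> i; apply: Yl; apply: mem_tnth.
have lE : l = [seq tnth (in_tuple l) i | i <- enum 'I_(size l)] by rewrite map_tnth_enum.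
exact: (pairing_span lE).
Qed.

Variables (n : nat) (y : 'I_n -> G).
Hypothesis Yy : forall i, Y (y i).
Hypothesis spanY : forall x, Y x -> exists k : 'rV[int]_n, forall g,
  pairing x g = \sum_i pairing (y i) g *~ k 0 i.

Definition pairing_mx m (x : 'I_n -> G) (w : 'I_m -> G) : 'M[Zc]_(n, m) :=
  \matrix_(i, j) pairing (x i) (w j).

Local Notation F := (pairing_mx y (tnth s)).

(* [x_i] is the product of the [y_l ^ P i l] modulo the center. *)
Definition represents (x : 'I_n -> G) (P : 'M[int]_n) : Prop :=
  (forall i, Y (x i)) /\ pairing_mx x (tnth s) = lact P F.

(** Both sides are additive in [w j], so the identity extends from the generators to all of [G]. *)
Lemma represents_pairing x P m (w : 'I_m -> G) :
  represents x P -> pairing_mx x w = lact P (pairing_mx y w).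
Proof.
move=> [Yx /matrixP xP]; apply/matrixP => i j; rewrite !mxE.
pose H := [set g | pairing (x i) g = \sum_l pairing (y l) g *~ P i l].
suff : H (w j) by move=> /= ->; apply: eq_bigr => l _; rewrite mxE.
apply: (generates_subgroup gen) => [|k]; last first.
  by have := xP i k; rewrite !mxE /H /mkset => ->; apply: eq_bigr => l _; rewrite mxE.
split=> [|g h|g]; rewrite /H /=; [|move=> Hg Hh|move=> Hg].
- by rewrite pairing1r big1 // => l _; rewrite pairing1r mul0rz.
- rewrite pairingMr // Hg Hh -big_split; apply: eq_bigr => l _.
  by rewrite pairingMr // mulrzDl.
- rewrite pairingVr // Hg -sumrN; apply: eq_bigr => l _.
  by rewrite pairingVr // mulNrz.
Qed.

Lemma row_coordinates (x : 'I_n -> G) : (forall i, Y (x i)) -> exists P, represents x P.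
Proof.
move=> Yx; have /choice[k kP] i := spanY (Yx i).
exists (\matrix_(i, l) k i 0 l); split=> //; apply/matrixP => i j; rewrite !mxE kP.
by apply: eq_bigr => l _; rewrite !mxE.
Qed.

Lemma column_coordinates m (w : 'I_m -> G) : exists Q, pairing_mx y w = ract F Q.
Proof.
suff /choice[q qP] j : exists q : 'cV[int]_r, forall i,
    pairing (y i) (w j) = \sum_l F i l *~ q l 0.
  exists (\matrix_(l, j) q j l 0); apply/matrixP => i j; rewrite mxE qP mxE.
  by apply: eq_bigr => l _; rewrite !mxE.
apply: (generates_subgroup gen (H := [set g | exists q : 'cV[int]_r, forall i,
    pairing (y i) g = \sum_l F i l *~ q l 0])) => [|k].
  split=> [|g h [q qP] [q' q'P]|g [q qP]] /=.
  - by exists 0 => i; rewrite pairing1r big1 // => l _; rewrite [X in _ *~ X]mxE mulr0z.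
  - exists (q + q') => i; rewrite pairingMr // qP q'P -big_split.
    by apply: eq_bigr => l _; rewrite [(q + q') l 0]mxE mulrzDr.
  - exists (- q) => i; rewrite pairingVr // qP -sumrN.
    by apply: eq_bigr => l _; rewrite [(- q) l 0]mxE mulrNz.
exists (delta_mx k 0) => i; rewrite (bigD1 k) //= [delta_mx k 0 k 0]mxE !eqxx.
rewrite big1 ?addr0 ?mxE // => j' /negPf jk.
by rewrite [delta_mx _ _ _ _]mxE jk.
Qed.

Lemma exists_represented P : exists x, represents x P.
Proof.
suff /choice[x xP] i : exists x, Y x /\ forall j,
    pairing x (tnth s j) = \sum_l F l j *~ P i l.
  exists x; split=> [i|]; first by have [] := xP i.
  by apply/matrixP => i j; rewrite [LHS]mxE (xP i).2 [RHS]mxE.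
have [Y1 YM YV] := @second_center_subgroup G.
have := @rV_subgroup_full n [set k | exists x, Y x /\ forall j,
    pairing x (tnth s j) = \sum_l F l j *~ k 0 l] _ _ (row i P).
case=> [||x [Yx xP]] /=.
- split=> [|k k' [x [Yx xP]] [x' [Yx' x'P]]].
    by exists 1%g; split=> // j; rewrite pairing1l big1 // => l _; rewrite [X in _ *~ X]mxE mulr0z.
  exists (x * x'^-1)%g; split; first by apply: YM => //; apply: YV.
  move=> j; rewrite pairingMl ?pairingVl ?xP ?x'P //; last exact: YV.
  by rewrite -sumrB; apply: eq_bigr => l _; rewrite [(k - k') 0 l]mxE [(- k') 0 l]mxE mulrzBr.
- move=> l; exists (y l); split=> // j; rewrite (bigD1 l) //= [delta_mx _ _ _ _]mxE !eqxx.
  rewrite big1 ?addr0 ?mxE // => j' /negPf jk.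
  by rewrite [delta_mx _ _ _ _]mxE jk.
- by exists x; split=> // j; rewrite xP; apply: eq_bigr => l _; rewrite [row i P 0 l]mxE.
Qed.

Lemma exists_witness m (Q : 'M[int]_(r, m)) : exists w, pairing_mx y w = ract F Q.
Proof.
suff /choice[w wP] j : exists w, forall i, pairing (y i) w = \sum_l F i l *~ Q l j.
  by exists w; apply/matrixP => i j; rewrite [LHS]mxE wP [RHS]mxE.
have := @rV_subgroup_full r [set k | exists w, forall i,
    pairing (y i) w = \sum_l F i l *~ k 0 l] _ _ (row j Q^T).
case=> [||w wP] /=.
- split=> [|k k' [w wP] [w' w'P]].
    by exists 1%g => i; rewrite pairing1r big1 // => l _; rewrite [X in _ *~ X]mxE mulr0z.
  exists (w * w'^-1)%g => i; rewrite pairingMr ?pairingVr // wP w'P.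
  by rewrite -sumrB; apply: eq_bigr => l _; rewrite [(k - k') 0 l]mxE [(- k') 0 l]mxE mulrzBr.
- move=> l; exists (tnth s l) => i; rewrite (bigD1 l) //= [delta_mx _ _ _ _]mxE !eqxx.
  rewrite big1 ?addr0 ?mxE // => j' /negPf jk.
  by rewrite [delta_mx _ _ _ _]mxE jk.
- by exists w => i; rewrite wP; apply: eq_bigr => l _; rewrite [row _ _ 0 l]mxE [Q^T _ _]mxE.
Qed.

Lemma representsB x x' P P' : represents x P -> represents x' P' ->
  represents (fun i => (x i)^-1 * x' i)%g (P' - P).
Proof.
have [_ YM YV] := @second_center_subgroup G.
move=> [Yx xP] [Yx' x'P]; split=> [i|]; first by apply: YM => //; apply: YV.
rewrite lactB -xP -x'P; apply/matrixP => i j; rewrite !mxE.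
by rewrite pairingMl ?pairingVl 1?addrC //; apply: YV.
Qed.

Lemma representsN x P : represents x P -> represents (fun i => (x i)^-1)%g (- P).
Proof.
have [Y1 _ _] := @second_center_subgroup G.
move=> xP; have h0 : represents (fun=> 1%g) 0.
  split=> //; rewrite lact0; apply/matrixP => i j; rewrite !mxE.
  exact: pairing1l.
have := representsB xP h0; rewrite sub0r.
by under eq_fun => i do rewrite mulg1.
Qed.

Lemma representsD x x' P P' : represents x P -> represents x' P' ->
  represents (fun i => x i * x' i)%g (P + P').
Proof.
move=> /representsN xP x'P; have := representsB xP x'P.
by rewrite opprK addrC; under eq_fun => i do rewrite invgK.
Qed.

Lemma representsX x P k : represents x P ->
  represents (fun i => x i ^+ k)%g (P *+ k).
Proof.
move=> xP; elim: k => [|k IH].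
  have := representsD xP (representsN xP); rewrite subrr mulr0n.
  by under eq_fun => i do rewrite mulgV.
rewrite mulrS; have := representsD xP IH.
by under eq_fun => i do rewrite -expgS.
Qed.

Lemma represents_uniq x P P' : represents x P -> represents x P' ->
  lact (P - P') F = 0.
Proof. by move=> [_ xP] [_ xP']; rewrite lactB -xP -xP' subrr. Qed.

(* The matrices of the endomorphisms with an adjoint; [ract _ Q] applies the
   adjoint to the generators [s]. *)
Definition scalars : set 'M[int]_n := 
  [set P | exists Q : 'M[int]_r, lact P F = ract F Q].

Definition central_scalars : set 'M[int]_n := [set P | scalars P /\
  forall Q, scalars Q -> lact (P *m Q - Q *m P) F = 0].

(** The kernel of the map from integer rows onto the second center modulo the center that sends the
    basis to the [y_l]. *)
Definition relations : set 'rV[int]_n := [set k | lact k F = 0].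

Lemma scalars_subring : int_subring scalars.
Proof.
split=> [|P P' [Q e] [Q' e']|P P' [Q e] [Q' e']].
- by exists 1%:M; rewrite lact1 ract1.
- by exists (Q - Q'); rewrite lactB ractB e e'.
- by exists (Q *m Q'); rewrite lact_mul e' lact_ract e ract_mul.
Qed.

(** The adjoint moves [P] to the other side of [F]. Hence a matrix with an adjoint preserves the
    relations and does define an endomorphism of the quotient. *)
Lemma scalars_null m P (M : 'M[int]_(m, n)) : scalars P -> lact M F = 0 -> lact (M *m P) F = 0.
Proof. by move=> [Q e] M0; rewrite lact_mul e lact_ract M0 ract0l. Qed.

Lemma lact0r m (A : 'M[int]_(m, n)) : lact A (0 : 'M[Zc]_(n, r)) = 0.
Proof. by rewrite -(subrr 0) lactBr subrr. Qed.

Lemma central_scalars_subring : int_subring central_scalars.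
Proof.
have [S1 SB SM] := scalars_subring; split.
- by split=> // Q SQ; rewrite mul1mx mulmx1 subrr lact0.
- move=> P P' [SP cP] [SP' cP']; split; first exact: SB.
  move=> Q SQ; have -> : (P - P') *m Q - Q *m (P - P') =
      (P *m Q - Q *m P) - (P' *m Q - Q *m P').
    rewrite mulmxBl mulmxBr !opprB addrACA [RHS]addrACA; congr (_ + _).
    exact: addrC.
  by rewrite lactB cP // cP' // subrr.
- move=> P P' [SP cP] [SP' cP']; split; first exact: SM.
  move=> Q SQ; have -> : P *m P' *m Q - Q *m (P *m P') =
      P *m (P' *m Q - Q *m P') + (P *m Q - Q *m P) *m P'.
    by rewrite mulmxBr mulmxBl !mulmxA addrA subrK.
  rewrite lactD lact_mul cP' // lact0r add0r.
  by apply: scalars_null => //; apply: cP.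
Qed.

Lemma relations_group : zmod_subgroup relations.
Proof.
by split=> [|k k']; rewrite /relations /= ?lact0 // => e e'; rewrite lactB e e' subrr.
Qed.

Lemma relationsM k P : relations k -> central_scalars P -> relations (k *m P).
Proof. by move=> k0 [SP _]; apply: scalars_null. Qed.

Lemma central_scalars_comm P Q i : central_scalars P -> central_scalars Q ->
  relations (row i (P *m Q - Q *m P)).
Proof.
move=> [SP cP] [SQ _]; rewrite /relations /= lact_row cP //.
by apply/matrixP => a j; rewrite !mxE.
Qed.

Lemma null_rows (P : 'M[int]_n) : lact P F = 0 -> forall i, relations (row i P).
Proof.
by move=> P0 i; rewrite /relations /= lact_row P0; apply/matrixP => a j; rewrite !mxE.
Qed.

(** If [d] annihilated every pairing with the [y_l], exponents would matter only modulo [d], so the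
    center would have finite index in [Y] and hence in [G]. *)
Lemma relations_infinite_index : finite_index Y ->
  ~ finite_index (centralizing [set (1%g : G)]) ->
  forall d : int, d != 0 -> exists i, ~ relations (d *: delta_mx 0 i).
Proof.
move=> [T hT] infZ d d_n0; apply: contrapT => no; apply: infZ.
have df i j : F i j *~ d = 0.
  have : relations (d *: delta_mx 0 i) by apply: contrapT => h; apply: no; exists i.
  by rewrite /relations /= => /matrixP/(_ 0 j); rewrite lact_delta [RHS]mxE.
have dm_gt0 : (0 < `|d|)%N by rewrite absz_gt0.
have [Y1 YM YV] := @second_center_subgroup G.
pose cls (c : {ffun 'I_n -> 'I_`|d|}) (x : G) := Y x /\ forall j,
  pairing x (tnth s j) = \sum_l F l j *+ c l.
(* [z c] is an element of [Y] with residues [c] as exponents if there is one, and otherwise some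
   harmless element of [Y]. *)
have /choice[z zP] c : exists z, (Y z) /\ ((exists x, cls c x) -> cls c z).
  by have [[x cx]|nx] := pselect (exists x, cls c x);
    [exists x; case: (cx) | exists 1%g].
exists [seq (t * z c)%g | t <- T, c <- enum {ffun 'I_n -> 'I_`|d|}] => g.
have [t tT Yt] := hT g; set u := (t^-1 * g)%g in Yt.
have [k kP] := spanY Yt.
have lt l : (`|(k ord0 l %% d)%Z| < `|d|)%N.
  by rewrite -ltz_nat gez0_abs ?modz_ge0 // ltz_mod.
pose c := [ffun l => Ordinal (lt l)].
have cu : cls c u.
  split=> // j; rewrite kP; apply: eq_bigr => l _; rewrite ffunE /=.
  rewrite {1}[k 0 l](divz_eq _ d) mulrzDr mulrC mulrzA -[pairing _ _]/(pairing (y l) (tnth s j)).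
  have := df l j; rewrite mxE => ->; rewrite mul0rz add0r.
  by rewrite [RHS]pmulrn gez0_abs ?modz_ge0.
have [Yz /(_ (ex_intro _ u cu)) [_ cz]] := zP c.
exists (t * z c)%g.
  by apply/allpairsP; exists (t, c); split=> //=; rewrite mem_enum.
have -> : ((t * z c)^-1 * g = (z c)^-1 * u)%g by rewrite invgM -mulgA.
apply/asboolP; apply: pairing_eq0; first by apply: YM => //; apply: YV.
move=> h; apply: (generates_subgroup gen (H := [set h | pairing ((z c)^-1 * u)%g h = 0])).
  have Yzu : Y ((z c)^-1 * u)%g by apply: YM => //; apply: YV.
  split=> [|a b a0 b0|a a0] /=; first by rewrite pairing1r.
    by rewrite pairingMr // a0 b0 addr0.
  by rewrite pairingVr // a0 oppr0.
move=> j /=; rewrite pairingMl ?pairingVl //; last exact: YV.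
by rewrite cz (proj2 cu) addNr.
Qed.

(** [w j] is the image of the [j]-th generator under an adjoint of the endomorphism sending [y i] to
    [x i]. *)
Definition witness (x : 'I_n -> G) (w : 'I_r -> G) : Prop :=
  forall i j, [~ x i, tnth s j]%g = [~ y i, w j]%g.

Lemma comm_pairing_mx m (x x' : 'I_n -> G) (w w' : 'I_m -> G) :
  (forall i, Y (x i)) -> (forall i, Y (x' i)) ->
  (forall i j, [~ x i, w j]%g = [~ x' i, w' j]%g) <->
  pairing_mx x w = pairing_mx x' w'.
Proof.
move=> Yx Yx'; split=> [e|/matrixP e i j].
  by apply/matrixP => i j; rewrite !mxE /pairing e.
by apply: pairing_inj => //; have := e i j; rewrite !mxE.
Qed.

Lemma witnessP x w : (forall i, Y (x i)) ->
  witness x w <-> pairing_mx x (tnth s) = pairing_mx y w.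
Proof. by move=> Yx; apply: comm_pairing_mx. Qed.

Lemma scalars_witness x P : represents x P -> scalars P -> exists w, witness x w.
Proof.
move=> [Yx xP] [Q e]; have [w wQ] := exists_witness Q.
by exists w; apply/witnessP => //; rewrite xP e.
Qed.

Lemma witness_scalars x w P : represents x P -> witness x w -> scalars P.
Proof.
move=> [Yx xP] /witnessP xw; have [Q e] := column_coordinates w.
by exists Q; rewrite -xP xw.
Qed.

(** Pairing another tuple with the adjoint of [P] composes the two endomorphisms; every product of
    scalars is expressed by equations in this way. *)
Lemma witness_pairing x w P x' P' : represents x P -> witness x w ->
  represents x' P' -> pairing_mx x' w = lact (P' *m P) F.
Proof.
move=> [Yx xP] /witnessP xw x'P.
by rewrite (represents_pairing w x'P) -xw // xP lact_mul.
Qed.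

Lemma second_center_definable : e_definable_in (as_unary Y).
Proof.
have fgG : finitely_generated (group_structure G) by exists r, s.
apply: (upper_central_definable (N := trivial_normal G) 2 fgG).
apply/e_definableP; apply: (@diophantine_ext _ (group_structure G) _
  (fun a => a ord0 = (1%g : G))).
  by move=> a; rewrite /as_unary /= /thead tnth_mktuple.
apply: diophantine_eq; first exact: (@term_fun_var _ (group_structure G)).
exact: (@term_fun_const _ (group_structure G)).
Qed.

Local Notation M := (group_structure G).

(** Additive generators [p c] of [I] also generate it as an ideal, so its elements are the sums of
    [p c *m R c] with central scalars [R c]. These can be quantified over by equations, in place of
    integer coefficients. *)
Lemma ideal_definable (I : set 'M[int]_n) :
  zmod_subgroup I -> (forall P, I P -> central_scalars P) ->
  (forall P Q, I P -> central_scalars Q -> I (P *m Q)) ->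
  @diophantine _ M 'I_n (fun x => exists2 P, I P & represents x P).
Proof.
move=> gI IS IM.
have rS0 := central_scalars_subring; have gS0 := int_subring_group rS0.
have [S01 S0B S0M] := rS0.
have [t [p [Ip spanI]]] := matrix_subgroup_fg gI.
have [q [rho [Srho spanS]]] := matrix_subgroup_fg (int_subring_group scalars_subring).
have /choice[xp xpP] c := exists_represented (p c).
have /choice[xr xrP] e := exists_represented (rho e).
have /choice[wr wrP] e := scalars_witness (xrP e) (Srho e).
pose U := ('I_t * 'I_n + 'I_t * 'I_r)%type.
pose X (u : U -> G) c i := u (inl (c, i)).
pose W (u : U -> G) c j := u (inr (c, j)).
(* The equations say, in this order, that each [X u c] has the adjoint [W u c], that it commutes
   with the additive generators [rho e] of the scalars, and that [x] is the sum over [c] of the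
   products with [p c]. *)
pose D (x : 'I_n -> G) (u : U -> G) :=
  ((forall c i, Y (X u c i)) /\ (forall c i j, [~ X u c i, tnth s j]%g = [~ y i, W u c j]%g)) /\
  (forall c e i j, [~ xr e i, W u c j]%g = [~ X u c i, wr e j]%g) /\
  (forall i j, [~ x i, tnth s j]%g = \prod_(c <- enum 'I_t) [~ xp c i, W u c j]%g)%g.
(* The witness [W u c] gives the product [rho e *m R] and the witness [wr e] the product
   [R *m rho e]. Testing the [rho e] suffices as the commutator is additive in [Q]. *)
have commR c (R : 'M[int]_n) u : represents (X u c) R -> witness (X u c) (W u c) ->
    (forall e i j, [~ xr e i, W u c j]%g = [~ X u c i, wr e j]%g) <-> central_scalars R.
  move=> uR uw; have SR := witness_scalars uR uw.
  have key e : (forall i j, [~ xr e i, W u c j]%g = [~ X u c i, wr e j]%g) <->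
      lact (R *m rho e - rho e *m R) F = 0.
    rewrite (comm_pairing_mx _ _ (xrP e).1 uR.1).
    rewrite (witness_pairing uR uw (xrP e)) (witness_pairing (xrP e) (wrP e) uR).
    by rewrite lactB; split=> [->|/eqP]; rewrite ?subrr // subr_eq0 => /eqP.
  split=> [h|[_ cR] e]; last by apply/key/cR.
  split=> // Q /spanS[k ->].
  have gT : zmod_subgroup [set Q | lact (R *m Q - Q *m R) F = 0].
    split=> [|Q1 Q2] /=; first by rewrite mul0mx mulmx0 subrr lact0.
    move=> Q10 Q20; have -> : R *m (Q1 - Q2) - (Q1 - Q2) *m R =
        (R *m Q1 - Q1 *m R) - (R *m Q2 - Q2 *m R).
      rewrite mulmxBl mulmxBr !opprB addrACA [RHS]addrACA; congr (_ + _).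
      exact: addrC.
    by rewrite lactB Q10 Q20 subrr.
  apply: (zmod_subgroup_sum gT) => e _; apply: (zmod_subgroupMz gT).
  by apply/key.
have prodE x u (R : 'I_t -> 'M[int]_n) : (forall i, Y (x i)) ->
    (forall c, represents (X u c) (R c) /\ witness (X u c) (W u c)) ->
    (forall i j, [~ x i, tnth s j]%g =
        \prod_(c <- enum 'I_t) [~ xp c i, W u c j]%g)%g <->
    represents x (\sum_c p c *m R c).
  move=> Yx uR.
  have cxp c i j : central [~ xp c i, W u c j]%g.
    by have [Yxp _] := xpP c; have /second_centerP := Yxp i.
  have sumE i j : \sum_c in_center [~ xp c i, W u c j]%g =
      lact (\sum_c p c *m R c) F i j.
    rewrite lact_sum summxE; apply: eq_bigr => c _.
    have [uRc uwc] := uR c.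
    by rewrite -(witness_pairing uRc uwc (xpP c)) !mxE.
  split=> [e|[_ /matrixP e] i j].
    split=> //; apply/matrixP => i j; rewrite -sumE mxE /pairing e.
    by have [_ ->] := in_center_prod (cxp^~ i^~ j).
  have [cprod prodE] := in_center_prod (cxp^~ i^~ j).
  apply: in_center_inj => //; first by have /second_centerP := Yx i.
  by rewrite prodE sumE -e mxE.
apply: (@diophantine_ext _ M _ (fun x => (forall i, Y (x i)) /\ exists u, D x u)).
  move=> x; split=> [[Yx [u [[YX Xw] [Xc xE]]]]|[P IP xP]].
    have /choice[R RP] c := row_coordinates (YX c).
    exists (\sum_c p c *m R c).
      apply: zmod_subgroup_sum => // c _; apply: IM => //.
      by apply/(commR c (R c) u) => //; apply: Xw.
    by apply/(prodE x u R) => // c; split=> //; apply: Xw.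
  have Yx := xP.1; split=> //; have [k PE] := spanI P IP.
  (* The integer coefficients of [P] are themselves central scalars. *)
  have S0k c : central_scalars (1%:M *~ k c) by apply: zmod_subgroupMz.
  have /choice[r0 r0P] c := exists_represented (1%:M *~ k c).
  have /choice[w0 w0P] c := scalars_witness (r0P c) (S0k c).1.
  pose u (a : U) := match a with inl b => r0 b.1 b.2 | inr b => w0 b.1 b.2 end.
  have Xu c : X u c = r0 c by apply/funext.
  have Wu c : W u c = w0 c by apply/funext.
  exists u; split; first by split=> c; [case: (r0P c) | move=> i j; apply: w0P].
  split; first by move=> c; apply/(commR c (1%:M *~ k c)); rewrite ?Xu ?Wu.
  apply/(prodE x u (fun c => 1%:M *~ k c)) => //.
  suff <- : P = \sum_c p c *m (1%:M *~ k c) by [].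
  rewrite PE; apply: eq_bigr => c _; rewrite -!scaler_int.
  by rewrite -scalemxAr mulmx1.
have dY (V : Type) (f : (V -> M) -> M) : term_fun f -> diophantine (fun a => Y (f a)).
  by move=> tf; apply: (@diophantine_mem G V Y) => //; apply: second_center_definable.
have tv (V : Type) (v : V) : term_fun (fun a : V -> M => a v) by apply: term_fun_var.
have tc (V : Type) (g : G) : term_fun (fun a : V -> M => g : M) by apply: term_fun_const.
have tX c i : term_fun (fun a : 'I_n + U -> M => X (a \o inr) c i).
  exact: (tv _ (inr (inl (c, i)))).
have tW c i : term_fun (fun a : 'I_n + U -> M => W (a \o inr) c i).
  exact: (tv _ (inr (inr (c, i)))).
have tx i : term_fun (fun a : 'I_n + U -> M => (a \o inl) i).
  exact: (tv _ (inl i)).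
apply: diophantine_and; first by apply: diophantine_all => i; apply/dY/tv.
apply: (@diophantine_ex _ M _ U D).
apply: diophantine_and.
  apply: diophantine_and; apply: diophantine_all => c; apply: diophantine_all => i.
    by apply/dY/tX.
  by apply: diophantine_all => j; apply: diophantine_eq; apply: term_fun_comm.
apply: diophantine_and.
  apply: diophantine_all => c; apply: diophantine_all => e.
  apply: diophantine_all => i; apply: diophantine_all => j.
  by apply: diophantine_eq; apply: term_fun_comm.
apply: diophantine_all => i; apply: diophantine_all => j.
apply: diophantine_eq; first exact: term_fun_comm.
by apply: term_fun_prod => c; apply: term_fun_comm.
Qed.

Lemma number_ring_interpretation : finite_index Y ->
  ~ finite_index (centralizing [set (1%g : G)]) ->
  exists (L : fieldExtType rat) (X : ('I_n -> G) -> Prop)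
    (phi : ('I_n -> G) -> ring_of_integers L), interpretation X phi.
Proof.
move=> finY infZ.
have rS0 := central_scalars_subring; have gS0 := int_subring_group rS0.
have [S01 S0B S0M] := rS0.
have [L [lam [d [d_gt0 [lamB lamM] lamK lam_int condP]]]] :=
  number_field_character relations_group (relations_infinite_index finY infZ)
    rS0 relationsM central_scalars_comm.
pose I : set 'M[int]_n := [set P | central_scalars P /\
  exists z : ring_of_integers L, lam P = val z *+ d].
pose N : set 'M[int]_n := [set P | central_scalars P /\ lam P = 0].
have [S00 _] := gS0.
have lam0 : lam 0 = 0 by rewrite -(subrr (1%:M : 'M_n)) lamB // subrr.
(* The matrices of one tuple differ by relations, on which [lam] vanishes; so [phi] can be defined
   on tuples. *)
have lam_null P P' x : central_scalars P -> central_scalars P' ->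
    represents x P -> represents x P' -> lam P = lam P'.
  move=> SP SP' xP xP'; apply/eqP; rewrite -subr_eq0 -lamB //; apply/eqP.
  apply: lamK; first exact: S0B.
  exact: null_rows (represents_uniq xP xP').
have mulrd (u v : L) : u *+ d = v *+ d -> u = v.
  rewrite -!scaler_nat; apply: scalerI.
  by rewrite Num.Theory.pnatr_eq0 -lt0n.
pose AX x := exists2 P, I P & represents x P.
pose NX x := exists2 P, N P & represents x P.
have dAX : @diophantine _ M 'I_n AX.
  apply: ideal_definable => [|P []//|P Q [SP [z zP]] SQ].
    split; first by split=> //; exists 0; rewrite lam0 mul0rn.
    move=> P P' [SP [z zP]] [SP' [z' zP']]; split; first exact: S0B.
    by exists (z - z'); rewrite lamB // zP zP' rmorphB mulrnBl.
  split; first exact: S0M.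
  (* [I] absorbs products because [lam Q] is an algebraic integer. *)
  have Qint : lam Q \in @integral_pred L by apply/asboolP/lam_int.
  by exists (z * AlgInteger Qint); rewrite lamM // zP rmorphM /= mulrnAl.
have dNX : @diophantine _ M 'I_n NX.
  apply: ideal_definable => [|P []//|P Q [SP zP] SQ].
    split; first by [].
    move=> P P' [SP zP] [SP' zP']; split; first exact: S0B.
    by rewrite lamB // zP zP' subr0.
  by split; [apply: S0M | rewrite lamM // zP mul0r].
have NXP x P : central_scalars P -> represents x P -> NX x <-> lam P = 0.
  move=> SP xP; split=> [[P' [SP' P'0] xP']|P0]; last by exists P.
  by rewrite (lam_null P P' x).
have /choice[phi phiP] x : exists z : ring_of_integers L,
    forall P, I P -> represents x P -> lam P = val z *+ d.
  have [[P [SP [z zP]] xP]|nx] := pselect (AX x); last first.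
    by exists 0 => P IP xP; case: nx; exists P.
  by exists z => P' [SP' _] xP'; rewrite (lam_null P' P x).
have val_eq (z z' : ring_of_integers L) : z = z' <-> (val z - val z') *+ d = 0.
  split=> [->|/eqP]; first by rewrite subrr mul0rn.
  rewrite -(mul0rn _ d) => /eqP/mulrd/eqP; rewrite subr_eq0 => /eqP.
  exact: val_inj.
have tv (V : Type) (v : V) : term_fun (fun a : V -> M => a v) by apply: term_fun_var.
have tc (V : Type) (g : G) : term_fun (fun a : V -> M => g : M) by apply: term_fun_const.
have dsub (V : Type) (P : ('I_n -> G) -> Prop) (f : 'I_n -> V) :
    @diophantine _ M 'I_n P -> @diophantine _ M V (fun a => P (fun i => a (f i))).
  by move=> dP; apply: (diophantine_sub dP).
exists L, AX, phi; split=> //.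
- move=> z; have [P SP Pz] := condP (val z) (asboolW (valP z)).
  have IP : I P by split=> //; exists z.
  have [x xP] := exists_represented P; exists x; first by exists P.
  by apply/val_inj/mulrd; rewrite -(phiP x P IP xP).
- pose E (a : 'I_n + 'I_n -> G) i := ((a (inl i))^-1 * a (inr i))%g.
  apply: (@diophantine_ext _ M _ (fun a =>
    (AX (fun i => a (inl i)) /\ AX (fun i => a (inr i))) /\ NX (E a))).
    move=> a; have h : AX (fun i => a (inl i)) -> AX (fun i => a (inr i)) ->
        NX (E a) <-> phi (a \o inl) = phi (a \o inr).
      move=> [P IP xP] [P' IP' xP']; rewrite (NXP _ _ _ (representsB xP xP')).
        rewrite lamB ?(phiP _ _ IP xP) ?(phiP _ _ IP' xP'); [|by case: IP'|by case: IP].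
        rewrite -mulrnBl; split=> [/val_eq -> //|e]; exact/val_eq/esym.
      by apply: S0B; [case: IP' | case: IP].
    by split=> [[[Xa Xb] /h e]|[Xa Xb /h e]]; split=> //; [apply: e | apply: e].
  apply: diophantine_and; first by apply: diophantine_and; apply: dsub.
  apply: (diophantine_sub dNX) => i.
  by apply: (@term_fun_mul G) => //; apply: (@term_fun_inv G).
- pose E (a : 'I_n + ('I_n + 'I_n) -> G) i :=
    (a (inl i) * a (inr (inl i)) * (a (inr (inr i)))^-1)%g.
  apply: (@diophantine_ext _ M _ (fun a =>
    (AX (fun i => a (inl i)) /\ AX (fun i => a (inr (inl i)))) /\
    (AX (fun i => a (inr (inr i))) /\ NX (E a)))).
    move=> a; have h : AX (fun i => a (inl i)) -> AX (fun i => a (inr (inl i))) ->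
        AX (fun i => a (inr (inr i))) ->
        NX (E a) <-> phi (a \o inl) + phi (a \o inr \o inl) = phi (a \o inr \o inr).
      move=> [P IP xP] [P' IP' xP'] [Q IQ xQ].
      have [[SP _] [SP' _] [SQ _]] := And3 IP IP' IQ.
      have SPP' : central_scalars (P + P') by apply: zmod_subgroupD.
      have lamD : lam (P + P') = lam P + lam P'.
        by rewrite -[in RHS](addrK P' P) lamB // subrK.
      rewrite (NXP _ (P + P' - Q) _ (representsD (representsD xP xP') (representsN xQ))).
        rewrite lamB // lamD (phiP _ _ IP xP) (phiP _ _ IP' xP') (phiP _ _ IQ xQ).
        by rewrite val_eq rmorphD /= mulrnBl mulrnDl.
      exact: S0B.
    by split=> [[[Xa Xb] [Xc /h e]]|[Xa Xb Xc /h e]]; split=> //; try split=> //; apply: e.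
  apply: diophantine_and; first by apply: diophantine_and; apply: dsub.
  apply: diophantine_and; first exact: dsub.
  apply: (diophantine_sub dNX) => i.
  apply: (@term_fun_mul G); first exact: (@term_fun_mul G).
  exact: (@term_fun_inv G).
(* Writing the three values of [lam] as [d z], [d z'] and [d z''], the condition [z z' = z'']
   becomes [lam (P' *m P) = d * lam Q]: hence the power [d] of the third tuple. [mw] holds a tuple
   for [P' *m P] and a witness for [P]. *)
- pose B (a : 'I_n + ('I_n + 'I_n) -> G) (mw : 'I_n + 'I_r -> G) :=
    (forall i, Y (mw (inl i))) /\
    ((forall i j, [~ a (inl i), tnth s j]%g = [~ y i, mw (inr j)]%g) /\
    (forall i j, [~ mw (inl i), tnth s j]%g = [~ a (inr (inl i)), mw (inr j)]%g)) /\
    NX (fun i => mw (inl i) * ((a (inr (inr i))) ^+ d)^-1)%g.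
  apply: (@diophantine_ext _ M _ (fun a =>
    (AX (fun i => a (inl i)) /\ AX (fun i => a (inr (inl i)))) /\
    (AX (fun i => a (inr (inr i))) /\ exists mw, B a mw))).
    move=> a; have h : AX (fun i => a (inl i)) -> AX (fun i => a (inr (inl i))) ->
        AX (fun i => a (inr (inr i))) ->
        (exists mw, B a mw) <->
        phi (a \o inl) * phi (a \o inr \o inl) = phi (a \o inr \o inr).
      move=> [P IP xP] [P' IP' xP'] [Q IQ xQ].
      have [[SP _] [SP' _] [SQ _]] := And3 IP IP' IQ.
      have SQd : central_scalars (Q *+ d) by apply: zmod_subgroupMn.
      have SPP := S0M _ _ SP' SP.
      have lamMn k : central_scalars (Q *+ k) /\ lam (Q *+ k) = lam Q *+ k.
        split; first exact: zmod_subgroupMn.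
        elim: k => [|k IH]; first by rewrite !mulr0n.
        have SQk e : central_scalars (Q *+ e) by apply: zmod_subgroupMn.
        by rewrite !mulrSr -IH -[in RHS](addrK Q (Q *+ k)) lamB -?mulrSr // subrK.
      have mrep (mm : 'I_n -> G) w : (forall i, Y (mm i)) ->
          witness (fun i => a (inl i)) w ->
          (forall i j, [~ mm i, tnth s j]%g = [~ a (inr (inl i)), w j]%g) <->
          represents mm (P' *m P).
        move=> Ymm aw; rewrite (comm_pairing_mx _ _ Ymm xP'.1).
        by rewrite (witness_pairing xP aw xP'); split=> [|[]].
      have key mm : represents mm (P' *m P) ->
          NX (fun i => mm i * ((a (inr (inr i))) ^+ d)^-1)%g <->
          phi (a \o inl) * phi (a \o inr \o inl) = phi (a \o inr \o inr).
        move=> mP.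
        have rep := representsD mP (representsN (representsX d xQ)).
        rewrite (NXP _ _ _ rep); last exact: S0B.
        rewrite lamB // lamM // (lamMn d).2.
        rewrite (phiP _ _ IP xP) (phiP _ _ IP' xP') (phiP _ _ IQ xQ).
        rewrite mulrnAr mulrnAl -mulrnBl -mulrnBl mulrC val_eq rmorphM /=.
        by split=> [e|->]; [apply: mulrd; rewrite mul0rn | rewrite mul0rn].
      split=> [[mw [Ym [[aw bm] Nm]]]|e].
        by apply/(key (mw \o inl)) => //; apply/(mrep _ (mw \o inr)).
      have [w aw] := scalars_witness xP SP.1.
      have [mm mP] := exists_represented (P' *m P).
      exists (sumf mm w); split; first by case: mP.
      split; last exact/(key mm).
      by split=> //; apply/(mrep mm w) => //; case: mP.
    by split=> [[[Xa Xb] [Xc /h e]]|[Xa Xb Xc /h e]]; split=> //; try split=> //; apply: e.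
  apply: diophantine_and; first by apply: diophantine_and; apply: dsub.
  apply: diophantine_and; first exact: dsub.
  apply: (@diophantine_ex _ M _ _ B).
  have tl i : term_fun (fun b : 'I_n + ('I_n + 'I_n) + ('I_n + 'I_r) -> M =>
      (b \o inr) (inl i)) by exact: (tv _ (inr (inl i))).
  have tr j : term_fun (fun b : 'I_n + ('I_n + 'I_n) + ('I_n + 'I_r) -> M =>
      (b \o inr) (inr j)) by exact: (tv _ (inr (inr j))).
  have ta i : term_fun (fun b : 'I_n + ('I_n + 'I_n) + ('I_n + 'I_r) -> M =>
      (b \o inl) i) by exact: (tv _ (inl i)).
  apply: diophantine_and.
    apply: diophantine_all => i; apply: (@diophantine_mem G _ Y) => //.
    exact: second_center_definable.
  apply: diophantine_and.
    by apply: diophantine_and; apply: diophantine_all => i; apply: diophantine_all => j;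
      apply: diophantine_eq; apply: term_fun_comm.
  apply: (diophantine_sub dNX) => i.
  apply: (@term_fun_mul G) => //; apply: (@term_fun_inv G).
  exact: term_fun_exp.
Qed.

End Coordinates.

Theorem number_ring_interpretable (G : groupType) i : (0 < i)%N ->
  finitely_generated (group_structure G) ->
  e_definable_in (as_unary (gamma G i)) ->
  ~ virtually_abelian (quotient_group (gamma_normal G i)) ->
  exists (L : fieldExtType rat) (V : finType) (X : (V -> G) -> Prop)
    (phi : (V -> G) -> ring_of_integers L), interpretation X phi.
Proof.
move=> i_gt0 fgG dg nva.
have [N [dN [r [s gen]] infZ finY]] := central_quotient_exists i_gt0 fgG dg nva.
have [n [y [Yy spanY]]] := second_center_generators gen finY.
have [L [X [phi int]]] := number_ring_interpretation gen Yy spanY finY infZ.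
by exists L, 'I_n; do 2 eexists; apply: interpretation_quotient int.
Qed.

(** * A polynomial-time transducer *)

Section BlankEquivalence.
Variables A B : finType.
Variable M : machine A B.
Implicit Types (l : seq (cell M)) (t : tape M) (c : config M).

(** Head moves leave explicit blanks at the ends of the lists, so configurations are compared up to
    trailing blanks. *)
Definition blank_eq l l' := forall i, nth None l i = nth None l' i.

Definition tape_eq t t' := blank_eq t.1 t'.1 /\ blank_eq t.2 t'.2.

Definition config_eq c c' := c.1 = c'.1 /\ forall i, tape_eq (c.2 i) (c'.2 i).

Lemma blank_eq_head l l' : blank_eq l l' -> head None l = head None l'.
Proof. by move=> e; rewrite -!nth0. Qed.

Lemma blank_eq_behead l l' : blank_eq l l' -> blank_eq (behead l) (behead l').
Proof. by move=> e i; rewrite !nth_behead. Qed.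

Lemma blank_eq_cons x l l' : blank_eq l l' -> blank_eq (x :: l) (x :: l').
Proof. by move=> e []. Qed.

Lemma blank_eq_eta l : blank_eq (head None l :: behead l) l.
Proof. by case: l => // -[|i] //=; rewrite nth_nil. Qed.

Lemma act_eq t t' a : tape_eq t t' -> tape_eq (act t a) (act t' a).
Proof.
case: a => x [] [e1 e2]; split=> //=; rewrite -?(blank_eq_head e1).
- exact: blank_eq_behead.
- by do 2 apply: blank_eq_cons; apply: blank_eq_behead.
- by apply: blank_eq_cons; apply: blank_eq_behead.
- by apply: blank_eq_cons.
- exact: blank_eq_behead.
Qed.

Lemma next_eq c c' : config_eq c c' -> config_eq (Defs.next c) (Defs.next c').
Proof.
move=> [e1 e2]; rewrite /Defs.next.
have -> : transition c' = transition c.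
  rewrite /transition e1; congr (trans _ _); apply/ffunP => i; rewrite !ffunE.
  by rewrite /scanned (blank_eq_head (e2 i).2).
case: (transition c) => [[q a]|] //; split=> //= i; rewrite !ffunE.
exact: act_eq.
Qed.

Lemma config_eq_trans c1 c2 c3 :
  config_eq c1 c2 -> config_eq c2 c3 -> config_eq c1 c3.
Proof.
move=> [e1 e2] [f1 f2]; split; first by rewrite e1.
by move=> i; split=> j; rewrite ?(e2 i).1 ?(e2 i).2 ?(f2 i).1 ?(f2 i).2.
Qed.

Definition reach n c c' := exists2 k, k <= n & config_eq (iter k (@Defs.next _ _ M) c) c'.

Lemma reach_eq n c c' : config_eq c c' -> reach n c c'.
Proof. by exists 0. Qed.

Lemma iter_next_eq k c c' :
  config_eq c c' -> config_eq (iter k (@Defs.next _ _ M) c) (iter k (@Defs.next _ _ M) c').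
Proof. by move=> e; elim: k => //= k; apply: next_eq. Qed.

Lemma reach_trans n m c1 c2 c3 : reach n c1 c2 -> reach m c2 c3 -> reach (n + m) c1 c3.
Proof.
move=> [k kn e] [k' km e']; exists (k' + k); first by rewrite addnC leq_add.
by rewrite iterD; apply: config_eq_trans e'; apply: iter_next_eq.
Qed.

Lemma reach_le n m c c' : n <= m -> reach n c c' -> reach m c c'.
Proof. by move=> nm [k kn e]; exists k => //; apply: leq_trans nm. Qed.

Lemma reach_next c c' : config_eq (Defs.next c) c' -> reach 1 c c'.
Proof. by exists 1. Qed.

Lemma iter_next_halt c k : transition c = None -> iter k (@Defs.next _ _ M) c = c.
Proof. by move=> h; elim: k => //= k ->; rewrite /Defs.next h. Qed.

(** A halted machine no longer moves, so an upper bound on the running time is enough although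
    [computes_within] runs for exactly [n] steps. *)
Lemma reach_computes n w v c :
  reach n (initial M w) c -> transition c = None ->
  blank_eq (c.2 ord_max).2 [seq Some (inl (inr x)) | x <- v] ->
  computes_within M w n v.
Proof.
move=> [k kn [e1 e2]] halt out; rewrite /computes_within.
set c' := iter k _ _ in e1 e2.
have halt' : transition c' = None.
  rewrite -halt /transition e1; congr (trans _ _); apply/ffunP => i; rewrite !ffunE.
  by rewrite /scanned (blank_eq_head (e2 i).2).
rewrite -(subnK kn) iterD -/c' iter_next_halt //; split=> //; rewrite /output.
have : blank_eq (c'.2 ord_max).2 [seq Some (inl (inr x)) | x <- v].
  by move=> i; rewrite (e2 ord_max).2.
move: (c'.2 ord_max).2 => l; clear; elim: v l => [|x v IH] [|y l] e //=.
- by have := e 0; rewrite /= => ->.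
- by have := e 0.
have -> : y = Some (inl (inr x)) by have := e 0.
by congr (_ :: _); apply: IH => i; have := e i.+1.
Qed.

End BlankEquivalence.

(** * A machine expanding a template at each node of a syntax tree *)

Section Transducer.
Variables (S T : signature) (r q : nat).
Local Notation A := (token S r).
Local Notation B := (token T q).

Variant item := Lit of B | InsPath | InsWord.

Definition bit_tokens (w : bitseq) : seq B := [seq TokBit T q b | b <- w].

Definition expand (p x : bitseq) (e : item) : seq B :=
  match e with
  | Lit b => [:: b]
  | InsPath => bit_tokens p
  | InsWord => bit_tokens x
  end.

Definition expand_all p x (s : seq item) : seq B := flatten [seq expand p x e | e <- s].

Variable prog : A -> seq item.

(** Paths list their innermost direction first. The last child is always [true], even an only child,
    so that the traversal climbs past it when its subtree is finished. *)
Fixpoint out_term (u : term S 'I_r bitseq) (p : bitseq) : seq B :=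
  match u with
  | Var x => expand_all p x (prog (TokEnd S r))
  | Coef i => expand_all p [::] (prog (TokGen S i))
  | Op0 o => expand_all p [::] (prog (TokOp0 r o))
  | Op1 o u1 => expand_all p [::] (prog (TokOp1 r o)) ++ out_term u1 (true :: p)
  | Op2 o u1 u2 => expand_all p [::] (prog (TokOp2 r o)) ++
      out_term u1 (false :: p) ++ out_term u2 (true :: p)
  end.

(** After the second side, at [[:: true, false & p]], the next subtree in preorder is [true :: p],
    where the remaining equations are placed; no counter of equations is needed. *)
Fixpoint out_system (E : instance S r) (p : bitseq) : seq B :=
  if E is (u1, u2) :: E' then
    expand_all p [::] (prog (TokEq S r)) ++ out_term u1 [:: false, false & p] ++
    out_term u2 [:: true, false & p] ++ out_system E' (true :: p)
  else [::].

(** [PathL], [PathR] and [WordR], [WordL] copy and return. [Done], [Push] and [Skip] consume the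
    token and descend, [Adv0] and [Adv] climb to the next subtree. [Rewind] brings the last head
    back to the start of the output, since [output] reads rightwards from the head. *)
Variant phase :=
  Read | Emit | PathL | PathR | WordR | WordL | Done | Push | Skip | Adv0 | Adv
  | Rewind | Halt.

Definition phase_code (x : phase) : bool * bool * bool * bool :=
  match x with
  | Read => (true, true, true, true)
  | Emit => (true, true, true, false)
  | PathL => (true, true, false, true)
  | PathR => (true, true, false, false)
  | WordR => (true, false, true, true)
  | WordL => (true, false, true, false)
  | Done => (true, false, false, true)
  | Push => (true, false, false, false)
  | Skip => (false, true, true, true)
  | Adv0 => (false, true, true, false)
  | Adv => (false, true, false, true)
  | Rewind => (false, true, false, false)
  | Halt => (false, false, true, true)
  end.

Definition phase_decode (x : bool * bool * bool * bool) : phase :=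
  match x with
  | (true, true, true, true) => Read
  | (true, true, true, false) => Emit
  | (true, true, false, true) => PathL
  | (true, true, false, false) => PathR
  | (true, false, true, true) => WordR
  | (true, false, true, false) => WordL
  | (true, false, false, true) => Done
  | (true, false, false, false) => Push
  | (false, true, true, true) => Skip
  | (false, true, true, false) => Adv0
  | (false, true, false, true) => Adv
  | (false, true, false, false) => Rewind
  | _ => Halt
  end.

Lemma phase_codeK : cancel phase_code phase_decode.
Proof. by case. Qed.

HB.instance Definition _ := Finite.copy phase (can_type phase_codeK).

Definition max_prog : nat := \max_(a : A) size (prog a).

Local Notation state := (phase * A * 'I_max_prog.+1)%type.
Local Notation symbol := (option (A + B + bool)).

Definition input_bit (c : symbol) : option bool :=
  if c is Some (inl (inl (TokBit b))) then Some b else None.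

Definition out (b : B) : symbol := Some (inl (inr b)).

(* The tapes carry the input, the current path (with its innermost direction just
   left of the head) and the output. A path or a word is inserted into the output
   by scanning it once and moving back. *)
Definition step (st : state) (a0 a1 a2 : symbol) :
    option (state * (symbol * move) * (symbol * move) * (symbol * move)) :=
  let: (ph, a, i) := st in
  let k0 := (a0, Stay) in let k1 := (a1, Stay) in let k2 := (a2, Stay) in
  match ph with
  | Read =>
      match a0 with
      | Some (inl (inl a')) => Some ((Emit, a', ord0), k0, k1, k2)
      | _ => Some ((Rewind, a, i), k0, k1, (a2, Left))
      end
  | Emit =>
      match onth (prog a) i with
      | Some (Lit b) => Some ((Emit, a, inord i.+1), k0, k1, (out b, Right))
      | Some InsPath => Some ((PathL, a, i), k0, (a1, Left), k2)
      | Some InsWord => Some ((WordR, a, i), k0, k1, k2)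
      | None => Some ((Done, a, ord0), k0, k1, k2)
      end
  | PathL =>
      match a1 with
      | Some (inr b) => Some ((PathL, a, i), k0, (a1, Left), (out (TokBit T q b), Right))
      | _ => Some ((PathR, a, i), k0, (a1, Right), k2)
      end
  | PathR =>
      match a1 with
      | Some _ => Some ((PathR, a, i), k0, (a1, Right), k2)
      | None => Some ((Emit, a, inord i.+1), k0, k1, k2)
      end
  | WordR =>
      match input_bit a0 with
      | Some b => Some ((WordR, a, i), (a0, Right), k1, (out (TokBit T q b), Right))
      | None => Some ((WordL, a, i), (a0, Left), k1, k2)
      end
  | WordL =>
      match input_bit a0 with
      | Some b => Some ((WordL, a, i), (a0, Left), k1, k2)
      | None => Some ((Emit, a, inord i.+1), (a0, Right), k1, k2)
      end
  | Done =>
      match a with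
      | TokEq => Some ((Push, a, i), (a0, Right), (Some (inr false), Right), k2)
      | TokOp2 _ => Some ((Read, TokEnd S r, ord0), (a0, Right), (Some (inr false), Right), k2)
      | TokOp1 _ => Some ((Read, TokEnd S r, ord0), (a0, Right), (Some (inr true), Right), k2)
      | TokGen _ | TokOp0 _ => Some ((Adv0, a, i), (a0, Right), k1, k2)
      | TokBit _ | TokEnd => Some ((Skip, a, i), k0, k1, k2)
      end
  | Push => Some ((Read, TokEnd S r, ord0), k0, (Some (inr false), Right), k2)
  | Skip =>
      if input_bit a0 is Some _ then Some ((Skip, a, i), (a0, Right), k1, k2)
      else Some ((Adv0, a, i), (a0, Right), k1, k2)
  | Adv0 => Some ((Adv, a, i), k0, (a1, Left), k2)
  | Adv =>
      match a1 with
      | Some (inr true) => Some ((Adv, a, i), k0, (None, Left), k2)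
      | Some (inr false) => Some ((Read, TokEnd S r, ord0), k0, (Some (inr true), Right), k2)
      | _ => Some ((Read, TokEnd S r, ord0), k0, (a1, Right), k2)
      end
  | Rewind =>
      match a2 with
      | Some _ => Some ((Rewind, a, i), k0, k1, (a2, Left))
      | None => Some ((Halt, a, i), k0, k1, (a2, Right))
      end
  | Halt => None
  end.

Definition tape_index (j : nat) : 'I_3 := inord j.

Definition transducer : machine A B := @Machine A B bool state 2
  (Read, TokEnd S r, ord0)
  (fun st f => omap (fun a => let: (st', x0, x1, x2) := a in
     (st', [ffun j : 'I_3 => nth x2 [:: x0; x1; x2] j]))
    (step st (f (tape_index 0)) (f (tape_index 1)) (f (tape_index 2)))).

Local Notation TM := transducer.

Definition mk (st : state) (t0 t1 t2 : tape TM) : config TM :=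
  (st, [ffun j : 'I_3 => nth t2 [:: t0; t1; t2] j]).

Lemma transition_mk st t0 t1 t2 :
  transition (mk st t0 t1 t2) =
  omap (fun a => let: (st', x0, x1, x2) := a in
     (st', [ffun j : 'I_3 => nth x2 [:: x0; x1; x2] j]))
    (step st (scanned t0) (scanned t1) (scanned t2)).
Proof. by rewrite /transition /= !ffunE /= !inordK. Qed.

Lemma next_mk st (t0 t1 t2 : tape TM) st' x0 x1 x2 :
  step st (scanned t0) (scanned t1) (scanned t2) = Some (st', x0, x1, x2) ->
  Defs.next (mk st t0 t1 t2) = mk st' (act t0 x0) (act t1 x1) (act t2 x2).
Proof.
move=> e; rewrite /Defs.next transition_mk e /=; congr pair.
by apply/ffunP => j; rewrite !ffunE; case: j => [[|[|[|]]]].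
Qed.

Lemma mk_eq st t0 t1 t2 t0' t1' t2' :
  tape_eq t0 t0' -> tape_eq t1 t1' -> tape_eq t2 t2' ->
  config_eq (mk st t0 t1 t2) (mk st t0' t1' t2').
Proof.
by move=> e0 e1 e2; split=> //= j; rewrite !ffunE; case: j => [[|[|[|]]]].
Qed.

Lemma reach_step st (t0 t1 t2 : tape TM) st' x0 x1 x2 t0' t1' t2' :
  step st (scanned t0) (scanned t1) (scanned t2) = Some (st', x0, x1, x2) ->
  tape_eq (act t0 x0) t0' -> tape_eq (act t1 x1) t1' -> tape_eq (act t2 x2) t2' ->
  reach 1 (mk st t0 t1 t2) (mk st' t0' t1' t2').
Proof.
by move=> /next_mk e e0 e1 e2; apply: reach_next; rewrite e; apply: mk_eq.
Qed.

Lemma act_stay (t : tape TM) : tape_eq (act t (scanned t, Stay)) t.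
Proof. by split=> //=; apply: blank_eq_eta. Qed.

Definition bits (p : bitseq) : seq (cell TM) := [seq Some (inr b) | b <- p].
Definition outs (o : seq B) : seq (cell TM) := [seq out b | b <- o].
Definition toks (u : seq A) : seq (cell TM) := [seq Some (inl (inl a)) | a <- u].
Definition in_bits (x : bitseq) : seq (cell TM) := toks [seq TokBit S r b | b <- x].
Definition head_bit (l : seq (cell TM)) : option bool := input_bit (head None l).

Implicit Types (l rest : seq (cell TM)) (p x : bitseq) (o : seq B).
Implicit Types (t : tape TM) (a : A) (i : 'I_max_prog.+1).

Definition conf (st : state) (l rest : seq (cell TM)) p o : config TM :=
  mk st (l, rest) (bits p, [::]) (rev (outs o), [::]).

Lemma blank_eq_None : blank_eq ([:: None] : seq (cell TM)) [::].
Proof. by case=> //= j; rewrite !nth_nil. Qed.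

Lemma act_left l rest :
  tape_eq (act ((l, rest) : tape TM) (head None rest, Left)) (behead l, head None l :: rest).
Proof. by split=> //=; apply/blank_eq_cons/blank_eq_eta. Qed.

Lemma act_out o b :
  tape_eq (act ((rev (outs o), [::]) : tape TM) (out b, Right)) (rev (outs (rcons o b)), [::]).
Proof. by rewrite /outs map_rcons rev_rcons. Qed.

Lemma path_left a i t0 p rr o :
  reach (size p).+1
    (mk (PathL, a, i) t0 (behead (bits p), head None (bits p) :: rr) (rev (outs o), [::]))
    (mk (PathR, a, i) t0 ([::], catrev (bits p) rr)
      (rev (outs (o ++ bit_tokens p)), [::])).
Proof.
elim: p rr o => [|b p IH] rr o /=.
  apply: reach_step; rewrite /=; first by reflexivity.
  - exact: act_stay.
  - by split=> //=; apply: blank_eq_None.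
  - by rewrite cats0; apply: act_stay.
rewrite -(cat1s (TokBit T q b)) catA cats1 -addn1 addnC.
apply: reach_trans (IH _ (rcons o (TokBit T q b))).
apply: reach_step; rewrite /=; first by reflexivity.
- exact: act_stay.
- by [].
- exact: act_out.
Qed.

Lemma path_right a i t0 t2 p (l1 : seq (cell TM)) :
  reach (size p).+1 (mk (PathR, a, i) t0 (l1, bits p) t2)
    (mk (Emit, a, inord i.+1) t0 (catrev (bits p) l1, [::]) t2).
Proof.
elim: p l1 => [|b p IH] l1 /=.
  by apply: reach_step; rewrite /=; [reflexivity|exact: act_stay..].
rewrite -addn1 addnC; apply: reach_trans (IH _).
apply: reach_step; rewrite /=; [by reflexivity|exact: act_stay| by [] |exact: act_stay].
Qed.

Lemma catrev_bits p : catrev (bits p) [::] = bits (rev p).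
Proof. by rewrite /bits map_rev. Qed.

Lemma emit_path a i l rest p o : onth (prog a) i = Some InsPath ->
  reach (2 * size p + 3) (conf (Emit, a, i) l rest p o)
    (conf (Emit, a, inord i.+1) l rest p (o ++ bit_tokens p)).
Proof.
move=> ai; have -> : 2 * size p + 3 = 1 + (size p).+1 + (size p).+1 by lia.
apply: (@reach_trans _ _ _ _ _ _ (mk (PathR, a, i) (l, rest) ([::], bits (rev p))
      (rev (outs (o ++ bit_tokens p)), [::]))); last first.
  have := path_right a i (l, rest) (rev (outs (o ++ bit_tokens p)), [::]) (rev p) [::].
  by rewrite size_rev catrev_bits revK.
apply: reach_trans; last first.
  by have := path_left a i (l, rest) p [::] o; rewrite catrev_bits; apply.
apply: reach_step; rewrite /= ?ai; [by reflexivity|exact: act_stay| |exact: act_stay].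
by split=> //; apply: blank_eq_cons; apply: blank_eq_None.
Qed.

Lemma word_right a i t1 x l rest o : head_bit rest = None ->
  reach (size x).+1
    (mk (WordR, a, i) (l, in_bits x ++ rest) t1 (rev (outs o), [::]))
    (mk (WordL, a, i) (behead (catrev (in_bits x) l), head None (catrev (in_bits x) l) :: rest)
      t1 (rev (outs (o ++ bit_tokens x)), [::])).
Proof.
move=> hrest; elim: x l o => [|b x IH] l o /=.
  apply: reach_step; rewrite /= -?[scanned _]/(head None rest).
  - by rewrite [input_bit _]hrest; reflexivity.
  - exact: act_left.
  - exact: act_stay.
  - by rewrite cats0; apply: act_stay.
rewrite -(cat1s (TokBit T q b)) catA cats1 -addn1 addnC.
apply: reach_trans (IH _ (rcons o (TokBit T q b))).
apply: reach_step; rewrite /=; first by reflexivity.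
- by [].
- exact: act_stay.
- exact: act_out.
Qed.

Lemma word_left a i t1 t2 x l rest : head_bit l = None ->
  reach (size x).+1
    (mk (WordL, a, i) (behead (in_bits x ++ l), head None (in_bits x ++ l) :: rest) t1 t2)
    (mk (Emit, a, inord i.+1) (l, catrev (in_bits x) rest) t1 t2).
Proof.
move=> hl; elim: x rest => [|b x IH] rest /=.
  apply: reach_step; rewrite /= -?[scanned _]/(head None l).
  - by rewrite [input_bit _]hl; reflexivity.
  - by split=> //=; apply: blank_eq_eta.
  - exact: act_stay.
  - exact: act_stay.
rewrite -addn1 addnC; apply: reach_trans (IH _).
by apply: reach_step; rewrite /=; [reflexivity|by []|exact: act_stay..].
Qed.

Lemma catrev_in_bits x l : catrev (in_bits x) l = in_bits (rev x) ++ l.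
Proof. by rewrite catrevE /in_bits /toks -!map_rev. Qed.

Lemma emit_word a i l rest p o x : onth (prog a) i = Some InsWord ->
  head_bit l = None -> head_bit rest = None ->
  reach (2 * size x + 3) (conf (Emit, a, i) l (in_bits x ++ rest) p o)
    (conf (Emit, a, inord i.+1) l (in_bits x ++ rest) p (o ++ bit_tokens x)).
Proof.
move=> ai hl hrest; have -> : 2 * size x + 3 = 1 + (size x).+1 + (size x).+1 by lia.
apply: reach_trans; last first.
  have := word_left a i (bits p, [::]) (rev (outs (o ++ bit_tokens x)), [::]) (rev x) rest hl.
  by rewrite size_rev catrev_in_bits revK; apply.
apply: reach_trans; last first.
  have := word_right a i (bits p, [::]) x l o hrest.
  by rewrite catrev_in_bits; apply.
by apply: reach_step; rewrite /= ?ai; [reflexivity|exact: act_stay..].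
Qed.

Lemma emit_lit a i l rest p o b : onth (prog a) i = Some (Lit b) ->
  reach 1 (conf (Emit, a, i) l rest p o)
    (conf (Emit, a, inord i.+1) l rest p (rcons o b)).
Proof.
move=> ai; apply: reach_step; rewrite /= ?ai.
  by reflexivity.
- exact: act_stay.
- exact: act_stay.
- exact: act_out.
Qed.

(** Each item costs at most [2 * N + 3] steps: a path or a word of length at most [N] is traversed
    in both directions. *)
Lemma emit_all a i l rest p o x N :
  head_bit l = None -> head_bit rest = None -> size p <= N -> size x <= N ->
  i <= size (prog a) ->
  reach ((size (prog a) - i) * (2 * N + 3) + 1)
    (conf (Emit, a, i) l (in_bits x ++ rest) p o)
    (conf (Done, a, ord0) l (in_bits x ++ rest) p
      (o ++ expand_all p x (drop i (prog a)))).
Proof.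
move=> hl hrest pN xN ia; move e : (size (prog a) - i) => k.
elim: k i o ia e => [|k IH] i o ia e.
  have ea : size (prog a) <= i by lia.
  rewrite drop_oversize // cats0.
  by apply: reach_step; rewrite /= ?onth_default //; exact: act_stay.
have lt : i < size (prog a) by lia.
have le_max : size (prog a) <= max_prog by apply: leq_bigmax.
have iS : (inord i.+1 : 'I_max_prog.+1) = i.+1 :> nat by rewrite inordK //; lia.
case E : (onth (prog a) i) => [e0|]; last by have := onthTE (prog a) i; rewrite E lt.
have dE : drop i (prog a) = e0 :: drop i.+1 (prog a).
  by rewrite (drop_nth e0 lt) -odflt_onth E.
have := IH (inord i.+1) (o ++ expand p x e0); rewrite iS => /(_ lt).
rewrite dE /expand_all /= catA => IH'.
have -> : k.+1 * (2 * N + 3) + 1 = (2 * N + 3) + (k * (2 * N + 3) + 1) by lia.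
apply: reach_trans (IH' _); last by lia.
case: e0 E {dE IH'} => [b||] E /=.
- by rewrite cats1; apply: reach_le _ (emit_lit _ _ _ _ E); lia.
- by apply: reach_le _ (emit_path _ _ _ _ E); lia.
- by apply: reach_le _ (emit_word _ _ _ E hl hrest); lia.
Qed.

Definition rd : state := (Read, TokEnd S r, ord0).

Lemma emit_token a l rest p o x N :
  head_bit l = None -> head_bit rest = None -> size p <= N -> size x <= N ->
  head None (in_bits x ++ rest) = Some (inl (inl a)) ->
  reach (max_prog * (2 * N + 3) + 2)
    (conf rd l (in_bits x ++ rest) p o)
    (conf (Done, a, ord0) l (in_bits x ++ rest) p (o ++ expand_all p x (prog a))).
Proof.
move=> hl hrest pN xN ha.
have le_max : size (prog a) <= max_prog by apply: leq_bigmax.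
have := @emit_all a ord0 l rest p o x N hl hrest pN xN (leq0n _).
rewrite drop0 subn0 => he.
apply: (@reach_le _ _ _ (1 + (size (prog a) * (2 * N + 3) + 1))).
  by have := leq_mul le_max (leqnn (2 * N + 3)); lia.
have hs : scanned ((l, in_bits x ++ rest) : tape TM) = Some (inl (inl a)) by [].
apply: reach_trans he; apply: reach_step.
- by rewrite /step /= hs; reflexivity.
- by rewrite -hs; apply: act_stay.
- exact: act_stay.
- exact: act_stay.
Qed.

(* Where the preorder traversal goes on after the subtree at path [p], innermost
   direction first. *)
Fixpoint adv p : bitseq :=
  match p with
  | true :: p' => adv p'
  | false :: p' => true :: p'
  | [::] => [::]
  end.

Lemma adv_loop a i t0 t2 p (rr : seq (cell TM)) : blank_eq rr [::] ->
  reach (size p).+1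
    (mk (Adv, a, i) t0 (behead (bits p), head None (bits p) :: rr) t2)
    (mk rd t0 (bits (adv p), [::]) t2).
Proof.
elim: p rr => [|[] p IH] rr hrr.
- apply: reach_step; rewrite /=; [by reflexivity|exact: act_stay| |exact: act_stay].
  by split=> //; apply: blank_eq_None.
- rewrite -addn1 addnC; apply: (reach_trans _ (IH (None :: rr) _)); last first.
    by case=> //= k; rewrite hrr nth_nil.
  by apply: reach_step; rewrite /=; [reflexivity|exact: act_stay|by []|exact: act_stay].
- apply: (@reach_le _ _ _ 1) => //.
  by apply: reach_step; rewrite /=; [reflexivity|exact: act_stay|by split|exact: act_stay].
Qed.

Lemma adv_path a i l rest p o :
  reach (size p + 2) (conf (Adv0, a, i) l rest p o) (conf rd l rest (adv p) o).
Proof.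
have -> : size p + 2 = 1 + (size p).+1 by lia.
apply: reach_trans (@adv_loop a i _ _ p [::] _); last by [].
apply: reach_step; rewrite /=; [by reflexivity|exact: act_stay| |exact: act_stay].
by split=> //; apply: blank_eq_cons; apply: blank_eq_None.
Qed.

Lemma skip_word a i l rest p o x :
  reach (size x).+1
    (conf (Skip, a, i) l (in_bits x ++ Some (inl (inl (TokEnd S r))) :: rest) p o)
    (conf (Adv0, a, i) (Some (inl (inl (TokEnd S r))) :: catrev (in_bits x) l) rest p o).
Proof.
elim: x l => [|b x IH] l.
  by apply: reach_step; rewrite /=; [reflexivity|by []|exact: act_stay..].
rewrite -addn1 addnC; apply: reach_trans (IH _).
by apply: reach_step; rewrite /=; [reflexivity|by []|exact: act_stay..].
Qed.

(** Room for running the program of a token, plus [2 * N + 4] steps for skipping a name and climbing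
    along the path. *)
Definition token_cost N : nat := (max_prog + 2) * (2 * N + 4).

Lemma token_costE N : max_prog * (2 * N + 3) + 2 + (2 * N + 4) <= token_cost N.
Proof. by rewrite /token_cost; have := leq0n N; have := leq0n max_prog; nia. Qed.

(** A variable is met at the first token of its name, a bit or, for the empty name, [TokEnd]; both
    must trigger the same program. *)
Hypothesis prog_bit : forall b, prog (TokBit S r b) = prog (TokEnd S r).

(** The machine finds the start of a name by going left to the first cell that is not a bit, so what
    precedes a name must not end in a bit. *)
Lemma encode_term_last (u : term S 'I_r bitseq) l :
  head_bit (catrev (toks (encode_term u)) l) = None.
Proof.
elim: u l => [x|j|c|c u IH|c u1 IH1 u2 IH2] l //=.
- by rewrite catrevE /toks map_rcons rev_rcons.
- by rewrite /toks map_cat catrevE rev_cat -catA -catrevE.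
Qed.

(** [N] bounds all paths and names that occur. The factor 2 allows each token to lengthen the path
    by two directions, as [TokEq] does. *)
Lemma run_term u p l rest o N : head_bit l = None ->
  size p + 2 * size (encode_term u) <= N ->
  reach (size (encode_term u) * token_cost N)
    (conf rd l (toks (encode_term u) ++ rest) p o)
    (conf rd (catrev (toks (encode_term u)) l) rest (adv p) (o ++ out_term u p)).
Proof.
have cost := token_costE N.
elim: u p l rest o => [x|j|c|c u IH|c u1 IH1 u2 IH2] p l rest o hl /= sN.
- rewrite size_rcons size_map in sN *.
  have -> : toks (rcons [seq TokBit S r b | b <- x] (TokEnd S r)) ++ rest =
      in_bits x ++ Some (inl (inl (TokEnd S r))) :: rest.
    by rewrite /toks map_rcons cat_rcons.
  have -> : catrev (toks (rcons [seq TokBit S r b | b <- x] (TokEnd S r))) l =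
      Some (inl (inl (TokEnd S r))) :: catrev (in_bits x) l.
    by rewrite !catrevE /toks map_rcons rev_rcons.
  have [a [ha pa]] : exists a,
      head None (in_bits x ++ Some (inl (inl (TokEnd S r))) :: rest) = Some (inl (inl a))
      /\ prog a = prog (TokEnd S r) /\ ((exists b, a = TokBit S r b) \/ a = TokEnd S r).
    by case: (x) => [|b x'] /=; eexists; split=> //; split=> //; [right|left; exists b].
  have he := @emit_token a l _ p o x N hl _ _ _ ha.
  apply: (@reach_le _ _ _ (max_prog * (2 * N + 3) + 2 + (1 + ((size x).+1 + (size p + 2))))).
    rewrite mulSn; have := leq0n (size x * token_cost N); lia.
  rewrite -pa.1; apply: reach_trans (he _ _ _) _; [by []|lia|lia|].
  apply: reach_trans (reach_trans (skip_word a ord0 _ _ _ _ _) (adv_path _ _ _ _ _ _)).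
  case: pa.2 => [[b ->]| ->];
    by apply: reach_step; rewrite /=; [reflexivity|exact: act_stay..].
- have he := @emit_token (TokGen S j) l (Some (inl (inl (TokGen S j))) :: rest) p o [::] N hl.
  apply: (@reach_le _ _ _ (max_prog * (2 * N + 3) + 2 + (1 + (size p + 2)))); first lia.
  apply: reach_trans (he _ _ _ _) _ => //; first lia.
  apply: reach_trans (adv_path _ _ _ _ _ _).
  by apply: reach_step; rewrite /=; [reflexivity|by []|exact: act_stay..].
- have he := @emit_token (TokOp0 r c) l (Some (inl (inl (TokOp0 r c))) :: rest) p o [::] N hl.
  apply: (@reach_le _ _ _ (max_prog * (2 * N + 3) + 2 + (1 + (size p + 2)))); first lia.
  apply: reach_trans (he _ _ _ _) _ => //; first lia.
  apply: reach_trans (adv_path _ _ _ _ _ _).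
  by apply: reach_step; rewrite /=; [reflexivity|by []|exact: act_stay..].
- have he := @emit_token (TokOp1 r c) l
    (Some (inl (inl (TokOp1 r c))) :: toks (encode_term u) ++ rest) p o [::] N hl.
  have := IH (true :: p) (Some (inl (inl (TokOp1 r c))) :: l) rest
    (o ++ expand_all p [::] (prog (TokOp1 r c))) erefl _.
  rewrite -catA => /(_ _) ih; rewrite mulSn; apply: reach_trans (ih _); last by rewrite /=; lia.
  apply: (@reach_le _ _ _ (max_prog * (2 * N + 3) + 2 + 1)); first lia.
  apply: reach_trans (he _ _ _ _) _ => //; first lia.
  by apply: reach_step; rewrite /=; [reflexivity|by []|by []|exact: act_stay].
- rewrite size_cat in sN *.
  have he := @emit_token (TokOp2 r c) l
    (Some (inl (inl (TokOp2 r c))) :: toks (encode_term u1 ++ encode_term u2) ++ rest)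
    p o [::] N hl.
  rewrite mulSn mulnDl.
  apply: (@reach_trans _ _ _ _ _ _ (conf rd (Some (inl (inl (TokOp2 r c))) :: l)
    (toks (encode_term u1 ++ encode_term u2) ++ rest) (false :: p)
    (o ++ expand_all p [::] (prog (TokOp2 r c))))).
    apply: (@reach_le _ _ _ (max_prog * (2 * N + 3) + 2 + 1)); first lia.
    apply: reach_trans (he _ _ _ _) _ => //; first lia.
    by apply: reach_step; rewrite /=; [reflexivity|by []|by []|exact: act_stay].
  rewrite /toks map_cat -catA -/toks.
  apply: reach_trans (IH1 (false :: p) _ _ _ _ _) _ => //; first by rewrite /=; lia.
  have -> : catrev (toks (encode_term u1) ++ toks (encode_term u2))
      (Some (inl (inl (TokOp2 r c))) :: l) =
      catrev (toks (encode_term u2)) (catrev (toks (encode_term u1))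
        (Some (inl (inl (TokOp2 r c))) :: l)).
    by rewrite !catrevE rev_cat catA.
  rewrite !catA.
  apply: IH2 => /=; last by lia.
  exact: encode_term_last.
Qed.

Lemma run_system (E : instance S r) p l o N : head_bit l = None ->
  size p + 2 * size (encode E) <= N ->
  exists p', reach (size (encode E) * token_cost N)
    (conf rd l (toks (encode E)) p o)
    (conf rd (catrev (toks (encode E)) l) [::] p' (o ++ out_system E p)).
Proof.
have cost := token_costE N.
elim: E p l o => [|[u1 u2] E IH] p l o hl sN.
  by exists p; rewrite cats0; apply: reach_eq.
have encE : encode ((u1, u2) :: E) = TokEq S r :: (encode_term u1 ++ encode_term u2 ++ encode E).
  by rewrite /encode /= -catA.
rewrite encE /= !size_cat in sN *.
pose eq_cell : cell TM := Some (inl (inl (TokEq S r))).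
pose l1 := catrev (toks (encode_term u1)) (eq_cell :: l).
pose l2 := catrev (toks (encode_term u2)) l1.
have [||p' hp'] := IH (true :: p) l2 (((o ++ expand_all p [::] (prog (TokEq S r))) ++
  out_term u1 [:: false, false & p]) ++ out_term u2 [:: true, false & p]).
- exact: encode_term_last.
- by rewrite /=; lia.
exists p'; rewrite !mulSn !mulnDl.
have -> : catrev (toks (encode_term u1 ++ encode_term u2 ++ encode E)) (eq_cell :: l) =
    catrev (toks (encode E)) l2.
  by rewrite /l2 /l1 !catrevE /toks !map_cat !rev_cat !catA.
have -> : o ++ expand_all p [::] (prog (TokEq S r)) ++ out_term u1 [:: false, false & p] ++
    out_term u2 [:: true, false & p] ++ out_system E (true :: p) =
    (((o ++ expand_all p [::] (prog (TokEq S r))) ++ out_term u1 [:: false, false & p]) ++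
      out_term u2 [:: true, false & p]) ++ out_system E (true :: p) by rewrite !catA.
rewrite !addnA; apply: reach_trans hp'.
apply: (reach_trans (c2 := conf rd l1 (toks (encode_term u2 ++ encode E))
  [:: true, false & p] ((o ++ expand_all p [::] (prog (TokEq S r))) ++
  out_term u1 [:: false, false & p]))); last first.
  have -> : toks (encode_term u2 ++ encode E) = toks (encode_term u2) ++ toks (encode E).
    exact: map_cat.
  apply: run_term; last by rewrite /=; lia.
  exact: encode_term_last.
apply: (reach_trans (c2 := conf rd (eq_cell :: l)
  (toks (encode_term u1 ++ encode_term u2 ++ encode E))
  [:: false, false & p] (o ++ expand_all p [::] (prog (TokEq S r))))); last first.
  have -> : toks (encode_term u1 ++ encode_term u2 ++ encode E) =
      toks (encode_term u1) ++ toks (encode_term u2 ++ encode E) by apply: map_cat.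
  by apply: run_term => //=; lia.
have he := @emit_token (TokEq S r) l
  (eq_cell :: toks (encode_term u1 ++ encode_term u2 ++ encode E)) p o [::] N hl.
apply: (@reach_le _ _ _ (max_prog * (2 * N + 3) + 2 + (1 + 1))); first lia.
apply: reach_trans (he _ _ _ _) _ => //; first lia.
apply: (reach_trans (c2 := conf (Push, TokEq S r, ord0) (eq_cell :: l)
  (toks (encode_term u1 ++ encode_term u2 ++ encode E)) (false :: p)
  (o ++ expand_all p [::] (prog (TokEq S r))))).
  by apply: reach_step; rewrite /=; [reflexivity|by []|by []|exact: act_stay].
by apply: reach_step; rewrite /=; [reflexivity|exact: act_stay|by []|exact: act_stay].
Qed.

(** The length of the output is needed to bound the time of the final rewind. *)
Lemma size_expand_all p x (a : A) N : size p <= N -> size x <= N ->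
  size (expand_all p x (prog a)) <= max_prog * N.+1.
Proof.
move=> pN xN; apply: (@leq_trans (size (prog a) * N.+1)).
  elim: (prog a) => //= e es IH; rewrite size_cat mulSn leq_add //.
  by case: e => [b||] /=; rewrite ?size_map //; lia.
by rewrite leq_mul2r leq_bigmax ?orbT.
Qed.

Lemma size_out_term u p N : size p + 2 * size (encode_term u) <= N ->
  size (out_term u p) <= size (encode_term u) * (max_prog * N.+1).
Proof.
elim: u p => [x|j|c|c u IH|c u1 IH1 u2 IH2] p /= sN.
- rewrite size_rcons size_map in sN *; rewrite mulSn.
  by apply: leq_trans (leq_addr _ _); apply: size_expand_all => //; lia.
- by rewrite mul1n; apply: size_expand_all => //; lia.
- by rewrite mul1n; apply: size_expand_all => //; lia.
- rewrite size_cat mulSn leq_add //; first by apply: size_expand_all => //; lia.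
  by apply: IH => /=; lia.
- rewrite !size_cat in sN *; rewrite mulSn mulnDl leq_add //.
    by apply: size_expand_all => //; lia.
  by rewrite leq_add ?IH1 ?IH2 //=; lia.
Qed.

Lemma size_out_system E p N : size p + 2 * size (encode E) <= N ->
  size (out_system E p) <= size (encode E) * (max_prog * N.+1).
Proof.
elim: E p => [|[u1 u2] E IH] p // sN.
have encE : encode ((u1, u2) :: E) = TokEq S r :: (encode_term u1 ++ encode_term u2 ++ encode E).
  by rewrite /encode /= -catA.
rewrite encE /= !size_cat in sN *; rewrite mulSn !mulnDl.
rewrite leq_add //; first by apply: size_expand_all => //; lia.
rewrite leq_add //; first by apply: size_out_term => /=; lia.
rewrite leq_add //; first by apply: size_out_term => /=; lia.
by apply: IH => /=; lia.
Qed.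

Lemma rewind a i t0 t1 o (rr : seq (cell TM)) :
  exists st0, st0.1.1 = Halt /\ reach (size o).+1
    (mk (Rewind, a, i) t0 t1 (behead (outs o), head None (outs o) :: rr))
    (mk st0 t0 t1 ([::], catrev (outs o) rr)).
Proof.
exists (Halt, a, i); split=> //; elim: o rr => [|b o IH] rr.
  apply: reach_step; rewrite /=; [by reflexivity|exact: act_stay|exact: act_stay|].
  by split=> //; apply: blank_eq_None.
rewrite -addn1 addnC; apply: reach_trans (IH _).
by apply: reach_step; rewrite /=; [reflexivity|exact: act_stay|exact: act_stay|by []].
Qed.

Lemma transducer_computes (E : instance S r) n m : n = size (encode E) ->
  n * token_cost (2 * n) + n * (max_prog * (2 * n).+1) + 2 <= m ->
  computes_within TM (encode E) m (out_system E [::]).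
Proof.
move=> nE nm; have sN : size ([::] : bitseq) + 2 * size (encode E) <= 2 * n by rewrite nE.
have [p' hp'] := @run_system E [::] [::] [::] (2 * n) erefl sN.
have so := size_out_system sN; set o := out_system E [::] in hp' so *.
have [st0 [st0_halt hr]] := rewind (TokEnd S r) ord0
  ((catrev (toks (encode E)) [::], [::]) : tape TM) (bits p', [::]) (rev o) [::].
have outsr : rev (outs o) = outs (rev o) by rewrite /outs map_rev.
apply: (@reach_computes _ _ _ _ _ _ (mk st0 (catrev (toks (encode E)) [::], [::]) (bits p', [::])
  ([::], outs o))).
- apply: (@reach_le _ _ _ (size (encode E) * token_cost (2 * n) + (1 + (size (rev o)).+1))).
    by apply: leq_trans nm; rewrite size_rev nE in so *; lia.
  apply: (@reach_trans _ _ _ _ _ _ (conf rd (catrev (toks (encode E)) [::]) [::] p' o)).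
    have -> : initial TM (encode E) = conf rd [::] (toks (encode E)) [::] [::].
      congr pair; apply/ffunP => j; rewrite !ffunE.
      by case: j => [[|[|[|]]]].
    exact: hp'.
  have -> : outs o = catrev (outs (rev o)) [::] by rewrite /outs map_rev -/(rev _) revK.
  apply: reach_trans hr; apply: reach_step; rewrite /=; first by reflexivity.
  + exact: act_stay.
  + exact: act_stay.
  + rewrite outsr; split=> //; apply: blank_eq_cons; exact: blank_eq_None.
- by rewrite transition_mk; case: (st0) st0_halt => [[ph a0] i0] /= ->.
- by rewrite /= ffunE.
Qed.

End Transducer.

Lemma out_system_polynomial_time (S T : signature) (r q : nat)
    (prog : token S r -> seq (item T q)) (f : instance S r -> instance T q) :
  (forall b, prog (TokBit S r b) = prog (TokEnd S r)) ->
  (forall E, encode (f E) = out_system prog E [::]) ->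
  polynomial_time (@encode S r) (@encode T q) f.
Proof.
move=> prog_bit fE.
(* On inputs of length [n] the traversal costs [(4 * c + 8) * n * (n + 1)], the rewind at most
   [2 * c * (n + 1) ^ 2], and a constant 2 remains. *)
pose c := max_prog prog; pose K : nat := 6 * c + 10.
exists (transducer prog), (K%:P * ('X + 1%:P) * ('X + 1%:P))%R => E.
rewrite !hornerE fE; set n := size (encode E).
rewrite -[X in computes_within _ _ X]/(K * (n + 1) * (n + 1)).
apply: (@transducer_computes _ _ _ _ prog prog_bit E n) => //.
by rewrite /token_cost -/c /K; nia.
Qed.

(** * Diophantine reductions from interpretations *)

Lemma expand_all_cat (T : signature) q p x (s1 s2 : seq (item T q)) :
  expand_all p x (s1 ++ s2) = expand_all p x s1 ++ expand_all p x s2.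
Proof. by rewrite /expand_all map_cat flatten_cat. Qed.

Lemma encode_cat (T : signature) q (E1 E2 : instance T q) :
  encode (E1 ++ E2) = encode E1 ++ encode E2.
Proof. by rewrite /encode map_cat flatten_cat. Qed.

Section Templates.
Variables (T : signature) (q : nat).

(* A slot [(d, j)] stands for the [j]-th variable of the node reached from the
   current node by the directions [d], or of the current input variable if [d]
   is [None]. *)
Definition slot : Type := (option bitseq * nat)%type.

(* The unary prefix makes the naming injective. *)
Definition name (p x : bitseq) (v : slot) : bitseq :=
  nseq v.2 true ++ false ::
    (if v.1 is Some d then false :: d ++ p else true :: x).

Definition instantiate (E : system T 'I_q slot) (p x : bitseq) : instance T q :=
  ssub (@Coef _ _ _) (fun v => Var T 'I_q (name p x v)) E.

Definition lit_bits (w : bitseq) : seq (item T q) := [seq Lit (TokBit T q b) | b <- w].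

(** The same recursion as [encode_term], leaving to the machine the parts of a name that depend on
    the current node or input variable. *)
Fixpoint items_term (u : term T 'I_q slot) : seq (item T q) :=
  match u with
  | Var v => lit_bits (nseq v.2 true) ++ Lit (TokBit T q false) ::
      (if v.1 is Some d then Lit (TokBit T q false) :: lit_bits d ++ [:: InsPath T q]
       else [:: Lit (TokBit T q true); InsWord T q]) ++ [:: Lit (TokEnd T q)]
  | Coef i => [:: Lit (TokGen T i)]
  | Op0 o => [:: Lit (TokOp0 q o)]
  | Op1 o u1 => Lit (TokOp1 q o) :: items_term u1
  | Op2 o u1 u2 => Lit (TokOp2 q o) :: items_term u1 ++ items_term u2
  end.

Definition items (E : system T 'I_q slot) : seq (item T q) :=
  flatten [seq Lit (TokEq T q) :: items_term e.1 ++ items_term e.2 | e <- E].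

Lemma expand_lit_bits p x w : expand_all p x (lit_bits w) = bit_tokens T q w.
Proof.
elim: w => //= b w IH.
by rewrite -[LHS]/(TokBit T q b :: expand_all p x (lit_bits w)) IH.
Qed.

Lemma expand_items_term p x u :
  expand_all p x (items_term u) =
  encode_term (tsub (@Coef _ _ _) (fun v => Var T 'I_q (name p x v)) u).
Proof.
elim: u => [[d j]|i|o|o u IH|o u1 IH1 u2 IH2] //=.
- rewrite expand_all_cat expand_lit_bits -cats1 /name [in RHS]map_cat -catA.
  congr (_ ++ _); case: d => [d|].
    rewrite -[LHS]/(TokBit T q false :: TokBit T q false ::
      expand_all p x ((lit_bits d ++ [:: InsPath T q]) ++ [:: Lit (TokEnd T q)])).
    rewrite !expand_all_cat expand_lit_bits /= map_cat; do 2 congr (_ :: _).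
    by rewrite -[expand_all p x [:: InsPath T q]]/(bit_tokens T q p ++ [::]) cats0.
  by rewrite -[LHS]/(TokBit T q false :: TokBit T q true :: bit_tokens T q x ++ [:: TokEnd T q]).
- by rewrite -IH.
- by rewrite -IH1 -IH2 -expand_all_cat.
Qed.

Lemma expand_items p x E : expand_all p x (items E) = encode (instantiate E p x).
Proof.
elim: E => //= -[u1 u2] E IH.
rewrite -[items _]/((Lit (TokEq T q) :: items_term u1 ++ items_term u2) ++ items E).
rewrite expand_all_cat IH -cat1s !expand_all_cat !expand_items_term.
by rewrite /encode /= -!catA.
Qed.

End Templates.

(** * Correctness of the translation of ring systems *)

Section Reduction.
Variables (R : nzRingType) (G : groupType) (V : finType).
Variables (X : (V -> G) -> Prop) (phi : (V -> G) -> R).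
Local Notation RS := ring_signature.
Local Notation GS := group_signature.
Local Notation MR := (ring_structure R).
Local Notation MG := (group_structure G).
Variables (r : nat) (s : r.-tuple R) (q : nat) (t : q.-tuple G).

Local Notation template := (system GS 'I_q slot).

Variable closed : G -> term GS 'I_q void.
Hypothesis closedE : forall g, eval (M := MG) (tnth t) (of_void _) (closed g) = g.
Variable rep : R -> V -> G.
Hypothesis repX : forall x, X (rep x).
Hypothesis repK : forall x, phi (rep x) = x.

Definition ground (g : G) : term GS 'I_q slot :=
  tsub (@Coef _ _ _) (of_void _) (closed g).

Lemma eval_ground (v : slot -> G) g : eval (M := MG) (tnth t) v (ground g) = g.
Proof. by rewrite eval_tsub -[RHS]closedE; apply: eval_ext => // -[]. Qed.

(** The first [#|V|] variables of a node form the tuple naming the value of its subterm; the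
    witnesses of its equations follow. *)
Definition mk_template (U W : finType) (E : system GS MG (U + W))
    (pl : U -> term GS 'I_q slot) : template :=
  ssub ground (sumf pl (fun w =>
    Var GS 'I_q (Some [::], #|V| + enum_rank w) : term GS 'I_q slot)) E.

Lemma satisfies_template (U W : finType) (E : system GS MG (U + W)) pl
    (sg : bitseq -> G) p x :
  satisfies (M := MG) (tnth t) sg (instantiate (mk_template E pl) p x) <->
  satisfies (M := MG) id (sumf (fun u => eval (M := MG) (tnth t) (fun v => sg (name p x v)) (pl u))
    (fun w => sg (name p x (Some [::], #|V| + enum_rank w)))) E.
Proof.
split=> [/satisfies_ssub/satisfies_ssub sat|sat].
  by apply: (eq_satisfies sat) => [g|[]] //=; rewrite eval_ground.
do 2 apply/satisfies_ssub.
by apply: (eq_satisfies sat) => [g|[]] //=; rewrite eval_ground.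
Qed.

Definition place (d : bitseq) (v : V) : term GS 'I_q slot :=
  Var GS 'I_q (Some d, enum_rank v : nat).
Definition user (v : V) : term GS 'I_q slot :=
  Var GS 'I_q (None, enum_rank v : nat).

Definition node (sg : bitseq -> G) (p : bitseq) : V -> G :=
  fun v => sg (name p [::] (Some [::], enum_rank v : nat)).
Definition user_val (sg : bitseq -> G) (x : bitseq) : V -> G :=
  fun v => sg (name [::] x (None, enum_rank v : nat)).

Variables (W1 W2 W3 : finType).
Variables (Eeq : system GS MG (V + V + W1)) (Eadd : system GS MG (V + (V + V) + W2))
  (Emul : system GS MG (V + (V + V) + W3)).
Hypothesis EeqP : forall a : V + V -> G,
  [/\ X (a \o inl), X (a \o inr) & phi (a \o inl) = phi (a \o inr)] <->
  exists y : W1 -> G, satisfies (M := MG) id (sumf a y) Eeq.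
Hypothesis EaddP : forall a : V + (V + V) -> G,
  [/\ X (a \o inl), X (a \o inr \o inl), X (a \o inr \o inr)
    & (phi (a \o inl) + phi (a \o inr \o inl))%R = phi (a \o inr \o inr)] <->
  exists y : W2 -> G, satisfies (M := MG) id (sumf a y) Eadd.
Hypothesis EmulP : forall a : V + (V + V) -> G,
  [/\ X (a \o inl), X (a \o inr \o inl), X (a \o inr \o inr)
    & (phi (a \o inl) * phi (a \o inr \o inl))%R = phi (a \o inr \o inr)] <->
  exists y : W3 -> G, satisfies (M := MG) id (sumf a y) Emul.

Definition const (a : V -> G) (v : V) : term GS 'I_q slot := ground (a v).

(** The opposite is expressed by a sum equal to 0, so the definable relations of equality, sum and
    product are enough. Each occurrence of a variable has its own tuple, tied by [Eeq] to the tuple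
    shared by all occurrences. *)
Definition token_template (a : token RS r) : template :=
  match a with
  | TokBit _ | TokEnd => mk_template Eeq (sumf (place [::]) user)
  | TokEq => mk_template Eeq (sumf (place [:: false; false]) (place [:: true; false]))
  | TokGen i => mk_template Eeq (sumf (place [::]) (const (rep (tnth s i))))
  | TokOp0 b => mk_template Eeq (sumf (place [::]) (const (rep (op0 (s := MR) b))))
  | TokOp1 _ => mk_template Eadd
      (sumf (place [:: true]) (sumf (place [::]) (const (rep 0%R))))
  | TokOp2 b =>
      let pl := sumf (place [:: false]) (sumf (place [:: true]) (place [::])) in
      if b then mk_template Emul pl else mk_template Eadd pl
  end.

Fixpoint translate_term (u : term RS 'I_r bitseq) (p : bitseq) : instance GS q :=
  match u with
  | Var x => instantiate (token_template (TokEnd RS r)) p x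
  | Coef i => instantiate (token_template (TokGen RS i)) p [::]
  | Op0 o => instantiate (token_template (TokOp0 r o)) p [::]
  | Op1 o u1 => instantiate (token_template (TokOp1 r o)) p [::] ++ translate_term u1 (true :: p)
  | Op2 o u1 u2 => instantiate (token_template (TokOp2 r o)) p [::] ++
      translate_term u1 (false :: p) ++ translate_term u2 (true :: p)
  end.

(* An equation is a node whose first child carries its two sides and whose second
   child is the rest of the system. *)
Fixpoint translate (E : instance RS r) (p : bitseq) : instance GS q :=
  if E is (u1, u2) :: E' then
    instantiate (token_template (TokEq RS r)) p [::] ++
    translate_term u1 [:: false, false & p] ++
    translate_term u2 [:: true, false & p] ++ translate E' (true :: p)
  else [::].

Lemma encode_translate E p :
  encode (translate E p) = out_system (fun a => items (token_template a)) E p.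
Proof.
have encT u p' : encode (translate_term u p') =
    out_term (fun a => items (token_template a)) u p'.
  elim: u p' => [x|i|o|o u IH|o u1 IH1 u2 IH2] p'; rewrite [LHS]/= ?encode_cat -?expand_items //.
    by rewrite IH.
  by rewrite IH1 IH2.
elim: E p => [|[u1 u2] E IH] p //.
by rewrite [LHS]/= !encode_cat -expand_items !encT IH.
Qed.

Lemma sumf_eta2 (A B C : Type) (f : A -> C) (g : B -> C) :
  (sumf f g \o inl = f) * (sumf f g \o inr = g).
Proof. by []. Qed.

Section Soundness.
Variable sg : bitseq -> G.
Local Notation sat := (satisfies (M := MG) (tnth t) sg).
Local Notation ev x := (phi (user_val sg x)).

Lemma sat_eq p x (pl pl' : V -> term GS 'I_q slot) :
  let e u := eval (M := MG) (tnth t) (fun v => sg (name p x v)) u in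
  sat (instantiate (mk_template Eeq (sumf pl pl')) p x) ->
  [/\ X (e \o pl), X (e \o pl') & phi (e \o pl) = phi (e \o pl')].
Proof.
move=> e /satisfies_template h.
by have /EeqP := ex_intro (fun y => satisfies (M := MG) id (sumf _ y) Eeq) _ h.
Qed.

Lemma sat_add p x (pl pl' pl2 : V -> term GS 'I_q slot) :
  let e u := eval (M := MG) (tnth t) (fun v => sg (name p x v)) u in
  sat (instantiate (mk_template Eadd (sumf pl (sumf pl' pl2))) p x) ->
  [/\ X (e \o pl), X (e \o pl'), X (e \o pl2)
    & (phi (e \o pl) + phi (e \o pl'))%R = phi (e \o pl2)].
Proof.
move=> e /satisfies_template h.
by have /EaddP := ex_intro (fun y => satisfies (M := MG) id (sumf _ y) Eadd) _ h.
Qed.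

Lemma sat_mul p x (pl pl' pl2 : V -> term GS 'I_q slot) :
  let e u := eval (M := MG) (tnth t) (fun v => sg (name p x v)) u in
  sat (instantiate (mk_template Emul (sumf pl (sumf pl' pl2))) p x) ->
  [/\ X (e \o pl), X (e \o pl'), X (e \o pl2)
    & (phi (e \o pl) * phi (e \o pl'))%R = phi (e \o pl2)].
Proof.
move=> e /satisfies_template h.
by have /EmulP := ex_intro (fun y => satisfies (M := MG) id (sumf _ y) Emul) _ h.
Qed.

Lemma const_eval p x a :
  (fun u => eval (M := MG) (tnth t) (fun v => sg (name p x v)) u) \o const a = a.
Proof. by apply/funext => v /=; rewrite eval_ground. Qed.

Lemma translate_term_sound u p : sat (translate_term u p) ->
  X (node sg p) /\ phi (node sg p) = eval (M := MR) (tnth s) (fun x => ev x) u.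
Proof.
elim: u p => [x|i|o|o u IH|o u1 IH1 u2 IH2] p /=.
- by move=> /sat_eq[].
- by move=> /sat_eq[? _]; rewrite const_eval repK.
- by move=> /sat_eq[? _]; rewrite const_eval repK.
- move=> /satisfies_cat[/sat_add[_ Xp _ e] /IH[_ <-]]; split=> //.
  by move: e; rewrite const_eval repK => /eqP; rewrite addrC addr_eq0 => /eqP.
- move=> /satisfies_cat[h /satisfies_cat[/IH1[_ <-] /IH2[_ <-]]].
  by case: o h => [/sat_mul[]|/sat_add[]].
Qed.

Lemma translate_sound E p : sat (translate E p) ->
  satisfies (M := MR) (tnth s) (fun x => ev x) E.
Proof.
elim: E p => [|[u1 u2] E IH] p //=.
move=> /satisfies_cat[/sat_eq[_ _ e] /satisfies_cat[/translate_term_sound[_ e1]]].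
move=> /satisfies_cat[/translate_term_sound[_ e2] /IH]; split=> //.
by rewrite -e1 -e2.
Qed.

End Soundness.

Definition node_values (W : finType) (a : V -> G) (y : W -> G) (j : nat) : G :=
  if insub j is Some k then a (enum_val (k : 'I_#|V|))
  else if insub (j - #|V|) is Some k then y (enum_val (k : 'I_#|W|)) else 1%g.

Lemma node_values_node (W : finType) a (y : W -> G) v : node_values a y (enum_rank v) = a v.
Proof. by rewrite /node_values valK enum_rankK. Qed.

Lemma node_values_aux (W : finType) a (y : W -> G) w :
  node_values a y (#|V| + enum_rank w) = y w.
Proof.
rewrite /node_values insubF ?ltnNge ?leq_addr // addKn valK enum_rankK.
by [].
Qed.

(** [l] descends from the node at [p], while paths are innermost first: hence [catrev]. Relative
    addresses let assignments be built before the position of a subterm is known. *)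
Definition agree (de : bitseq -> nat -> G) (sg : bitseq -> G) (p : bitseq) : Prop :=
  forall l j, sg (name (catrev l p) [::] (Some [::], j)) = de l j.

Section Completeness.
Variable v : bitseq -> R.

Definition users (sg : bitseq -> G) : Prop := forall x, user_val sg x = rep (v x).

Lemma template_complete (U W : finType) (E : system GS MG (U + W)) pl
    (a : V -> G) (b : U -> G) (y : W -> G) de sg p x :
  satisfies (M := MG) id (sumf b y) E -> agree de sg p ->
  de [::] = node_values a y ->
  (forall u, eval (M := MG) (tnth t) (fun v => sg (name p x v)) (pl u) = b u) ->
  satisfies (M := MG) (tnth t) sg (instantiate (mk_template E pl) p x).
Proof.
move=> sat ag deE plE; apply/satisfies_template.
apply: (eq_satisfies sat) => // -[u|w] /=; first by rewrite plE.
by have := ag [::] (#|V| + enum_rank w); rewrite deE node_values_aux => <-.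
Qed.

Definition branch (n0 : nat -> G) (d0 d1 : bitseq -> nat -> G) (l : bitseq) : nat -> G :=
  match l with [::] => n0 | b :: l' => if b then d1 l' else d0 l' end.

(** Distinct nodes have distinct names, so the assignments of the subterms and the witnesses of the
    root are chosen independently and glued by [branch]. *)
Lemma translate_term_complete u :
  exists de, (forall k, de [::] (enum_rank k : nat) =
      rep (eval (M := MR) (tnth s) v u) k) /\
    forall sg p, agree de sg p -> users sg ->
      satisfies (M := MG) (tnth t) sg (translate_term u p).
Proof.
pose dummy (l : bitseq) (j : nat) : G := 1%g.
have leaf (z : R) (pl : V -> term GS 'I_q slot) : exists de : bitseq -> nat -> G,
    (forall k, de [::] (enum_rank k : nat) = rep z k) /\
    forall sg p x, agree de sg p ->
      (forall k, eval (M := MG) (tnth t) (fun v => sg (name p x v)) (pl k) = rep z k) ->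
      satisfies (M := MG) (tnth t) sg (instantiate (mk_template Eeq (sumf (place [::]) pl)) p x).
  have [y sat] : exists y, satisfies (M := MG) id (sumf (sumf (rep z) (rep z)) y) Eeq.
    by apply/EeqP; split; rewrite ?sumf_eta2.
  exists (branch (node_values (rep z) y) dummy dummy); split.
    by move=> k; apply: node_values_node.
  move=> sg p x ag plE; apply: (template_complete sat ag) => // -[k|k] //=.
  by have := ag [::] (enum_rank k); rewrite /= node_values_node.
elim: u => [x|i|o|o u [de [deE IH]]|o u1 [de1 [de1E IH1]] u2 [de2 [de2E IH2]]].
- have [de [deE h]] := leaf (v x) user; exists de; split=> // sg p ag us.
  by apply: h => // k; rewrite -us.
- have [de [deE h]] := leaf (tnth s i) (const (rep (tnth s i))); exists de; split=> // sg p ag us.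
  by apply: h => // k; rewrite /= eval_ground.
- have [de [deE h]] := leaf (op0 (s := MR) o) (const (rep (op0 (s := MR) o))).
  exists de; split=> // sg p ag us.
  by apply: h => // k; rewrite /= eval_ground.
- set z := eval (M := MR) (tnth s) v u in deE.
  have [y sat] : exists y, satisfies (M := MG) id
      (sumf (sumf (rep z) (sumf (rep (- z)%R) (rep 0%R))) y) Eadd.
    by apply/EaddP; split; rewrite ?sumf_eta2 //= !repK subrr.
  exists (branch (node_values (rep (- z)%R) y) dummy de); split.
    by move=> k; apply: node_values_node.
  move=> sg p ag us; apply/satisfies_cat; split; last first.
    by apply: IH => // l j; have := ag (true :: l) j.
  apply: (template_complete sat ag) => // -[k|[k|k]] /=.
  + by rewrite -deE; have := ag [:: true] (enum_rank k).
  + by have := ag [::] (enum_rank k); rewrite /= node_values_node.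
  + by rewrite eval_ground.
- set z1 := eval (M := MR) (tnth s) v u1 in de1E; set z2 := eval (M := MR) (tnth s) v u2 in de2E.
  pose z : R := op2 (s := MR) o z1 z2.
  have common (W : finType) (E : system GS MG (V + (V + V) + W)) y :
      satisfies (M := MG) id (sumf (sumf (rep z1) (sumf (rep z2) (rep z))) y) E ->
      exists de, (forall k, de [::] (enum_rank k : nat) = rep z k) /\
        forall sg p, agree de sg p -> users sg ->
        satisfies (M := MG) (tnth t) sg (instantiate (mk_template E
          (sumf (place [:: false]) (sumf (place [:: true]) (place [::])))) p [::] ++
          translate_term u1 (false :: p) ++ translate_term u2 (true :: p)).
    move=> sat; exists (branch (node_values (rep z) y) de1 de2); split.
      by move=> k; apply: node_values_node.
    move=> sg p ag us; apply/satisfies_cat; split.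
      apply: (template_complete sat ag) => // -[k|[k|k]] /=.
      + by rewrite -de1E; have := ag [:: false] (enum_rank k).
      + by rewrite -de2E; have := ag [:: true] (enum_rank k).
      + by have := ag [::] (enum_rank k); rewrite /= node_values_node.
    apply/satisfies_cat; split; [apply: IH1 | apply: IH2] => // l j.
      by have := ag (false :: l) j.
    by have := ag (true :: l) j.
  case: o @z common => z common.
    have [y sat] : exists y, satisfies (M := MG) id
        (sumf (sumf (rep z1) (sumf (rep z2) (rep z))) y) Emul.
      by apply/EmulP; split; rewrite ?sumf_eta2 //= !repK.
    exact: common sat.
  have [y sat] : exists y, satisfies (M := MG) id
      (sumf (sumf (rep z1) (sumf (rep z2) (rep z))) y) Eadd.
    by apply/EaddP; split; rewrite ?sumf_eta2 //= !repK.
  exact: common sat.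
Qed.

Lemma translate_complete E : satisfies (M := MR) (tnth s) v E ->
  exists de, forall sg p, agree de sg p -> users sg ->
    satisfies (M := MG) (tnth t) sg (translate E p).
Proof.
elim: E => [_|[u1 u2] E IH [eu /IH[de deP]]]; first by exists (fun _ _ => 1%g).
have [de1 [de1E h1]] := translate_term_complete u1.
have [de2 [de2E h2]] := translate_term_complete u2.
set z1 := eval _ _ u1 in de1E eu; set z2 := eval _ _ u2 in de2E eu.
have [y sat] : exists y, satisfies (M := MG) id (sumf (sumf (rep z1) (rep z2)) y) Eeq.
  by apply/EeqP; split; rewrite ?sumf_eta2 // !repK.
exists (branch (node_values (rep z1) y) (branch (fun=> 1%g) de1 de2) de).
move=> sg p ag us; apply/satisfies_cat; split.
  apply: (template_complete sat ag) => // -[k|k] /=.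
  + by rewrite -de1E; have := ag [:: false; false] (enum_rank k).
  + by rewrite -de2E; have := ag [:: false; true] (enum_rank k).
apply/satisfies_cat; split.
  by apply: h1 => // l j; have := ag [:: false, false & l] j.
apply/satisfies_cat; split.
  by apply: h2 => // l j; have := ag [:: false, true & l] j.
by apply: deP => // l j; have := ag (true :: l) j.
Qed.

End Completeness.

Lemma translate_correct E :
  has_solution (M := MR) s E <-> has_solution (M := MG) t (translate E [::]).
Proof.
split=> [[v /translate_complete[de h]]|[sg sat]]; last first.
  by exists (fun x => phi (user_val sg x)); apply: translate_sound sat.
(* [sg] decodes a name: the unary prefix gives the index [j], and the next bit tells a path from the
   name of an input variable. Words that are no names get 1. *)
pose sg (w : bitseq) : G :=
  let j := index false w in
  match drop j.+1 w with
  | true :: x => if insub j is Some k then rep (v x) (enum_val (k : 'I_#|V|)) else 1%g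
  | false :: l => de (rev l) j
  | [::] => 1%g
  end.
have idx j w : index false (nseq j true ++ false :: w) = j.
  by elim: j => //= j ->.
have drp j w : drop j.+1 (nseq j true ++ false :: w) = w.
  by elim: j => //=; rewrite drop0.
exists sg; apply: h.
  by move=> l j; rewrite /sg /name idx drp -/(rev _) revK.
move=> x; apply/funext => k; rewrite /user_val /sg /name idx drp valK.
by rewrite enum_rankK.
Qed.

End Reduction.

Theorem interpretation_dioph_reducible (R : nzRingType) (G : groupType) (V : finType)
    (X : (V -> G) -> Prop) (phi : (V -> G) -> R) :
  interpretation X phi -> dioph_reducible (ring_structure R) (group_structure G).
Proof.
move=> [_ surj [W1 [Eeq EeqP]] [W2 [Eadd EaddP]] [W3 [Emul EmulP]]] r s q t _ gen_t.
have /choice[closed closedE] := gen_t.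
have /choice[rep repP] x : exists a, X a /\ phi a = x.
  by have [a Xa ax] := surj x; exists a.
exists ((translate s closed rep Eeq Eadd Emul)^~ [::]); split.
  apply: out_system_polynomial_time (fun E => encode_translate _ _ _ _ _ _ _ _) => //.
by move=> E; apply: (translate_correct s closedE _ _ EeqP EaddP EmulP) => x; case: (repP x).
Qed.

Local Close Scope classical_set_scope.

Theorem theorem4p13 (G : groupType)
    (fgG : finitely_generated (group_structure G)) (i : nat) (i_gt0 : 0 < i) :
  (finite_verbal_width G i -> e_definable_in (as_unary (gamma G i))) /\
  (e_definable_in (as_unary (gamma G i)) ->
   ~ virtually_abelian (quotient_group (gamma_normal G i)) ->
   exists L : fieldExtType rat,
     e_interpretable (ring_of_integers L) G /\
     dioph_reducible (ring_structure (ring_of_integers L)) (group_structure G)).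
Proof.
split=> [|dg nva]; first exact: finite_verbal_width_definable.
have [L [V [X [phi int]]]] := number_ring_interpretable i_gt0 fgG dg nva.
exists L; split; first exact: interpretation_e_interpretable int.
exact: interpretation_dioph_reducible int.
Qed.
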